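(* Suppose that the following assumptions hold, where $G(h)=\mathbb{E}[g(X,h)]$ and $\theta$ is the unique zero of $\nabla G$. (i) There exists $C>0$ such that for all $h\in\mathbb{R}^d$, $\mathbb{E}\left[\|\nabla_hg(X,h)\|^2\right]\le C\left(1+G(h)-G(\theta)\right)$. (ii) $G$ is twice continuously differentiable, $\nabla^2G(\theta)$ is positive definite, and there is $L_{\nabla G}>0$ such that $\|\nabla^2G(h)\|_{op}\le L_{\nabla G}$ for all $h\in\mathbb{R}^d$. (iii) There exist $r>0$ and $L_r>0$ such that $\|\nabla^2G(h)-\nabla^2G(\theta)\|_{op}\le L_r\|\theta-h\|$ for all $h\in\mathcal{B}(\theta,r)$. (iv) There exist $q>2$ and $C_q$ such that $\mathbb{E}\left[\|\nabla_h^2g(X,h)\|_F^q\right]\le C_q$ for all $h\in\mathbb{R}^d$. Suppose also that $\frac{1-\gamma}{q-1}<\beta<\gamma-\frac12$, $\gamma+\nu>\frac32$, $\nu\in(\frac12,1-\beta)$ and $\beta'\in(1-\gamma,\gamma-2\beta)$. Let $\theta_n$ and $\theta_{n,\tau'}$ be the iterates of the Universal Weighted Averaged Stochastic Newton algorithm defined in the context. Then $$\theta_n\xrightarrow[n\to\infty]{a.s.}\theta\quad\text{and}\quad\theta_{n,\tau'}\xrightarrow[n\to\infty]{a.s.}\theta.$$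
   Context: Setting. $X$ is a random vector of $\mathbb{R}^p$ and $g:\mathbb{R}^p\times\mathbb{R}^d\to\mathbb{R}$ is such that $g(X,\cdot)$ is convex. For every $h\in\mathbb{R}^d$ there is $\Omega_h\subseteq\mathbb{R}^p$ with $\mathbb{P}[X\in\Omega_h]=1$ such that for all $x\in\Omega_h$, $g(x,\cdot)$ is twice differentiable at $h$; $\nabla_hg$ and $\nabla_h^2g$ denote the gradient and Hessian in the second variable. $G:\mathbb{R}^d\to\mathbb{R}$, $G(h)=\mathbb{E}[g(X,h)]$, is convex, with $\nabla G(h)=\mathbb{E}[\nabla_hg(X,h)]$ and $\nabla^2G(h)=\mathbb{E}[\nabla_h^2g(X,h)]$, and there is a unique $\theta\in\mathbb{R}^d$ with $\nabla G(\theta)=0$. Norms. $\|\cdot\|$ is the Euclidean norm, $\|\cdot\|_{op}$ and $\|\cdot\|_F$ are the spectral and Frobenius norms of matrices. $\mathcal{B}(\theta,r)$ is the ball of radius $r$ centered at $\theta$. Data. $(X_n)_{n\ge1}$ are i.i.d. copies of $X$. $(Z_n)_{n\ge1}$ are i.i.d. random vectors of $\mathbb{R}^d$, independent of $(X_n)$, bounded ($\|Z_n\|\le M$ for a constant $M$), with $\mathbb{E}[Z_n]=0$ and $\mathbb{E}[Z_nZ_n^T]=I_d$. Parameters. $\gamma_n=c_\gamma n^{-\gamma}$ with $c_\gamma>0$, $\frac12<\gamma<1$; $\nu_n=c_\nu n^{-\nu}$ with $c_\nu>0$; $\beta_n=c_\beta n^\beta$ with $c_\beta>0$ and $\gamma_n\beta_n\le\frac12$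 for all $n\ge1$; $\beta_n'=c_\beta'n^{\beta'}$ with $c'_\beta>0$ and $\gamma_n^2\beta_n^2\beta_n'\le\gamma_n$ for all $n\ge1$; $\tau,\tau'\ge0$. Algorithm. $\Pi_{\beta_n'}$ denotes the projection (for the Frobenius norm) onto the ball of $d\times d$ matrices of Frobenius norm at most $\beta_n'$ centered at $0$. $\theta_0\in\mathbb{R}^d$ is arbitrary, $A_0$ is an arbitrary symmetric positive definite matrix, $\theta_{0,\tau'}=\theta_0$, $A_{0,\tau}=A_0$, and for $n\ge1$ (with $0^0=1$) $$P_n=A_{n-1}Z_n,\qquad Q_n=\nabla_h^2g(X_n,\theta_{n-1,\tau'})Z_n,$$ $$\theta_n=\theta_{n-1}-\nu_nA_{n-1,\tau}\nabla_hg(X_n,\theta_{n-1}),$$ $$\theta_{n,\tau'}=\left(1-\frac{(\ln(n+1))^{\tau'}}{\sum_{k=0}^n(\ln(k+1))^{\tau'}}\right)\theta_{n-1,\tau'}+\frac{(\ln(n+1))^{\tau'}}{\sum_{k=0}^n(\ln(k+1))^{\tau'}}\theta_n,$$ $$A_n=\Pi_{\beta_n'}\left(A_{n-1}-\gamma_n\left(P_nQ_n^T+Q_nP_n^T-2I_d\right)\mathbf{1}_{\{\|Q_n\|\|Z_n\|\le\beta_n\}}\right),$$ $$A_{n,\tau}=\left(1-\frac{(\ln(n+1))^\tau}{\sum_{k=0}^n(\ln(k+1))^\tau}\right)A_{n-1,\tau}+\frac{(\ln(n+1))^\tau}{\sum_{k=0}^n(\ln(k+1))^\tau}A_n.$$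 *)

(* Defs.v *)
From HB Require Import structures.
From mathcomp Require Import all_boot all_order all_algebra finmap.
From mathcomp Require Import all_classical all_reals all_analysis.
Set Implicit Arguments.
Unset Strict Implicit.
Unset Printing Implicit Defensive.
Import Order.TTheory GRing.Theory Num.Theory.
Import numFieldNormedType.Exports.

Local Open Scope classical_set_scope.
Local Open Scope ring_scope.

(* The sigma-algebra on matrices (in particular on column vectors) is the one
   generated by the coordinate maps, as the library does for [n.-tuple T]; it is
   the Borel sigma-algebra. *)
Section measurable_matrix.
Context {R : realType} (m n : nat).

Definition mx_measurable : set (set 'M[R]_(m, n)) :=
  <<s \bigcup_(ij in [set: 'I_m * 'I_n])
        preimage_set_system setT (fun A : 'M[R]_(m, n) => A ij.1 ij.2)
          (@measurable _ R) >>.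

Let mx_measurable0 : mx_measurable set0.
Proof. exact: sigma_algebra0. Qed.

Let mx_measurableC A : mx_measurable A -> mx_measurable (~` A).
Proof. exact: sigma_algebraC. Qed.

Let mx_measurable_bigcup (F : (set 'M[R]_(m, n))^nat) :
  (forall i, mx_measurable (F i)) -> mx_measurable (\bigcup_i (F i)).
Proof. exact: sigma_algebra_bigcup. Qed.

HB.instance Definition _ := @isMeasurable.Build default_measure_display
  'M[R]_(m, n) mx_measurable mx_measurable0 mx_measurableC mx_measurable_bigcup.

End measurable_matrix.

(* The library norm [`|A|] on matrices is the sup norm, hence the definitions
   below. *)
Section norms.
Context {R : realType}.

Definition norm2 n (x : 'cV[R]_n) : R := Num.sqrt (\sum_i x i ord0 ^+ 2).

Definition normF m n (A : 'M[R]_(m, n)) : R :=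
  Num.sqrt (\sum_i \sum_j A i j ^+ 2).

Definition normop m n (A : 'M[R]_(m, n)) : R :=
  sup [set norm2 (A *m x) | x in [set x : 'cV[R]_n | norm2 x <= 1]].

Definition posdefmx n (A : 'M[R]_n) : Prop :=
  A^T = A /\ forall x : 'cV[R]_n, x != 0 -> 0 < (x^T *m A *m x) ord0 ord0.

(* [B] is a point of [K] nearest to [A] for the Frobenius norm *)
Definition nearest_point m n (K : set 'M[R]_(m, n)) (A B : 'M[R]_(m, n)) : Prop :=
  K B /\ forall C, K C -> normF (A - B) <= normF (A - C).

(* [xget 0] is only a total way to name the nearest point, which exists and is
   unique for [0 <= b]. *)
Definition projF n (b : R) (A : 'M[R]_n) : 'M[R]_n :=
  xget 0 (nearest_point [set C | normF C <= b] A).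

End norms.

Section second_order.
Context {R : realType} {d : nat}.
Implicit Types (f : 'cV[R]_d -> R) (h : 'cV[R]_d).

Definition gradient f h : 'cV[R]_d := \col_i 'D_(delta_mx i ord0) f h.

Definition hessian f h : 'M[R]_d :=
  \matrix_(i, j) 'D_(delta_mx j ord0) (fun y => gradient f y i ord0) h.

Definition twice_differentiable f h : Prop :=
  (\forall y \near h, differentiable f y) /\ differentiable (gradient f) h.

Definition convex_fun f : Prop :=
  convex_function [set: convex_lmodType 'cV[R]_d] f.

End second_order.

Section probability.
Context {dT : measure_display} {T : measurableType dT} {R : realType}
  (P : probability T R).

Definition has_expectation (Y : T -> R) (a : R) : Prop :=
  P.-integrable setT (fun w => (Y w)%:E) /\ 'E_P[Y]%E = a%:E.

Definition has_expectation_mx m n (Y : T -> 'M[R]_(m, n)) (M : 'M[R]_(m, n)) :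
  Prop := forall i j, has_expectation (fun w => Y w i j) (M i j).

Definition same_law d (U : measurableType d) (Y Y' : T -> U) : Prop :=
  forall A, measurable A -> P (Y @^-1` A) = P (Y' @^-1` A).

Definition mutually_independent d (U : measurableType d) (Y : nat -> T -> U) :
  Prop :=
  forall (J : {fset nat}) (A : nat -> set U), (forall j, measurable (A j)) ->
    P (\bigcap_(j in [set` J]) (Y j @^-1` A j)) =
    (\prod_(j <- J) P (Y j @^-1` A j))%E.

Definition sigma_of_process d (U : measurableType d) (Y : nat -> T -> U) :
  set (set T) :=
  <<s \bigcup_n preimage_set_system setT (Y n) measurable >>.

Definition independent_processes d d' (U : measurableType d)
    (V : measurableType d') (Y : nat -> T -> U) (Z : nat -> T -> V) : Prop :=
  forall A B, sigma_of_process Y A -> sigma_of_process Z B ->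
    P (A `&` B) = (P A * P B)%E.

End probability.

Section algorithm.
Context {R : realType} {p d : nat}.

(* n |-> c n^a *)
Definition power_seq (c a : R) (n : nat) : R := c * n%:R `^ a.

(* [powR] satisfies [0 `^ 0 = 1] and [0 `^ t = 0] for [t != 0]. *)
Definition log_weight (t : R) (n : nat) : R :=
  ln n.+1%:R `^ t / \sum_(0 <= k < n.+1) ln k.+1%:R `^ t.

Record uwasn_state := UWASNState {
  est : 'cV[R]_d ;      (* theta_n *)
  est_avg : 'cV[R]_d ;  (* theta_(n,tau') *)
  hinv : 'M[R]_d ;       (* A_n *)
  hinv_avg : 'M[R]_d     (* A_(n,tau) *)
}.

(* The samples are indexed from 0: [x n] and [z n] are the X_(n+1) and Z_(n+1)
   used to go from step [n] to step [n.+1].  The step sequences keep the usual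
   indexing from 1. *)
Fixpoint uwasn (Dg : 'cV[R]_p -> 'cV[R]_d -> 'cV[R]_d)
    (D2g : 'cV[R]_p -> 'cV[R]_d -> 'M[R]_d)
    (gamma nu beta beta' : nat -> R) (tau tau' : R)
    (theta0 : 'cV[R]_d) (A0 : 'M[R]_d)
    (x : nat -> 'cV[R]_p) (z : nat -> 'cV[R]_d) (n : nat) : uwasn_state :=
  match n with
  | 0 => UWASNState theta0 theta0 A0 A0
  | m.+1 =>
    let s := uwasn Dg D2g gamma nu beta beta' tau tau' theta0 A0 x z m in
    let P := hinv s *m z m in
    let Q := D2g (x m) (est_avg s) *m z m in
    let theta := est s - nu n *: (hinv_avg s *m Dg (x m) (est s)) in
    let theta_avg :=
      (1 - log_weight tau' n) *: est_avg s + log_weight tau' n *: theta in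
    let A := projF (beta' n)
      (hinv s - (gamma n * (norm2 Q * norm2 (z m) <= beta n)%R%:R) *:
                 (P *m Q^T + Q *m P^T - 2%:M)) in
    let A_avg :=
      (1 - log_weight tau n) *: hinv_avg s + log_weight tau n *: A in
    UWASNState theta theta_avg A A_avg
  end.

End algorithm.

(* Main.v *)
(* Both parts of the algorithm are almost supermartingales. Conditional
   expectations are avoided: "E[U_(n+1) | F_n] <= (1 + a_n) U_n + b_n - D_n" is
   the inequality of the integrals over every event of F_n, and the expectation
   over the samples used at step n is computed with the state of the algorithm
   frozen, by independence.

   Inverse Hessian. With Phi_n the product of the matrices I - e_k Q_k Z_k^T,
   e_k = gamma_k or 0 according to the truncation, one gets that |Phi_n| is
   bounded, that the sum of the gamma_k - e_k is finite and that
   |A_n| = O(n^kappa) for every kappa > 1 - gamma; here q, beta and beta' are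
   used, and the Hessian only through its sign and its moment of order q. On
   the other hand A_(n+1) is at least
   (I - e Q Z^T) A_n (I - e Q Z^T)^T + e I, up to the projection. Iterating from
   the possibly indefinite A_1, the negative part stays bounded, so that A_n is
   eventually nonnegative; since kappa < beta' the projection is eventually
   inactive, and e beta_n <= 1/2 then gives A_n >= k n^(-beta). The weighted
   averages inherit both bounds.

   Iterates. Expanding G to second order, (G(theta_n) - G(theta)) is an almost
   supermartingale on the events where the bounds on A_(n,tau) hold with a given
   constant, with D_n of order n^(-nu-beta) |grad G(theta_n)|^2. As
   nu + beta <= 1 and G is convex with a unique critical point, the gap has
   lower limit 0, hence limit 0, and theta_n converges to theta. *)

Require Import Defs.
From HB Require Import structures.
From mathcomp Require Import all_boot all_order all_algebra finmap.
From mathcomp Require Import all_classical all_reals all_analysis.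
From mathcomp Require Import measurable_realfun ring lra.
Set Implicit Arguments.
Unset Strict Implicit.
Unset Printing Implicit Defensive.
Import Order.TTheory GRing.Theory Num.Theory.
Import numFieldNormedType.Exports.

Local Open Scope classical_set_scope.
Local Open Scope ring_scope.

(** * Frobenius norm and projection *)

Section frobenius.
Context {R : realType}.

(** Why the products Phi_n stay bounded although Q Z^T has no symmetry: given the past, Q Z^T has
    the Hessian of G as its mean, which is positive semidefinite, so the squared Frobenius norm has
    a nonpositive drift up to terms of order gamma_n^2 and up to the truncation error, of order
    gamma_n beta_n^(1-q). The latter is summable exactly because 1 - gamma < beta (q - 1). The same
    drift controls A_n, except that the increment 2 gamma_n I contributes a term linear in |A_n|;
    absorbing it costs the exponent kappa > 1 - gamma.

    The bounds obtained for A_n have random constants, which cannot enter an inequality between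
    integrals. The study of the iterates is therefore done once for each integer j, on events that
    are known before the next sample is drawn, and the countably many null sets are discarded
    together.

    Three constraints meet in kappa: above 1 - gamma for the growth bound, below beta' so that the
    projection becomes inactive, below nu - 1/2 so that the second-order terms are summable. Such a
    kappa exists because 1 - gamma < beta' and gamma + nu > 3/2. *)

Definition mxdot m n (A B : 'M[R]_(m, n)) : R := \sum_i \sum_j A i j * B i j.

Lemma mxdotE m n (A B : 'M[R]_(m, n)) : mxdot A B = \tr (A^T *m B).
Proof.
rewrite /mxtrace /mxdot exchange_big; apply: eq_bigr => j _; rewrite mxE.
by apply: eq_bigr => i _; rewrite mxE.
Qed.

Lemma mxdotC m n (A B : 'M[R]_(m, n)) : mxdot A B = mxdot B A.
Proof. by apply: eq_bigr => i _; apply: eq_bigr => j _; rewrite mulrC. Qed.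

Lemma mxdotDl m n (A B C : 'M[R]_(m, n)) :
  mxdot (A + B) C = mxdot A C + mxdot B C.
Proof. by rewrite !mxdotE linearD /= mulmxDl linearD. Qed.

Lemma mxdotDr m n (A B C : 'M[R]_(m, n)) :
  mxdot C (A + B) = mxdot C A + mxdot C B.
Proof. by rewrite mxdotC mxdotDl !(mxdotC C). Qed.

Lemma mxdotZl m n k (A B : 'M[R]_(m, n)) : mxdot (k *: A) B = k * mxdot A B.
Proof. by rewrite !mxdotE linearZ /= -scalemxAl linearZ. Qed.

Lemma mxdotZr m n k (A B : 'M[R]_(m, n)) : mxdot A (k *: B) = k * mxdot A B.
Proof. by rewrite mxdotC mxdotZl mxdotC. Qed.

Lemma mxdotNl m n (A B : 'M[R]_(m, n)) : mxdot (- A) B = - mxdot A B.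
Proof. by rewrite -scaleN1r mxdotZl mulN1r. Qed.

Lemma mxdotNr m n (A B : 'M[R]_(m, n)) : mxdot A (- B) = - mxdot A B.
Proof. by rewrite mxdotC mxdotNl mxdotC. Qed.

Lemma mxdot0l m n (A : 'M[R]_(m, n)) : mxdot 0 A = 0.
Proof. by rewrite -(scale0r 0) mxdotZl mul0r. Qed.

Lemma mxdot_mulmxl m n p (A : 'M[R]_(m, n)) (B : 'M[R]_(n, p)) C :
  mxdot (A *m B) C = mxdot B (A^T *m C).
Proof. by rewrite !mxdotE trmx_mul mulmxA. Qed.

Lemma mxdot_mulmxr m n p (A : 'M[R]_(m, n)) (B : 'M[R]_(n, p)) C :
  mxdot (A *m B) C = mxdot A (C *m B^T).
Proof. by rewrite !mxdotE trmx_mul -mulmxA mxtrace_mulC mulmxA. Qed.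

Lemma mxdot_trmx m n (A B : 'M[R]_(m, n)) : mxdot A^T B^T = mxdot A B.
Proof.
rewrite /mxdot exchange_big; apply: eq_bigr => i _; apply: eq_bigr => j _.
by rewrite !mxE.
Qed.

Lemma mxdot_ge0 m n (A : 'M[R]_(m, n)) : 0 <= mxdot A A.
Proof. by do 2!apply: sumr_ge0 => ? _; rewrite -expr2 sqr_ge0. Qed.

Lemma normF_ge0 m n (A : 'M[R]_(m, n)) : 0 <= normF A.
Proof. exact: sqrtr_ge0. Qed.

Lemma normF_sqr m n (A : 'M[R]_(m, n)) : normF A ^+ 2 = mxdot A A.
Proof.
rewrite /normF sqr_sqrtr; last by do 2!apply: sumr_ge0 => ? _; rewrite sqr_ge0.
by do 2!apply: eq_bigr => ? _; rewrite expr2.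
Qed.

Lemma norm2E n (x : 'cV[R]_n) : norm2 x = normF x.
Proof.
by congr Num.sqrt; apply: eq_bigr => i _; rewrite big_ord1 (ord1 ord0).
Qed.

Lemma normF_eq0 m n (A : 'M[R]_(m, n)) : (normF A == 0) = (A == 0).
Proof.
apply/eqP/eqP => [A0|->]; last first.
  by apply/eqP; rewrite -sqrf_eq0 normF_sqr mxdot0l.
have : mxdot A A == 0 by rewrite -normF_sqr A0 expr0n.
rewrite psumr_eq0; last first.
  by move=> i _; apply: sumr_ge0 => j _; rewrite -expr2 sqr_ge0.
move=> /allP H; apply/matrixP => i j; rewrite mxE.
have := H i; rewrite mem_index_enum => /(_ isT) /=.
rewrite psumr_eq0; last by move=> k _; rewrite -expr2 sqr_ge0.
move=> /allP /(_ j); rewrite mem_index_enum => /(_ isT) /=.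
by rewrite mulf_eq0 orbb => /eqP.
Qed.

Lemma normF0 m n : normF (0 : 'M[R]_(m, n)) = 0.
Proof. by apply/eqP; rewrite normF_eq0. Qed.

Lemma normFZ m n k (A : 'M[R]_(m, n)) : normF (k *: A) = `|k| * normF A.
Proof.
apply/eqP; rewrite -(@eqrXn2 _ 2) // ?mulr_ge0 ?normF_ge0 //.
by rewrite normF_sqr exprMn normF_sqr mxdotZl mxdotZr real_normK ?num_real// mulrA expr2.
Qed.

Lemma normFN m n (A : 'M[R]_(m, n)) : normF (- A) = normF A.
Proof. by rewrite -scaleN1r normFZ normrN1 mul1r. Qed.

Lemma normF_trmx m n (A : 'M[R]_(m, n)) : normF A^T = normF A.
Proof.
by apply/eqP; rewrite -(@eqrXn2 _ 2) ?normF_ge0 // !normF_sqr mxdot_trmx.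
Qed.

Lemma mxdot_sqr_le m n (A B : 'M[R]_(m, n)) :
  mxdot A B ^+ 2 <= mxdot A A * mxdot B B.
Proof.
have := mxdot_ge0 (mxdot B B *: A - mxdot A B *: B).
rewrite mxdotDl !mxdotDr !(mxdotNl, mxdotNr, mxdotZl, mxdotZr) (mxdotC B A).
have [->|/eqP B0] := eqVneq B 0.
  by move=> _; rewrite (mxdotC A 0) !mxdot0l mulr0 expr0n /=.
have : 0 < mxdot B B.
  rewrite lt_neqAle mxdot_ge0 andbT eq_sym -normF_sqr sqrf_eq0 normF_eq0.
  exact/eqP.
set a := mxdot A A; set b := mxdot B B; set c := mxdot A B => b0 H.
have : 0 <= b * (a * b - c ^+ 2) by nra.
by rewrite pmulr_rge0 // subr_ge0.
Qed.

Lemma mxdot_le m n (A B : 'M[R]_(m, n)) : `|mxdot A B| <= normF A * normF B.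
Proof.
rewrite -(@ler_pXn2r _ 2) ?nnegrE ?mulr_ge0 ?normF_ge0 //.
by rewrite real_normK ?num_real // exprMn !normF_sqr mxdot_sqr_le.
Qed.

Lemma normFD m n (A B : 'M[R]_(m, n)) : normF (A + B) <= normF A + normF B.
Proof.
rewrite -(@ler_pXn2r _ 2) ?nnegrE ?addr_ge0 ?normF_ge0 //.
rewrite sqrrD !normF_sqr mxdotDl !mxdotDr (mxdotC B A).
have := le_trans (ler_norm _) (mxdot_le A B); lra.
Qed.

Lemma normFB m n (A B : 'M[R]_(m, n)) : normF (A - B) <= normF A + normF B.
Proof. by rewrite -(normFN B) normFD. Qed.

Lemma normF_mulmx m n p (A : 'M[R]_(m, n)) (B : 'M[R]_(n, p)) :
  normF (A *m B) <= normF A * normF B.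
Proof.
rewrite -(@ler_pXn2r _ 2) ?nnegrE ?mulr_ge0 ?normF_ge0 // exprMn !normF_sqr.
rewrite -(mxdot_trmx B B) /mxdot mulr_suml; apply: ler_sum => i _.
rewrite mulr_sumr; apply: ler_sum => j _; rewrite -expr2.
have rowE k l (C D : 'M[R]_(k, l)) (a : 'I_k) :
    mxdot (row a C) (row a D) = \sum_j C a j * D a j.
  by rewrite /mxdot big_ord1; apply: eq_bigr => b _; rewrite !mxE.
rewrite -!rowE; have -> : (A *m B) i j = mxdot (row i A) (row j B^T).
  by rewrite mxE /mxdot big_ord1; apply: eq_bigr => b _; rewrite !mxE.
exact: mxdot_sqr_le.
Qed.

Lemma coord_le_normF m n (A : 'M[R]_(m, n)) i j : `|A i j| <= normF A.
Proof.
rewrite -(@ler_pXn2r _ 2) ?nnegrE ?normF_ge0 // real_normK ?num_real //.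
rewrite normF_sqr /mxdot (bigD1 i) //= (bigD1 j) //= -expr2 -addrA lerDl.
rewrite addr_ge0 //; first by apply: sumr_ge0 => k _; rewrite -expr2 sqr_ge0.
by do 2!apply: sumr_ge0 => ? _; rewrite -expr2 sqr_ge0.
Qed.

Definition quad n (A : 'M[R]_n) (x : 'cV[R]_n) : R := mxdot x (A *m x).

Lemma quadD n (A B : 'M[R]_n) x : quad (A + B) x = quad A x + quad B x.
Proof. by rewrite /quad mulmxDl mxdotDr. Qed.

Lemma quadZ n k (A : 'M[R]_n) x : quad (k *: A) x = k * quad A x.
Proof. by rewrite /quad -scalemxAl mxdotZr. Qed.

Lemma quad_scalar n k (x : 'cV[R]_n) : quad k%:M x = k * normF x ^+ 2.
Proof. by rewrite /quad mul_scalar_mx mxdotZr normF_sqr. Qed.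

Lemma quad_le n (A : 'M[R]_n) x : `|quad A x| <= normF A * normF x ^+ 2.
Proof.
rewrite (le_trans (mxdot_le _ _)) // mulrC expr2 mulrA.
by rewrite ler_wpM2r ?normF_ge0 // normF_mulmx.
Qed.

Lemma normF_outer m n (x : 'cV[R]_m) (y : 'cV[R]_n) :
  normF (x *m y^T) = normF x * normF y.
Proof.
apply/eqP; rewrite -(@eqrXn2 _ 2) ?mulr_ge0 ?normF_ge0 // exprMn !normF_sqr.
rewrite /mxdot; apply/eqP; rewrite mulr_suml; apply: eq_bigr => i _.
rewrite big_ord1 mulr_sumr; apply: eq_bigr => j _.
by rewrite !mxE !big_ord1 !mxE; ring.
Qed.

(** Trades [xget] for a formula. Measurability of the projection rests on it, and so does the fact
    that projecting only multiplies by a factor in [0, 1], hence keeps symmetry and the sign of the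
    quadratic form. *)
Lemma projFE n (b : R) (A : 'M[R]_n) : 0 <= b ->
  projF b A = (if normF A <= b then 1 else b / normF A) *: A.
Proof.
move=> b0; case: ifPn => [Ab|].
  rewrite scale1r; apply/esym; have near : nearest_point [set C | normF C <= b] A A.
    by split => // C _; rewrite subrr normF0 normF_ge0.
  rewrite /projF; case: xgetP => [B _ [_ /(_ A Ab)]|]; last by move=> /(_ A).
  rewrite subrr normF0 => AB0; apply/eqP; rewrite -subr_eq0 -normF_eq0.
  by rewrite eq_le AB0 normF_ge0.
rewrite -ltNge => bA; have A0 : 0 < normF A by exact: le_lt_trans bA.
set t := b / normF A.
have t1 : t < 1 by rewrite /t ltr_pdivrMr // mul1r.
have t0 : 0 <= t by rewrite divr_ge0 // ltW.
have tAE : normF (t *: A) = b by rewrite normFZ ger0_norm // divfK // gt_eqF.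
have AtA : normF (A - t *: A) = normF A - b.
  rewrite -{1}(scale1r A) -scalerBl normFZ ger0_norm; last by rewrite subr_ge0 ltW.
  by rewrite mulrBl mul1r divfK // gt_eqF.
have near : nearest_point [set C | normF C <= b] A (t *: A).
  split => /= [|C Cb]; rewrite ?tAE // AtA.
  have : normF (C + (A - C)) <= normF C + normF (A - C) by exact: normFD.
  by rewrite addrCA subrr addr0; lra.
rewrite /projF; case: xgetP => [C _ [/= Cb /(_ (t *: A))]|]; last by move=> /(_ (t *: A)).
rewrite /= tAE lexx => /(_ isT); rewrite AtA => AC.
have : normF (A - C) ^+ 2 <= (normF A - b) ^+ 2.
  by rewrite ler_pXn2r // nnegrE ?normF_ge0 // subr_ge0 ltW.
rewrite normF_sqr mxdotDl !mxdotDr !(mxdotNl, mxdotNr) (mxdotC C A) -!normF_sqr.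
move=> H; apply/eqP; rewrite -subr_eq0 -normF_eq0 -sqrf_eq0 eq_le sqr_ge0 andbT.
rewrite normF_sqr mxdotDl !mxdotDr !(mxdotNl, mxdotNr, mxdotZl, mxdotZr).
rewrite (mxdotC C A) -!normF_sqr.
have tA : t * normF A = b by rewrite divfK // gt_eqF.
have C2 : normF C ^+ 2 <= b ^+ 2 by rewrite ler_pXn2r // nnegrE normF_ge0.
set x := normF C ^+ 2 in H C2 *; set c := mxdot A C in H *.
have tA1 : t * (t * normF A ^+ 2) = b ^+ 2 by rewrite -tA; ring.
have tA2 : t * (b * normF A) = b ^+ 2 by rewrite mulrCA tA expr2.
(* Any nearest point [C] satisfies |tA - C|^2 <= (1 - t) (|C|^2 - b^2), which is at most 0; this
   forces [C] to be [t *: A]. *)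
have h1 : 0 <= (1 - t) * (b ^+ 2 - x) by rewrite mulr_ge0 // subr_ge0 // ltW.
have h2 : t * (x + 2 * (b * normF A) - b ^+ 2) <= t * (2 * c).
  by rewrite ler_wpM2l //; nra.
rewrite mulrN tA1; rewrite mulrBr mulrDr (mulrCA t 2) tA2 in h2.
by move: h1 h2; rewrite mulrBl mul1r mulrBr; set u := t * x; set v := t * b ^+ 2; lra.
Qed.

End frobenius.

(** * Measurability *)

Section measurable_matrix_functions.
Context {R : realType}.

Lemma measurable_coord m n (i : 'I_m) (j : 'I_n) :
  measurable_fun setT (fun A : 'M[R]_(m, n) => A i j).
Proof.
move=> _ Y mY; rewrite setTI; apply: sub_sigma_algebra.
by exists (i, j) => //; exists Y => //; rewrite setTI.
Qed.

Lemma measurable_mxP d (T : measurableType d) m n (f : T -> 'M[R]_(m, n)) :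
  (forall i j, measurable_fun setT (fun x => f x i j)) -> measurable_fun setT f.
Proof.
move=> mf.
apply: (@measurability _ _ _ _ _ _ (\bigcup_(ij in [set: 'I_m * 'I_n])
        preimage_set_system setT (fun A : 'M[R]_(m, n) => A ij.1 ij.2)
          (@measurable _ R))) => //.
move=> _ [_ [[i j] _] [B mB <-] <-]; rewrite setTI /=.
by have := mf i j measurableT B mB; rewrite !setTI.
Qed.

Lemma measurable_mx_coord d (T : measurableType d) m n (f : T -> 'M[R]_(m, n)) i j :
  measurable_fun setT f -> measurable_fun setT (fun x => f x i j).
Proof. by move=> mf; apply: (measurableT_comp (measurable_coord i j) mf). Qed.

(** The topology is that of the sup norm, so an open set is the union of the boxes inside it with
    rational centre and radius 1/(k+1). They are countably many and each is cut out by coordinates.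
    Measurability of [G] and of its gradient is deduced from continuity through this. *)
Lemma open_mx_measurable m n (O : set 'M[R]_(m, n)) : open O -> measurable O.
Proof.
move=> oO.
pose box (qk : 'M[rat]_(m, n) * nat) : set 'M[R]_(m, n) :=
  [set A | forall i j, `|A i j - ratr (qk.1 i j)| < qk.2.+1%:R^-1].
have mbox qk : measurable (box qk).
  have -> : box qk = \bigcap_(ij in [set: 'I_m * 'I_n])
      [set A | `|A ij.1 ij.2 - ratr (qk.1 ij.1 ij.2)| < qk.2.+1%:R^-1].
    by apply/seteqP; split=> [A boxA [i j] _|A boxA i j]; [exact: boxA|exact: (boxA (i, j))].
  apply: fin_bigcap_measurable; first exact: finite_finset.
  move=> [i j] _ /=.
  have mf : measurable_fun setT (fun A : 'M[R]_(m, n) => `|A i j - ratr (qk.1 i j)|).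
    apply: measurableT_comp => //; apply: measurable_funB => //.
    exact: measurable_coord.
  have mc : measurable_fun [set: 'M[R]_(m, n)] (fun=> qk.2.+1%:R^-1 : R) by [].
  have := measurable_fun_ltr mf mc measurableT (Y := [set true]).
  by rewrite setTI; apply.
have -> : O = \bigcup_qk (if pselect (box qk `<=` O) then box qk else set0).
  apply/seteqP; split=> [A OA|A [qk _]]; last by case: pselect => //= + ?; apply.
  have /nbhs_ballP[e /= e0 eO] := open_nbhs_nbhs (conj oO OA).
  have [k] : exists k, 0 + k.+1%:R^-1 < e / 2 by apply: ltr_add_invr; rewrite divr_gt0.
  rewrite add0r => ke.
  have /choice[q qP] (ij : 'I_m * 'I_n) :
      exists q : rat, `|A ij.1 ij.2 - ratr q| < k.+1%:R^-1.
    have : A ij.1 ij.2 - k.+1%:R^-1 < A ij.1 ij.2 + k.+1%:R^-1.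
      by rewrite ltrBlDr -addrA ltrDl -mulr2n pmulrn_lgt0 // invr_gt0 ltr0n.
    move=> /rat_in_itvoo[q]; rewrite in_itv /= => /andP[q1 q2]; exists q.
    by rewrite ltr_norml; move: q1 q2; set c := _^-1 => q1 q2; apply/andP; split; lra.
  exists (\matrix_(i, j) q (i, j), k) => //; case: pselect => [_ i j /=|].
    by rewrite mxE; exact: (qP (i, j)).
  case=> B boxB; apply: eO; split => // i j.
  have := boxB i j; have := qP (i, j); rewrite /= mxE.
  move: ke; set c := _^-1 => ke h1 h2.
  rewrite /ball /= (@le_lt_trans _ _ (`|A i j - ratr (q (i, j))| +
    `|B i j - ratr (q (i, j))|)) //; last by lra.
  by rewrite (distrC (B i j)); apply: ler_distD.
apply: countable_bigcupT_measurable => [|qk]; first exact: countableP.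
by case: pselect => /= _; [exact: mbox|exact: measurable0].
Qed.

Lemma continuous_mx_measurable m n (f : 'M[R]_(m, n) -> R) :
  continuous f -> measurable_fun setT f.
Proof.
move=> /continuousP cf; apply: (measurability _ (RGenOpens.measurableE R)).
move=> _ [_ [a [b ->] <-]]; rewrite setTI.
by apply: open_mx_measurable; exact/cf/interval_open.
Qed.

Section operations.
Context d (T : measurableType d).

Lemma measurable_mxD m n (f g : T -> 'M[R]_(m, n)) : measurable_fun setT f ->
  measurable_fun setT g -> measurable_fun setT (fun x => f x + g x).
Proof.
move=> mf mg; apply: measurable_mxP => i j.
under eq_fun do rewrite mxE.
by apply: measurable_funD; exact: measurable_mx_coord.
Qed.

Lemma measurable_mxZ m n (k : T -> R) (f : T -> 'M[R]_(m, n)) :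
  measurable_fun setT k -> measurable_fun setT f ->
  measurable_fun setT (fun x => k x *: f x).
Proof.
move=> mf mg; apply: measurable_mxP => i j.
under eq_fun do rewrite mxE.
by apply: measurable_funM => //; exact: measurable_mx_coord.
Qed.

Lemma measurable_mxN m n (f : T -> 'M[R]_(m, n)) : measurable_fun setT f ->
  measurable_fun setT (fun x => - f x).
Proof.
move=> mf; apply: measurable_mxP => i j.
under eq_fun do rewrite mxE.
by apply: measurableT_comp => //; exact: measurable_mx_coord.
Qed.

Lemma measurable_trmx m n (f : T -> 'M[R]_(m, n)) : measurable_fun setT f ->
  measurable_fun setT (fun x => (f x)^T).
Proof.
move=> mf; apply: measurable_mxP => i j.
by under eq_fun do rewrite mxE; exact: measurable_mx_coord.
Qed.

Lemma measurable_mulmx m n p (f : T -> 'M[R]_(m, n)) (g : T -> 'M[R]_(n, p)) :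
  measurable_fun setT f -> measurable_fun setT g ->
  measurable_fun setT (fun x => f x *m g x).
Proof.
move=> mf mg; apply: measurable_mxP => i j.
under eq_fun do rewrite mxE.
apply: measurable_sum => k.
by apply: measurable_funM; exact: measurable_mx_coord.
Qed.

Lemma measurable_mxdot m n (f g : T -> 'M[R]_(m, n)) : measurable_fun setT f ->
  measurable_fun setT g -> measurable_fun setT (fun x => mxdot (f x) (g x)).
Proof.
move=> mf mg; apply: measurable_sum => i; apply: measurable_sum => j.
by apply: measurable_funM; exact: measurable_mx_coord.
Qed.

Lemma measurable_normF m n (f : T -> 'M[R]_(m, n)) : measurable_fun setT f ->
  measurable_fun setT (fun x => normF (f x)).
Proof.
move=> mf; apply: (measurableT_comp (f := fun x : R => Num.sqrt x)).
  exact: (continuous_measurable_fun (@sqrt_continuous R)).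
apply: measurable_sum => i; apply: measurable_sum => j.
by apply: measurable_funX; exact: measurable_mx_coord.
Qed.

Lemma measurable_norm2 n (f : T -> 'cV[R]_n) : measurable_fun setT f ->
  measurable_fun setT (fun x => norm2 (f x)).
Proof. by move=> mf; under eq_fun do rewrite norm2E; exact: measurable_normF. Qed.

Lemma measurable_funV (f : T -> R) : measurable_fun setT f ->
  measurable_fun setT (fun x => (f x)^-1).
Proof.
move=> mf; apply: (measurableT_comp (f := fun x : R => x^-1)) => //.
(* [powR] gives the inverse on nonnegative reals only, hence the split by sign. *)
have -> : (fun x : R => x^-1) =
    (fun x : R => if 0 <= x then x `^ (-1) else - ((- x) `^ (-1))).
  apply/funext => x; case: ifPn => [x0|]; first by rewrite powR_inv1.
  by rewrite -ltNge => x0; rewrite powR_inv1 ?oppr_ge0 1?ltW // invrN opprK.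
apply: measurable_fun_ifT.
- by apply: measurable_fun_ler.
- exact: measurable_powR.
- apply: measurableT_comp => //; apply: (measurableT_comp (measurable_powR _)) => //.
Qed.

Lemma measurable_projF n (b : R) (f : T -> 'M[R]_n) : 0 <= b ->
  measurable_fun setT f -> measurable_fun setT (fun x => projF b (f x)).
Proof.
move=> b0 mf; under eq_fun do rewrite projFE //.
apply: measurable_mxZ => //; apply: measurable_fun_ifT => //.
- by apply: measurable_fun_ler => //; exact: measurable_normF.
- by apply: measurable_funM => //; apply: measurable_funV; exact: measurable_normF.
Qed.

End operations.

End measurable_matrix_functions.

(** * Independence and freezing *)

Section independence.
Context {dT : measure_display} {T : measurableType dT} {R : realType}
  (P : probability T R).

Definition generated_by d (U : measurableType d) (I : set nat)
    (Y : nat -> T -> U) : set (set T) :=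
  \bigcup_(n in I) preimage_set_system setT (Y n) measurable.

(** [G] is a generating family and not a sigma-algebra, so that adding a random variable to a
    filtration is a plain union. *)
Definition independent_of d (U : measurableType d) (G : set (set T))
    (Y : T -> U) : Prop :=
  forall A D, <<s G >> A -> measurable D ->
    P (A `&` Y @^-1` D) = (P A * P (Y @^-1` D))%E.

Lemma generated_by_measurable d (U : measurableType d) I (Y : nat -> T -> U) :
  (forall n, measurable_fun setT (Y n)) -> generated_by I Y `<=` measurable.
Proof. by move=> mY A [n _ [D mD <-]]; exact: mY. Qed.

Lemma g_sigma_algebra_measurable (G : set (set T)) :
  G `<=` measurable -> <<s G >> `<=` measurable.
Proof. by move=> GT; apply: smallest_sub => //; exact: sigma_algebra_measurable. Qed.

Lemma measurable_coarse d (U : measurableType d) (G : set (set T)) (S : T -> U) :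
  G `<=` measurable -> measurable_fun setT (S : g_sigma_algebraType G -> U) ->
  measurable_fun setT S.
Proof.
move=> GT mS _ D mD; have := mS measurableT D mD.
exact: g_sigma_algebra_measurable.
Qed.

Lemma measurable_finer d (U : measurableType d) (G H : set (set T)) (S : T -> U) :
  G `<=` H -> measurable_fun setT (S : g_sigma_algebraType G -> U) ->
  measurable_fun setT (S : g_sigma_algebraType H -> U).
Proof.
move=> GH mS _ D mD; have := mS measurableT D mD.
by apply: sub_smallest2r => // A GA; apply: GH.
Qed.

Lemma measurable_generated d (U : measurableType d) (G : set (set T)) (S : T -> U) :
  preimage_set_system setT S measurable `<=` G ->
  measurable_fun setT (S : g_sigma_algebraType G -> U).
Proof. by move=> SG _ D mD; apply: sub_sigma_algebra; apply: SG; exists D. Qed.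

(** Pi-lambda argument. With [E] the event on [Y n], the finite measures P(. and E) and P(E) P are
    compared on intersections of a cylinder in Y_0, ..., Y_(n-1) with an event of [W]: independence
    of the processes splits off the event of [W], mutual independence then splits off [E]. These
    sets are stable under intersection and generate the sigma-algebra. *)
Lemma process_independent d (U : measurableType d) d' (V : measurableType d')
    (Y : nat -> T -> U) (W : nat -> T -> V) (n : nat) :
  (forall n, measurable_fun setT (Y n)) -> (forall n, measurable_fun setT (W n)) ->
  mutually_independent P Y -> independent_processes P Y W ->
  independent_of (generated_by `I_n Y `|` generated_by setT W) (Y n).
Proof.
move=> mY mW indY indYW A D + mD.
have mE : measurable (Y n @^-1` D) by rewrite -[_ @^-1` _]setTI; exact: mY.
set E := Y n @^-1` D in mE *.
pose cyl (C : nat -> set U) : set T := \bigcap_(k in `I_n) (Y k @^-1` C k).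
pose Pi : set (set T) := [set B | exists C K,
  [/\ forall k, measurable (C k), sigma_of_process W K & B = cyl C `&` K]].
have mK K : sigma_of_process W K -> measurable K.
  by apply: g_sigma_algebra_measurable; exact: generated_by_measurable.
have mcyl C : (forall k, measurable (C k)) -> measurable (cyl C).
  move=> mC; apply: bigcap_measurableType => k _.
  by rewrite -[_ @^-1` _]setTI; exact: mY.
have sgK C : (forall k, measurable (C k)) -> sigma_of_process Y (cyl C).
  move=> mC; have sG := @sigma_algebra_measurable _
    (g_sigma_algebraType (\bigcup_n preimage_set_system setT (Y n) measurable)).
  have : (\bigcup_n preimage_set_system setT (Y n) measurable).-sigma.-measurable (cyl C).
    apply: bigcap_measurableType => k _; apply: sub_sigma_algebra.
    by exists k => //; exists (C k) => //; rewrite setTI.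
  by [].
have GPi : generated_by `I_n Y `|` generated_by setT W `<=` Pi.
  move=> B [[k kn [C mC <-]]|[k _ [C mC <-]]].
    exists (fun j => if j == k then C else setT), setT; split => //.
    - by move=> j; case: ifP.
    - exact: (@measurableT _ (g_sigma_algebraType _)).
    - rewrite setIT setTI; apply/seteqP; split=> [x Cx j jn /=|x /(_ k kn) /=].
        by case: eqP => // ->.
      by rewrite eqxx.
  exists (fun=> setT), (W k @^-1` C); split => //.
  - by apply: sub_sigma_algebra; exists k => //; exists C => //; rewrite setTI.
  - by congr (_ `&` _); apply/seteqP; split=> // x _ j.
move=> GA.
have {}GA : <<s Pi >> A by apply: sub_smallest2r GA => // B; exact: GPi.
have mPi B : Pi B -> measurable B.
  by move=> [C [K [mC WK ->]]]; apply: measurableI; [exact: mcyl|exact: mK].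
pose J := [fset x in iota 0 n]%fset.
have nJ : n \notin J by rewrite !inE mem_iota /= add0n ltnn.
have cylJ C : cyl C = \bigcap_(j in [set` J]) (Y j @^-1` C j).
  by apply/seteqP; split=> x Cx j /= jn; apply: Cx; rewrite /= !inE mem_iota /= add0n in jn *.
have cylD C : (forall k, measurable (C k)) ->
    P (cyl C `&` E) = (P (cyl C) * P E)%E.
  move=> mC; pose C' j := if j == n then D else C j.
  have mC' j : measurable (C' j) by rewrite /C'; case: ifP.
  have CJ j : j \in J -> C' j = C j.
    by move=> jJ; rewrite /C'; case: eqP => // jn; rewrite -jn jJ in nJ.
  have := indY (n |` J)%fset C' mC'.
  rewrite big_fsetU1 //= /C' eqxx -/C'.
  rewrite (_ : (\prod_(j <- J) _)%E = P (cyl C)); last first.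
    rewrite cylJ indY //; apply: eq_big_seq => j jJ; congr (P (_ @^-1` _)).
    exact: CJ.
  rewrite muleC => <-; congr (P _); apply/seteqP; split=> x.
    move=> [Cx Ex] j /=; rewrite in_fset1U => /orP[/eqP ->|jJ]; first by rewrite eqxx.
    by rewrite -/(C' j) CJ //; move: Cx; rewrite cylJ; apply.
  move=> H; split; last by have := H n; rewrite /= eqxx; apply; rewrite in_fset1U eqxx.
  rewrite cylJ => j /= jJ; have /= := H j; rewrite in_fset1U jJ orbT => /(_ isT).
  by rewrite -/(C' j) CJ.
pose m1 : {measure set T -> \bar R} := mrestr P mE.
have P0 : 0 <= fine (P E) by exact: fine_ge0.
pose m2 : {measure set T -> \bar R} := mscale (NngNum P0) P.
rewrite -[P E]fineK ?fin_num_measure // muleC; change (m1 A = m2 A).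
apply: (g_sigma_algebra_measure_unique Pi mPi (fun=> setT)).
- move=> _; exists (fun=> setT), setT; split => //.
    exact: (@measurableT _ (g_sigma_algebraType _)).
  by apply/seteqP; split.
- by apply/seteqP; split => // x _; exists 0%N.
- move=> _ _ [C1 [K1 [mC1 WK1 ->]]] [C2 [K2 [mC2 WK2 ->]]].
  exists (fun k => C1 k `&` C2 k), (K1 `&` K2); split => //.
  - by move=> k; exact: measurableI.
  - exact: (@measurableI _ (g_sigma_algebraType _)).
  - rewrite setIACA; congr (_ `&` _); apply/seteqP; split=> x.
      by move=> [H1 H2] k kn; split; [exact: H1|exact: H2].
    by move=> H; split=> k kn; have [] := H k kn.
- move=> _ [C [K [mC WK ->]]].
  change (P (cyl C `&` K `&` E) = (fine (P E))%:E * P (cyl C `&` K))%E.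
  rewrite fineK; last exact: fin_num_measure.
  rewrite setIAC indYW //; last first.
    apply: (@measurableI _ (g_sigma_algebraType _)); first exact: sgK.
    by apply: sub_sigma_algebra; exists n => //; exists D => //; rewrite setTI.
  by rewrite (indYW _ _ (sgK _ mC) WK) cylD // -muleA muleCA.
- move=> _; change (P (setT `&` E) < +oo)%E; rewrite setTI.
  by rewrite (le_lt_trans (probability_le1 P mE)) ?ltry.
- exact: GA.
Qed.

(** The substitute for a conditional expectation: [S] is known given G and [Y] is independent of G,
    so their joint law is a product and Tonelli integrates [Y] with [S] fixed. *)
Lemma integral_freeze d (U : measurableType d) d' (V : measurableType d')
    (G : set (set T)) (S : T -> U) (Y : T -> V) (B : set T)
    (f : U * V -> \bar R) :
  G `<=` measurable -> measurable_fun setT (S : g_sigma_algebraType G -> U) ->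
  measurable_fun setT Y -> independent_of G Y -> <<s G >> B ->
  measurable_fun setT f -> (forall uv, 0 <= f uv)%E ->
  (\int[P]_(w in B) f (S w, Y w) =
   \int[P]_(w in B) \int[P]_w' f (S w, Y w'))%E.
Proof.
move=> GT mS mY indGY GB mf f0.
have mB : measurable B by exact: g_sigma_algebra_measurable GB.
(* With the indicator of [B] as a component of the state, the integral over [B] becomes one over the
   whole space. The absolute value in [g] below keeps the integrand nonnegative at every real, not
   only at 0 and 1. *)
pose S' w := (S w, \1_B w : R).
have mS'G : measurable_fun setT (S' : g_sigma_algebraType G -> (U * R)%type).
  exact: measurable_fun_pair.
have mS' : measurable_fun setT S' by exact: measurable_coarse mS'G.
have mS1 : measurable_fun setT S by exact: measurable_coarse mS.
pose S'm : {RV P >-> (U * R)%type} := HB.pack S' (isMeasurableFun.Build _ _ _ _ _ mS').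
pose Ym : {RV P >-> V} := HB.pack Y (isMeasurableFun.Build _ _ _ _ _ mY).
have mSY : measurable_fun setT (fun w => (S' w, Y w)) by exact: measurable_fun_pair.
pose SY : {RV P >-> ((U * R) * V)%type} :=
  HB.pack (fun w => (S' w, Y w)) (isMeasurableFun.Build _ _ _ _ _ mSY).
pose g (x : (U * R) * V) : \bar R := (f (x.1.1, x.2) * `|x.1.2|%:E)%E.
have mg : measurable_fun setT g.
  apply: emeasurable_funM.
    apply: (measurableT_comp mf); apply: measurable_fun_pair => //.
    by apply: measurableT_comp => //; exact: measurableT_comp.
  apply/measurable_EFinP; apply: measurableT_comp => //.
  by apply: measurableT_comp => //.
have g0 x : (0 <= g x)%E by rewrite mule_ge0 // lee_fin normr_ge0.
have E1 : (\int[P]_(w in B) f (S w, Y w) = \int[P]_w g (SY w))%E.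
  rewrite integral_mkcond; apply: eq_integral => w _.
  rewrite patchE /g /= indicE; case: (w \in B); first by rewrite normr1 mule1.
  by rewrite normr0 mule0.
have E2 : (\int[P]_w g (SY w) =
    \int[distribution P S'm \x distribution P Ym]_x g x)%E.
  rewrite -(@ge0_integral_distribution _ _ _ _ _ P SY g) //.
  apply: eq_measure_integral => A mA _; apply/esym.
  apply: product_measure_unique => // C D mC mD.
  change (P (S' @^-1` C `&` Y @^-1` D) = P (S' @^-1` C) * P (Y @^-1` D))%E.
  by rewrite indGY //; have := mS'G measurableT C mC; rewrite setTI.
have mh : measurable_fun setT (fun x : U * R => (\int[distribution P Ym]_y g (x, y))%E).
  exact: measurable_fun_fubini_tonelli_F.
rewrite E1 E2 fubini_tonelli1 // ge0_integral_distribution //; last first.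
  by move=> x; apply: integral_ge0.
rewrite [RHS]integral_mkcond; apply: eq_integral => w _ /=.
rewrite /fubini_F ge0_integral_distribution //; last exact: measurableT_comp.
rewrite patchE /g /= indicE; case: (w \in B).
  by apply: eq_integral => w' _ /=; rewrite normr1 mule1.
by rewrite integral0_eq // => w' _ /=; rewrite normr0 mule0.
Qed.

Lemma integral_same_law d (U : measurableType d) (Y Y' : T -> U) (f : U -> \bar R) :
  measurable_fun setT Y -> measurable_fun setT Y' -> same_law P Y Y' ->
  measurable_fun setT f -> (forall u, 0 <= f u)%E ->
  (\int[P]_w f (Y w) = \int[P]_w f (Y' w))%E.
Proof.
move=> mY mY' YY' mf f0.
pose Ym : {RV P >-> U} := HB.pack Y (isMeasurableFun.Build _ _ _ _ _ mY).
pose Ym' : {RV P >-> U} := HB.pack Y' (isMeasurableFun.Build _ _ _ _ _ mY').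
transitivity (\int[distribution P Ym]_y f y)%E.
  by rewrite ge0_integral_distribution.
transitivity (\int[distribution P Ym']_y f y)%E.
  by apply: eq_measure_integral => A mA _; exact: YY'.
by rewrite ge0_integral_distribution.
Qed.

End independence.

(** * Almost supermartingales *)

Section supermartingale.
Context {dT : measure_display} {T : measurableType dT} {R : realType}
  (P : probability T R) (G : nat -> set (set T)).
Hypothesis G_measurable : forall n, G n `<=` measurable.
Hypothesis G_nondecreasing : forall n, G n `<=` G n.+1.

Definition adapted (U : nat -> T -> R) : Prop :=
  forall n, measurable_fun setT (U n : g_sigma_algebraType (G n) -> R).

Let GS n A : <<s G n >> A -> <<s G n.+1 >> A.
Proof. by apply: sub_smallest2r => // B; exact: G_nondecreasing. Qed.

Let GW m n A : (m <= n)%N -> <<s G m >> A -> <<s G n >> A.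
Proof.
move=> mn mA; rewrite -(subnKC mn); elim: (n - m)%N => [|k IH]; first by rewrite addn0.
by rewrite addnS; exact: GS.
Qed.

Let GT n A : <<s G n >> A -> measurable A.
Proof. by apply: g_sigma_algebra_measurable; exact: G_measurable. Qed.

Let GI n A B : <<s G n >> A -> <<s G n >> B -> <<s G n >> (A `&` B).
Proof. exact: (@measurableI _ (g_sigma_algebraType (G n))). Qed.

Let GD n A B : <<s G n >> A -> <<s G n >> B -> <<s G n >> (A `\` B).
Proof. exact: (@measurableD _ (g_sigma_algebraType (G n))). Qed.

Lemma adapted_measurable U : adapted U -> forall n, measurable_fun setT (U n).
Proof. by move=> aU n; apply: (measurable_coarse (@G_measurable n)); exact: aU. Qed.

Lemma adapted_ge U (c : R) n : adapted U -> <<s G n >> [set w | c <= U n w].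
Proof.
move=> aU.
have mc : measurable_fun [set: g_sigma_algebraType (G n)] (fun=> c : R) by [].
have := measurable_fun_ler mc (aU n) measurableT (Y := [set true]).
by rewrite setTI; apply.
Qed.

Lemma adapted_lt U (c : R) n : adapted U -> <<s G n >> [set w | U n w < c].
Proof.
move=> /(@adapted_ge _ c n) /(@sigma_algebraC _ _ _); congr (<<s _ >> _).
by apply/seteqP; split=> w /=; rewrite ltNge => /negP.
Qed.

Section nonnegative.
Variable U : nat -> T -> R.
Hypothesis U_ge0 : forall n w, 0 <= U n w.
Hypothesis U_adapted : adapted U.
Hypothesis U_super : forall n B, <<s G n >> B ->
  (\int[P]_(w in B) (U n.+1 w)%:E <= \int[P]_(w in B) (U n w)%:E)%E.

Let mU n D : measurable_fun D (EFin \o U n).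
Proof. by apply: measurable_funTS; apply/measurable_EFinP; exact: adapted_measurable. Qed.

(** The recursion peels off the first time of the window, not the last, because the induction for
    the maximal inequality moves the starting time forward. *)
Fixpoint hit (c : R) N n : set T :=
  [set w | c <= U n w] `|` (if N is M.+1 then hit c M n.+1 else set0).

Lemma hit_measurable c N n : measurable (hit c N n).
Proof.
elim: N n => [|N IH] n /=; apply: measurableU => //; apply: (@GT n); exact: adapted_ge.
Qed.

Lemma hitP c N n w : hit c N n w <-> exists2 m, (n <= m <= n + N)%N & c <= U m w.
Proof.
elim: N n => [|N IH] n /=; split.
- by case=> // cU; exists n; rewrite // addn0 leqnn.
- by case=> m; rewrite addn0 -eqn_leq => /eqP <-; left.
- case=> [cU|/IH[m /andP[nm mN] cU]]; first by exists n; rewrite ?leqnn ?leq_addr.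
  by exists m; rewrite // addnS -addSn mN andbT ltnW.
- case=> m /andP[]; rewrite leq_eqVlt => /orP[/eqP <- _ cU|nm mN cU]; first by left.
  by right; apply/IH; exists m; rewrite // nm addSn -addnS.
Qed.

Lemma markov_event c n B : 0 < c -> measurable B -> (forall w, B w -> c <= U n w) ->
  (c%:E * P B <= \int[P]_(w in B) (U n w)%:E)%E.
Proof.
move=> c0 mB cU; rewrite -integral_cst //; apply: ge0_le_integral => //.
- by move=> w _; rewrite lee_fin ltW.
- exact: mU.
Qed.

(** Where the level is reached at time n, Markov's inequality applies. The rest of [B] is still an
    event of time n, so the induction hypothesis from n+1 followed by one supermartingale step
    applies there. Allowing every event [B] is what replaces stopping times. *)
Lemma maximal_inequality_finite c N n B : 0 < c -> <<s G n >> B ->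
  (c%:E * P (B `&` hit c N n) <= \int[P]_(w in B) (U n w)%:E)%E.
Proof.
move=> c0; elim: N n B => [|N IH] n B GB.
  rewrite /= setU0; have mB := GT (GI GB (adapted_ge c U_adapted)).
  apply: (le_trans (markov_event (n := n) c0 mB (fun w Bw => Bw.2))).
  by apply: ge0_subset_integral => //; [exact: GT GB|exact: mU|
    move=> w _; rewrite lee_fin].
set H := [set w | c <= U n w]; have GH : <<s G n >> H by exact: adapted_ge.
have mBH := GT (GI GB GH); have mBD := GT (GD GB GH).
have -> : B `&` hit c N.+1 n = (B `&` H) `|` ((B `\` H) `&` hit c N n.+1).
  apply/seteqP; split=> w /=.
    by case=> Bw; case: (pselect (H w)) => Hw [?|?]; tauto.
  tauto.
have -> : (\int[P]_(w in B) (U n w)%:E = \int[P]_(w in B `&` H) (U n w)%:E +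
    \int[P]_(w in B `\` H) (U n w)%:E)%E.
  rewrite -ge0_integral_setU //; last 3 first.
  - exact: mU.
  - by move=> w _; rewrite lee_fin.
  - by apply/disj_setPS => w [[_ ?] [_ ?]].
  by rewrite setUIDK.
apply: (@le_trans _ _ (c%:E * (P (B `&` H) + P ((B `\` H) `&` hit c N n.+1)))%E).
  rewrite lee_pmul2l ?lte_fin // ?fin_numE //.
  have mh := hit_measurable c N n.+1.
  apply: (le_trans (measureU2 _ _ _)) => //; exact: measurableI.
rewrite ge0_muleDr //; apply: leeD; first by apply: markov_event => // w [].
by apply: (le_trans (IH n.+1 _ (GS (GD GB GH)))); exact: U_super (GD GB GH).
Qed.

Definition hit_ever c n : set T := \bigcup_N hit c N n.

Lemma hit_ever_measurable c n : measurable (hit_ever c n).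
Proof. by apply: bigcupT_measurable => N; exact: hit_measurable. Qed.

Lemma hit_everP c n w : hit_ever c n w <-> exists2 m, (n <= m)%N & c <= U m w.
Proof.
split=> [[N _ /hitP[m /andP[nm _] cU]]|[m nm cU]]; first by exists m.
by exists (m - n)%N => //; apply/hitP; exists m; rewrite // nm subnKC // leqnn.
Qed.

Lemma maximal_inequality c n B : 0 < c -> <<s G n >> B ->
  (c%:E * P (B `&` hit_ever c n) <= \int[P]_(w in B) (U n w)%:E)%E.
Proof.
move=> c0 GB; rewrite -lee_pdivlMl // /hit_ever setI_bigcupr.
have mF N : measurable (B `&` hit c N n).
  by apply: measurableI; [exact: GT GB|exact: hit_measurable].
have ndF : nondecreasing_seq (fun N => B `&` hit c N n).
  move=> M N MN; apply/subsetPset => w [Bw /hitP[m /andP[nm mM] cU]]; split => //.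
  by apply/hitP; exists m; rewrite // nm (leq_trans mM) // leq_add2l.
have cvgF : P (B `&` hit c N n) @[N --> \oo] --> P (\bigcup_N (B `&` hit c N n)).
  by apply: nondecreasing_cvg_mu => //; exact: bigcupT_measurable.
rewrite -(cvg_lim _ cvgF) //; apply: lime_le; first by apply/cvg_ex; eexists; exact: cvgF.
by apply: nearW => N; rewrite lee_pdivlMl //; exact: maximal_inequality_finite.
Qed.

Lemma supermartingale_bounded : (\int[P]_w (U 0 w)%:E < +oo)%E ->
  {ae P, forall w, exists C, forall n, U n w <= C}.
Proof.
move=> U0.
have mh k : measurable (hit_ever k.+1%:R 0) by exact: hit_ever_measurable.
exists (\bigcap_k hit_ever k.+1%:R 0); split.
- exact: bigcapT_measurable.
- have I0 : (0 <= \int[P]_w (U 0 w)%:E)%E.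
    by apply: integral_ge0 => w _; rewrite lee_fin.
  have If : (\int[P]_w (U 0 w)%:E)%E \is a fin_num by rewrite ge0_fin_numE.
  apply/eqP; rewrite eq_le measure_ge0 andbT.
  apply/lee_addgt0Pr => e e0; rewrite add0e.
  set I := fine (\int[P]_w (U 0 w)%:E)%E.
  have [k Ik] : exists k, I <= e * k.+1%:R.
    exists (Num.truncn (I / e)); rewrite mulrC -ler_pdivrMr //.
    by apply: ltW; apply: truncnS_gt.
  apply: (@le_trans _ _ (P (hit_ever k.+1%:R 0))).
    apply: le_measure; rewrite ?inE //; first exact: bigcapT_measurable.
    by move=> w /(_ k); apply.
  have := @maximal_inequality k.+1%:R 0%N setT _ (@measurableT _ (g_sigma_algebraType _)).
  rewrite setTI ltr0n => /(_ isT) H.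
  rewrite -(@lee_pmul2l _ k.+1%:R%:E) ?lte_fin ?ltr0n // (le_trans H) //.
  by rewrite -(fineK If) -EFinM lee_fin mulrC.
- move=> w /= Hw k _; apply: contrapT => nh; apply: Hw; exists k.+1%:R => n.
  rewrite leNgt; apply/negP => kU; apply: nh; apply/hit_everP; exists n => //.
  exact: ltW.
Qed.

(* Starting from the first time the process is below a small e, the maximal
   inequality bounds by e / c the probability of climbing back to c. *)
Lemma supermartingale_small : {ae P, forall w,
  (forall e, 0 < e -> exists n, U n w < e) -> U ^~ w @ \oo --> 0}.
Proof.
(* On [L] the process goes below every positive level; [bad j] adds that it exceeds 1/(j+1) at
   arbitrarily late times. Convergence to 0 fails on [L] only inside some [bad j]. *)
pose L := \bigcap_i \bigcup_n [set w | U n w < i.+1%:R^-1].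
pose bad j := L `&` \bigcap_n hit_ever j.+1%:R^-1 n.
have mlt c n : measurable [set w | U n w < c].
  by apply: (@GT n); exact: adapted_lt.
have mL : measurable L.
  by apply: bigcapT_measurable => i; apply: bigcupT_measurable => n.
have mbad j : measurable (bad j).
  apply: measurableI => //; apply: bigcapT_measurable => n.
  exact: hit_ever_measurable.
have bad0 j : P (bad j) = 0%E.
  apply/eqP; rewrite eq_le measure_ge0 andbT.
  set c : R := j.+1%:R^-1; have c0 : 0 < c by rewrite invr_gt0 ltr0n.
  apply/lee_addgt0Pr => e e0; rewrite add0e.
  have [i] : exists i, 0 + i.+1%:R^-1 < e * c by apply: ltr_add_invr; rewrite mulr_gt0.
  rewrite add0r => ie; set s : R := i.+1%:R^-1 in ie.
  have s0 : 0 < s by rewrite invr_gt0 ltr0n.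
  (* [D n] is the event that n is the first time below [s]: an event of time n, and the [D n] are
     disjoint, so their probabilities sum to at most 1 and the total bound is s / c < e. *)
  pose D := seqDU (fun n => [set w | U n w < s]).
  have GDn n : <<s G n >> (D n).
    apply: GD; first exact: adapted_lt.
    apply: (@bigsetU_measurable _ (g_sigma_algebraType (G n))) => k _.
    by apply: (@GW k); [exact/ltnW/ltn_ord|exact: adapted_lt].
  have mD n : measurable (D n) by exact: GT (GDn n).
  have mDh n : measurable (D n `&` hit_ever c n).
    by apply: measurableI => //; exact: hit_ever_measurable.
  have badD : bad j `<=` \bigcup_n (D n `&` hit_ever c n).
    move=> w [/(_ i Logic.I) Lw hw]; move: Lw.
    by rewrite seqDU_bigcup_eq => -[n _ Dn]; exists n => //; split => //; exact: hw.
  apply: le_trans; first exact: (measure_sigma_subadditive _ mDh (mbad j) badD).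
  apply: (@le_trans _ _ (\sum_(n <oo) (s / c)%:E * P (D n))%E).
    apply: lee_nneseries => [n _ _|n _]; first exact: measure_ge0.
    have := maximal_inequality (n := n) c0 (GDn n).
    rewrite -lee_pdivlMl // => /le_trans; apply.
    rewrite mulrC EFinM -muleA lee_pmul2l ?lte_fin ?invr_gt0 //.
    rewrite -integral_cst //; apply: ge0_le_integral => //.
    - by move=> w _; rewrite lee_fin.
    - exact: mU.
    - by move=> w [/= Us _]; rewrite lee_fin ltW.
  rewrite nneseriesZl; last by move=> n _; exact: measure_ge0.
  have <- : P (\bigcup_n D n) = (\sum_(n <oo) P (D n))%E.
    apply: measure_semi_bigcup => //; first exact: trivIset_seqDU.
    exact: bigcupT_measurable.
  apply: (@le_trans _ _ ((s / c)%:E * 1)%E).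
    rewrite lee_pmul2l ?lte_fin ?divr_gt0 //.
    by apply: probability_le1; exact: bigcupT_measurable.
  by rewrite mule1 lee_fin ler_pdivrMr // ltW.
exists (\bigcup_j bad j); split.
- exact: bigcupT_measurable.
- apply/eqP; rewrite eq_le measure_ge0 andbT.
  have mUb : measurable (\bigcup_j bad j) by exact: bigcupT_measurable.
  apply: le_trans; first exact: (measure_sigma_subadditive _ mbad mUb (@subset_refl _ _)).
  by rewrite eseries0 // => n _ _; exact: bad0.
- move=> w /= /not_implyP[small ncv]; apply: contrapT => nb; apply: ncv.
  apply/cvgr0Pnorm_lt => e e0; near \oo => j0.
  have [j] : exists j, 0 + j.+1%:R^-1 < e by exact: ltr_add_invr.
  rewrite add0r => je.
  have [n hn] : exists n, ~ hit_ever j.+1%:R^-1 n w.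
    apply: contrapT => nh; apply: nb; exists j => //; split.
      by move=> i _; have [|n ?] := small i.+1%:R^-1; [rewrite invr_gt0 ltr0n|exists n].
    by move=> n _; apply: contrapT => hn; apply: nh; exists n.
  exists n => // m /= nm; rewrite ger0_norm //; apply: lt_trans je.
  rewrite ltNge; apply/negP => jU; apply: hn; apply/hit_everP.
  by exists m.
Unshelve. all: by end_near. Qed.

End nonnegative.

Lemma partial_sums_cvg (a : nat -> R) : (forall n, 0 <= a n) ->
  (exists C, forall n, \sum_(k < n) a k <= C) ->
  exists s, [/\ forall n, \sum_(k < n) a k <= s &
    (fun n => s - \sum_(k < n) a k) @ \oo --> 0].
Proof.
move=> a0 [C aC]; pose S n := \sum_(k < n) a k.
have ndS : nondecreasing_seq S.
  by apply/nondecreasing_seqP => n; rewrite /S big_ord_recr /= lerDl.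
have ubS : has_ubound (range S) by exists C => _ [n _ <-]; exact: aC.
exists (sup (range S)); split; first by move=> n; apply: ub_le_sup => //; exists n.
rewrite -[X in _ --> X](subrr (sup (range S))).
by apply: cvgB; [exact: cvg_cst|exact: nondecreasing_cvgn].
Qed.

Lemma prod1D_bounded (a : nat -> R) : (forall n, 0 <= a n) ->
  (exists C, forall n, \sum_(k < n) a k <= C) ->
  exists C, forall n, \prod_(k < n) (1 + a k) <= C.
Proof.
move=> a0 [C aC]; exists (expR C) => n.
apply: (@le_trans _ _ (expR (\sum_(k < n) a k))); last by rewrite ler_expR.
elim: n => [|n IH]; first by rewrite !big_ord0 expR0.
rewrite !big_ord_recr /= expRD ler_pM //; last exact: expR_ge1Dx.
  by apply: prodr_ge0 => k _; rewrite addr_ge0.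
by rewrite addr_ge0.
Qed.

(** Dividing by the product [p] of the factors 1 + a_k removes the multiplicative error, adding the
    tail of the series of b removes the additive one, and accumulated terms D can be carried along.
    The result [V] is a nonnegative supermartingale, and [p] stays between 1 and [M], so estimates
    pass between [U] and [V]. *)
Lemma robbins_siegmund (U D : nat -> T -> R) (a b : nat -> R) :
  (forall n w, 0 <= U n w) -> (forall n w, 0 <= D n w) ->
  adapted U -> adapted D ->
  (forall n, 0 <= a n) -> (forall n, 0 <= b n) ->
  (exists C, forall n, \sum_(k < n) a k <= C) ->
  (exists C, forall n, \sum_(k < n) b k <= C) ->
  (\int[P]_w (U 0 w)%:E < +oo)%E ->
  (forall n B, <<s G n >> B ->
    (\int[P]_(w in B) (U n.+1 w + D n w)%:E <=
     (1 + a n)%:E * \int[P]_(w in B) (U n w)%:E + (b n)%:E * P B)%E) ->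
  {ae P, forall w, [/\ exists C, forall n, U n w <= C,
    exists C, forall n, \sum_(k < n) D k w <= C &
    (forall e N, 0 < e -> exists2 n, (N <= n)%N & U n w < e) ->
      U ^~ w @ \oo --> 0]}.
Proof.
move=> U0 D0 aU aD a0 b0 sa sb iU step.
have [s [bs tail0]] := partial_sums_cvg b0 sb.
have [M pM] := prod1D_bounded a0 sa.
pose p n := \prod_(k < n) (1 + a k).
have p1 n : 1 <= p n.
  by rewrite /p; elim: n => [|n IH]; rewrite ?big_ord0 // big_ord_recr /= mulr_ege1 // lerDl.
have p0 n : 0 < p n by exact: lt_le_trans (p1 n).
have pS n : p n.+1 = p n * (1 + a n) by rewrite /p big_ord_recr.
(* Two choices of [E] are needed: the partial sums of D give the two boundedness claims, while
   [E = 0] gives the convergence, since with accumulated sums [V] would have no reason to become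
   small. *)
pose V (E : nat -> T -> R) n w := (U n w + E n w) / p n + (s - \sum_(k < n) b k).
have V0 E : (forall n w, 0 <= E n w) -> forall n w, 0 <= V E n w.
  by move=> E0 n w; rewrite addr_ge0 ?subr_ge0 // divr_ge0 ?addr_ge0 // ltW.
have aV E : adapted E -> adapted (V E).
  move=> aE n; apply: measurable_funD => //; apply: measurable_funM => //.
  exact: measurable_funD.
have stepV E F : (forall n w, 0 <= E n w) -> (forall n w, 0 <= F n w) ->
    adapted E -> adapted F ->
    (forall n w, E n.+1 w = E n w + F n w) -> (forall n w, F n w <= D n w) ->
    forall n B, <<s G n >> B ->
    (\int[P]_(w in B) (V E n.+1 w)%:E <= \int[P]_(w in B) (V E n w)%:E)%E.
  move=> E0 F0 aE aF ES FD n B GB; have mB := GT GB.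
  have mm f D' : adapted f -> forall k, measurable_fun D' (EFin \o f k).
    move=> af k; apply: measurable_funTS; apply/measurable_EFinP.
    exact: adapted_measurable.
  have VE k : (\int[P]_(w in B) (V E k w)%:E =
      ((p k)^-1)%:E * (\int[P]_(w in B) (U k w)%:E + \int[P]_(w in B) (E k w)%:E) +
      (s - \sum_(i < k) b i)%:E * P B)%E.
    rewrite -ge0_integralD //; try by [exact: mm | move=> w _; rewrite lee_fin].
    rewrite -ge0_integralZl //; last 3 first.
    - by apply: emeasurable_funD; exact: mm.
    - by move=> w _; rewrite adde_ge0 // lee_fin.
    - by rewrite lee_fin invr_ge0 ltW.
    rewrite -integral_cst // -ge0_integralD //; last 3 first.
    - by move=> w _; rewrite mule_ge0 ?adde_ge0 ?lee_fin // invr_ge0 ltW.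
    - by apply: emeasurable_funM => //; apply: emeasurable_funD; exact: mm.
    - by move=> w _; rewrite lee_fin subr_ge0.
    by apply: eq_integral => w _; rewrite /V mulrC /= EFinD EFinM EFinD.
  have H : (\int[P]_(w in B) (U n.+1 w)%:E + \int[P]_(w in B) (E n.+1 w)%:E <=
     (1 + a n)%:E * (\int[P]_(w in B) (U n w)%:E + \int[P]_(w in B) (E n w)%:E)
     + (b n)%:E * P B)%E.
    have -> : (\int[P]_(w in B) (E n.+1 w)%:E =
        \int[P]_(w in B) (F n w)%:E + \int[P]_(w in B) (E n w)%:E)%E.
      rewrite -ge0_integralD //; try by [exact: mm | move=> w _; rewrite lee_fin].
      by apply: eq_integral => w _; rewrite ES EFinD addeC.
    rewrite addeA -ge0_integralD //; try by [exact: mm | move=> w _; rewrite lee_fin].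
    have IE : (0 <= \int[P]_(w in B) (E n w)%:E)%E.
      by apply: integral_ge0 => w _; rewrite lee_fin.
    have IU : (0 <= \int[P]_(w in B) (U n w)%:E)%E.
      by apply: integral_ge0 => w _; rewrite lee_fin.
    rewrite ge0_muleDr // [leRHS]addeAC; apply: leeD; last first.
      by rewrite -[leLHS]mul1e lee_wpmul2r // lee_fin lerDl.
    apply: le_trans (step n B GB).
    apply: ge0_le_integral => //.
    - by move=> w _; rewrite -EFinD lee_fin addr_ge0.
    - by apply: emeasurable_funD; exact: mm.
    - by apply: (@emeasurable_funD _ _ _ _ (EFin \o U n.+1) (EFin \o D n)); exact: mm.
    - by move=> w _; rewrite -EFinD lee_fin lerD2l.
  rewrite !VE; move: H.
  set I' := (\int[P]_(w in B) (U n.+1 w)%:E + _)%E.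
  set I := (\int[P]_(w in B) (U n w)%:E + _)%E => H.
  have I0 : (0 <= I)%E.
    by apply: adde_ge0; apply: integral_ge0 => w _; rewrite lee_fin.
  apply: (@le_trans _ _ (((p n.+1)^-1)%:E * ((1 + a n)%:E * I + (b n)%:E * P B) +
      (s - \sum_(i < n.+1) b i)%:E * P B)%E).
    by apply: leeD => //; rewrite lee_wpmul2l // lee_fin invr_ge0 ltW.
  rewrite ge0_muleDr //; last 2 first.
  - by rewrite mule_ge0 // lee_fin addr_ge0.
  - by rewrite mule_ge0 // lee_fin.
  have fP : P B \is a fin_num by exact: fin_num_measure.
  rewrite muleA -EFinM pS invfM -mulrA mulVf ?mulr1; last first.
    by rewrite gt_eqF // ltr_pwDl.
  rewrite -addeA leeD2l // -(fineK fP) -!EFinM -EFinD lee_fin.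
  rewrite big_ord_recr /= opprD mulrA -mulrDl.
  apply: ler_wpM2r; first exact: fine_ge0.
  (* As [p] is at least 1, the undivided tail of b is already large enough to pay for b_n /
     p_(n+1). *)
  rewrite -invfM -pS; have : (p n.+1)^-1 * b n <= b n.
    by rewrite ler_piMl // invf_le1.
  set u := _^-1; lra.
have V0fin E : (forall w, E 0 w = 0) -> (\int[P]_w (V E 0 w)%:E < +oo)%E.
  move=> E0; rewrite (eq_integral (fun w => (U 0%N w)%:E + s%:E)%E); last first.
    by move=> w _; rewrite /V E0 /p !big_ord0 addr0 divr1 subr0 EFinD.
  have s0 : 0 <= s by have := bs 0%N; rewrite big_ord0.
  rewrite ge0_integralD //; last 2 first.
  - by move=> w _; rewrite lee_fin.
  - by apply/measurable_EFinP; exact: adapted_measurable.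
  by rewrite integral_cst //= probability_setT mule1 lte_add_pinfty // ltry.
pose S n w := \sum_(k < n) D k w.
have S0 n w : 0 <= S n w by apply: sumr_ge0 => k _.
have aS : adapted S.
  move=> n; apply: measurable_sum => k.
  move=> _ Y mY; have := aD k measurableT Y mY; rewrite !setTI.
  by apply: GW; rewrite ltnW.
have Z0 (n : nat) (w : T) : 0 <= (fun=> fun=> 0 : R) n w by [].
have aZ : adapted (fun=> fun=> 0) by move=> n; exact: measurable_cst.
have SS n w : S n.+1 w = S n w + D n w by rewrite /S big_ord_recr.
have S00 w : S 0%N w = 0 by rewrite /S big_ord0.
have bound := supermartingale_bounded (V0 _ S0) (aV _ aS)
  (stepV _ _ S0 D0 aS aD SS (fun n w => lexx _)) (V0fin _ S00).
have Z0r (n : nat) (w : T) : (0 : R) = 0 + 0 by rewrite addr0.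
have small := supermartingale_small (V0 _ Z0) (aV _ aZ)
  (stepV _ _ Z0 Z0 aZ aZ Z0r D0).
apply: filterS2 bound small => w [C VC] small.
have M0 : 0 <= M by apply: le_trans (pM 0%N); exact: ltW (p0 0%N).
have SUC n : U n w + S n w <= M * C.
  have C0 : 0 <= C by exact: le_trans (V0 _ S0 0%N w) (VC 0%N).
  apply: (@le_trans _ _ (p n * C)); last by rewrite ler_wpM2r // pM.
  rewrite -ler_pdivrMl // mulrC (le_trans _ (VC n)) // lerDl subr_ge0.
  exact: bs.
split.
- by exists (M * C) => n; apply: le_trans (SUC n); rewrite lerDl.
- by exists (M * C) => n; apply: le_trans (SUC n); rewrite lerDr.
move=> inf; have {}small : V (fun=> fun=> 0) ^~ w @ \oo --> 0.
  apply: small => e e0.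
  have e20 : 0 < e / 2 by rewrite divr_gt0.
  move/cvgr0Pnorm_lt : tail0 => /(_ _ e20)[N _ tN].
  have [n Nn Un] := inf _ N e20; exists n; rewrite /V addr0.
  have := tN n Nn; rewrite ger0_norm ?subr_ge0 // => h.
  have : U n w / p n <= U n w by rewrite ler_pdivrMr // ler_peMr.
  by move=> h2; rewrite [ltRHS]splitr ltrD // (le_lt_trans h2).
apply: (@squeeze_cvgr _ _ _ _ (fun=> 0) (fun n => M * V (fun=> fun=> 0) n w)).
- apply: nearW => n; rewrite U0 /= /V addr0.
  rewrite -ler_pdivrMl; last by exact: lt_le_trans (p0 n) (pM n).
  rewrite mulrC (@le_trans _ _ (U n w / p n)) //; last by rewrite lerDl subr_ge0.
  by rewrite ler_wpM2l // lef_pV2 ?posrE // ?pM //; exact: lt_le_trans (p0 n) (pM n).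
- exact: cvg_cst.
- by rewrite -[X in _ --> X](mulr0 M); apply: cvgMr.
Qed.

End supermartingale.

(** * Powers and logarithmic weights *)

Section power_sequences.
Context {R : realType}.

(* (n+1)^a: the steps n.+1 of the algorithm use the samples indexed by n *)
Definition pw (a : R) (n : nat) : R := n.+1%:R `^ a.

Lemma pw_gt0 a n : 0 < pw a n.
Proof. by rewrite powR_gt0 // ltr0n. Qed.

Lemma pw_ge0 a n : 0 <= pw a n.
Proof. exact: powR_ge0. Qed.

Lemma pwD a b n : pw (a + b) n = pw a n * pw b n.
Proof. by rewrite /pw powRD // pnatr_eq0 implybT. Qed.

Lemma pwN a n : pw (- a) n = (pw a n)^-1.
Proof. exact: powRN. Qed.

Lemma pwX a n : pw (2 * a) n = pw a n ^+ 2.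
Proof. by rewrite mulr2n mulrDl mul1r pwD expr2. Qed.

Lemma pw0 n : pw 0 n = 1.
Proof. exact: powRr0. Qed.

Lemma pw1 n : pw 1 n = n.+1%:R.
Proof. by rewrite /pw powRr1 // ler0n. Qed.

Lemma le_pw a b n : a <= b -> pw a n <= pw b n.
Proof. by move=> ab; apply: ler_powR => //; rewrite ler1n. Qed.

Lemma pw_homo a m n : 0 <= a -> (m <= n)%N -> pw a m <= pw a n.
Proof.
by move=> a0 mn; apply: ge0_ler_powR; rewrite ?nnegrE ?ler0n // ler_nat.
Qed.

Lemma pwN_homo a m n : 0 <= a -> (m <= n)%N -> pw (- a) n <= pw (- a) m.
Proof.
by move=> a0 mn; rewrite !pwN lef_pV2 ?posrE ?pw_gt0 // pw_homo.
Qed.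

Lemma pwS_le a n : 0 <= a <= 1 -> pw a n.+1 <= 2 * pw a n.
Proof.
move=> /andP[a0 a1]; apply: (@le_trans _ _ ((2 * n.+1%:R) `^ a)).
  by apply: ge0_ler_powR; rewrite ?nnegrE // -natrM ler_nat mul2n -addnn addSn ltnS leq_addl.
rewrite powRM // ler_wpM2r ?pw_ge0 // -{2}(@powRr1 R 2) // ler_powR // ler1n.
by [].
Qed.

Lemma ln_step n : n.+2%:R^-1 <= ln n.+2%:R - ln n.+1%:R :> R.
Proof.
have n1 : 0 < n.+1%:R :> R by rewrite ltr0n.
have n2 : 0 < n.+2%:R :> R by rewrite ltr0n.
rewrite -lerN2 opprB -ln_div ?posrE //.
have -> : n.+1%:R / n.+2%:R = 1 + (- n.+2%:R^-1) :> R.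
  rewrite -(natr1 n.+1) addrC; apply: (mulIf (lt0r_neq0 n2)).
  by rewrite divfK ?gt_eqF // mulrDl mulNr mulVf ?gt_eqF // mul1r -natr1; ring.
apply: le_ln1Dx; rewrite ltrN2 invf_lt1 // ltr1n.
by [].
Qed.

Lemma ln_step_le n : ln n.+2%:R - ln n.+1%:R <= n.+1%:R^-1 :> R.
Proof.
have n1 : 0 < n.+1%:R :> R by rewrite ltr0n.
rewrite -ln_div ?posrE ?ltr0n //.
have -> : n.+2%:R / n.+1%:R = 1 + n.+1%:R^-1 :> R.
  by rewrite -(natr1 n.+1) mulrDl divff ?gt_eqF // mul1r.
by apply: le_ln1Dx; apply: lt_trans (_ : 0 < _); rewrite ?invr_gt0 // ltrN10.
Qed.

(** Comparison with the telescoping differences of (k+1)^(-t), t = s - 1; the inequality 1 + x <=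
    exp x takes the place of an integral. The first term gives 1, the telescoped remainder at most
    1/t. *)
Lemma pw_summable s : 1 < s -> exists C, forall n, \sum_(k < n) pw (- s) k <= C.
Proof.
move=> s1; set t := s - 1; have t0 : 0 < t by rewrite subr_gt0.
exists (1 + t^-1).
have step k : t * pw (- s) k.+1 <= pw (- t) k - pw (- t) k.+1.
  have -> : pw (- t) k = pw (- t) k.+1 * expR (t * (ln k.+2%:R - ln k.+1%:R)).
    rewrite /pw /powR !pnatr_eq0 /= -expRD; congr expR; ring.
  have -> : - s = - t + - 1 by rewrite /t; ring.
  rewrite pwD mulrCA -[X in _ - X]mulr1 -mulrBr ler_wpM2l ?pw_ge0 //.
  rewrite lerBrDl (le_trans _ (expR_ge1Dx _)) // lerD2l ler_wpM2l ?(ltW t0) //.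
  by rewrite pwN pw1 ln_step.
suff H n : \sum_(k < n.+1) pw (- s) k <= 1 + t^-1 * (1 - pw (- t) n).
  case=> [|n]; first by rewrite big_ord0 addr_ge0 // invr_ge0 ltW.
  rewrite (le_trans (H n)) // lerD2l ler_piMr ?invr_ge0 ?(ltW t0) //.
  by rewrite gerBl pw_ge0.
elim: n => [|n IH].
  by rewrite big_ord1 /pw !powR1 subrr mulr0 addr0.
rewrite big_ord_recr /= (le_trans (lerD IH (lexx _))) //.
have : pw (- s) n.+1 <= t^-1 * (pw (- t) n - pw (- t) n.+1).
  by rewrite ler_pdivlMl.
by rewrite !mulrBr; lra.
Qed.

Lemma pw_divergent s M : s <= 1 -> exists n, M <= \sum_(k < n) pw (- s) k.
Proof.
move=> s1.
have H n : ln n.+1%:R <= \sum_(k < n) pw (- s) k.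
  elim: n => [|n IH]; first by rewrite big_ord0 ln1.
  rewrite big_ord_recr /= (le_trans _ (lerD IH (lexx _))) // -lerBlDl.
  rewrite (le_trans (ln_step_le n)) // -pw1 -pwN le_pw // lerN2.
  by [].
exists (Num.truncn (expR M)); apply: le_trans (H _).
by rewrite -{1}(expRK M) ler_ln ?posrE ?expR_gt0 ?ltr0n // ltW // truncnS_gt.
Qed.

Lemma pwN_small a e : 0 < a -> 0 < e -> exists N, forall n, (N <= n)%N -> pw (- a) n <= e.
Proof.
move=> a0 e0; exists (Num.truncn (e `^ (- a^-1))) => n Nn.
have e1 : e `^ (- a^-1) <= n.+1%:R.
  by apply: ltW; apply: (lt_le_trans (truncnS_gt _)); rewrite ler_nat.
rewrite /pw (_ : e = (e `^ (- a^-1)) `^ (- a)); last first.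
  by rewrite -powRrM mulrNN mulVf ?gt_eqF // powRr1 // ltW.
rewrite !(powRN _ a) lef_pV2 ?posrE; last 2 first.
- by rewrite powR_gt0 // ltr0n.
- by rewrite !powR_gt0.
by apply: ge0_ler_powR => //; rewrite ?nnegrE ?powR_ge0 ?ler0n // ltW.
Qed.

End power_sequences.

Section log_weights.
Context {R : realType} (t : R).
Hypothesis t_ge0 : 0 <= t.

Let w n : R := ln n.+1%:R `^ t.
Let S n : R := \sum_(0 <= k < n.+1) w k.

Let w_ge0 n : 0 <= w n.
Proof. exact: powR_ge0. Qed.

Let SS n : S n.+1 = S n + w n.+1.
Proof. by rewrite /S big_nat_recr. Qed.

Let l2 : 0 < ln 2 `^ t :> R.
Proof. by rewrite powR_gt0 // ln_gt0 // ltr1n. Qed.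

Let S_lower n : n%:R * ln 2 `^ t <= S n.
Proof.
elim: n => [|n IH]; first by rewrite mul0r; apply: sumr_ge0.
rewrite SS -natr1 mulrDl mul1r lerD // /w.
apply: ge0_ler_powR => //; rewrite ?nnegrE ?ln_ge0 ?ler1n //.
by rewrite ler_ln ?posrE ?ltr0n // ler_nat.
Qed.

(** [S 0] is a power of ln 1, hence 0 as soon as t > 0. Positivity starts at index 1, which is also
    the first weight that the algorithm uses. *)
Let S_gt0 n : 0 < S n.+1.
Proof. by apply: lt_le_trans (S_lower _); rewrite mulr_gt0 // ltr0n. Qed.

Lemma log_weightE n : log_weight t n = w n / S n. Proof. by []. Qed.

Lemma log_weight_ge0 n : 0 <= log_weight t n.
Proof. by rewrite divr_ge0 ?powR_ge0 //; apply: sumr_ge0 => k _; exact: powR_ge0. Qed.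

Lemma log_weight_le1 n : log_weight t n.+1 <= 1.
Proof.
rewrite log_weightE ler_pdivrMr // mul1r SS lerDr.
by apply: sumr_ge0 => k _; exact: w_ge0.
Qed.

(** Multiplied by [S], the averaging recursion becomes a running sum with weights [w]; both
    averaging lemmas work on this form. *)
Let S_step n x y : S n.+1 * ((1 - log_weight t n.+1) * x + log_weight t n.+1 * y) =
  S n * x + w n.+1 * y.
Proof.
rewrite log_weightE; move: (S_gt0 n); rewrite SS.
by move: (S n) (w n.+1) => s v sv; field; exact: lt0r_neq0.
Qed.

(** Cesaro argument: the terms up to [N] contribute a constant, which the at least linear growth of
    [S] makes negligible. Only an inequality is required of [e], so that it may be the norm of an
    averaged error. *)
Lemma weighted_average_cvg0 (e x : nat -> R) : (forall n, 0 <= e n) ->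
  (forall n, e n.+1 <= (1 - log_weight t n.+1) * e n + log_weight t n.+1 * x n.+1) ->
  x @ \oo --> 0 -> e @ \oo --> 0.
Proof.
move=> e0 eS /cvgr0Pnorm_lt x0; apply/cvgr0Pnorm_lt => eps eps0.
have eps2 : 0 < eps / 2 by rewrite divr_gt0.
have [N _ xN] := x0 _ eps2.
have H n : (N <= n)%N -> S n * e n <= S N * e N + eps / 2 * S n.
  move=> Nn; rewrite -(subnKC Nn); elim: (n - N)%N => [|k IH].
    by rewrite addn0 lerDl mulr_ge0 //; [exact: ltW|exact: sumr_ge0].
  rewrite addnS; set m := (N + k)%N in IH *.
  apply: (@le_trans _ _ (S m * e m + w m.+1 * x m.+1)).
    by rewrite -S_step ler_wpM2l // ltW.
  rewrite [in leRHS]SS mulrDr addrA lerD // mulrC ler_wpM2r //.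
  have := xN m.+1; rewrite /= -addnS leq_addr => /(_ isT).
  by rewrite ltr_norml => /andP[_ /ltW].
have [M MP] : exists M, S N * e N < eps / 2 * (M%:R * ln 2 `^ t).
  exists (Num.truncn (S N * e N / (eps / 2 * ln 2 `^ t))).+1.
  by rewrite mulrCA mulrC -ltr_pdivrMr ?mulr_gt0 // truncnS_gt.
exists (maxn N M.+1) => // n /=; rewrite geq_max => /andP[Nn Mn].
rewrite ger0_norm //; case: n => // n in Nn Mn *.
rewrite -(ltr_pM2l (S_gt0 n)) (le_lt_trans (H _ Nn)) //.
have : S N * e N < eps / 2 * S n.+1.
  apply: (lt_le_trans MP); rewrite ler_wpM2l ?(ltW eps2) // (le_trans _ (S_lower _)) //.
  by rewrite ler_wpM2r ?(ltW l2) // ler_nat ltnW.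
lra.
Qed.

(** [N'] is chosen before the sequences [y] and [x], from bounds alone: the lemma is meant for the
    quadratic form of the averages in every direction, with a rank that does not depend on the
    direction. *)
Lemma weighted_average_lower (N : nat) (K c b : R) : 0 <= K -> 0 < c ->
  0 <= b < 1 -> exists N', forall y x : nat -> R,
  (forall n, y n.+1 = (1 - log_weight t n.+1) * y n + log_weight t n.+1 * x n.+1) ->
  - K <= y N -> (forall n, (N <= n)%N -> c * pw (- b) n <= x n) ->
  forall n, (N' <= n)%N -> c / 4 * pw (- b) n <= y n.
Proof.
move=> K0 c0 /andP[b0 b1].
set l : R := ln 2 `^ t.
have SN0 : 0 <= S N by apply: sumr_ge0.
set q := S N * K + c * S N.
have q0 : 0 <= q by rewrite addr_ge0 // mulr_ge0 // ltW.
(* Keeping c / 4 leaves 3/4 of the running sum to absorb [q], the contribution of the indices up to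
   [N]; another factor 1/2 comes from S_n >= (n+1)/2 * l. What has to be large is then n^(1-b),
   whence b < 1. *)
have r0 : 0 < 3 / 8 * c * l / (q + 1).
  by rewrite divr_gt0 ?mulr_gt0 ?ltr_wpDl.
have b10 : 0 < 1 - b by rewrite subr_gt0.
have [M MP] := pwN_small b10 r0.
exists (maxn N.+1 M) => y x yS yN xN n; rewrite geq_max => /andP[Nn Mn].
have H m : (N <= m)%N -> (m <= n)%N ->
    - (S N * K) + c * pw (- b) n * (S m - S N) <= S m * y m.
  move=> Nm; rewrite -(subnKC Nm); elim: (m - N)%N => [|k IH].
    by move=> _; rewrite addn0 subrr mulr0 addr0 -mulrN ler_wpM2l.
  rewrite addnS; set i := (N + k)%N in IH * => ik; rewrite yS S_step SS.
  have {}IH := IH (ltnW ik).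
  have : c * pw (- b) n * w i.+1 <= w i.+1 * x i.+1.
    rewrite mulrC ler_wpM2l // (le_trans _ (xN _ _)) //.
      by rewrite ler_wpM2l ?(ltW c0) // pwN_homo.
    by rewrite /i -addnS leq_addr.
  lra.
have {}H := H n (ltnW Nn) (leqnn n).
case: n => // n in Nn Mn H *.
rewrite -(ler_pM2l (S_gt0 n)) (le_trans _ H) //.
set p := pw (- b) n.+1 in H *; have p0 : 0 < p by exact: pw_gt0.
have p1 : p <= 1 by rewrite -(pw0 n.+1) le_pw // oppr_le0.
suff : q <= 3 / 4 * c * p * S n.+1.
  rewrite /q; have : c * p * S N <= c * S N.
    by rewrite ler_wpM2r // ler_piMr // ltW.
  nra.
have Sl : n.+2%:R / 2 * l <= S n.+1.
  apply: le_trans (S_lower _); rewrite ler_wpM2r ?(ltW l2) //.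
  by rewrite ler_pdivrMr // -(natr1 n.+1) mulr_natr mulr2n lerD2l ler1n.
apply: (@le_trans _ _ (3 / 4 * c * p * (n.+2%:R / 2 * l))); last first.
  by rewrite ler_wpM2l // !mulr_ge0 // ltW.
have : pw (- (1 - b)) n.+1 <= 3 / 8 * c * l / (q + 1) by exact: MP.
have -> : pw (- (1 - b)) n.+1 = (p * n.+2%:R)^-1.
  by rewrite -pw1 -pwD -pwN; congr (pw _ _); ring.
rewrite ler_pdivlMr ?ltr_wpDl // ler_pdivrMl ?mulr_gt0 ?ltr0n // => h.
apply: (@le_trans _ _ (q + 1)); first by rewrite lerDl.
by apply: (le_trans h); rewrite le_eqVlt; apply/orP; left; apply/eqP; field.
Qed.

End log_weights.

(** * Smooth convex functions *)

Section matrix_topology.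
Context {R : realType}.

Lemma mx_norm_le_normF m n (A : 'M[R]_(m, n)) : `|A| <= normF A.
Proof.
rewrite [leLHS]/Num.Def.normr /= mx_normrE; apply: bigmax_le => [|i _]; first exact: normF_ge0.
exact: coord_le_normF.
Qed.

Lemma cvg_normF m n (u : nat -> 'M[R]_(m, n)) (l : 'M[R]_(m, n)) :
  (fun k => normF (u k - l)) @ \oo --> 0 -> u @ \oo --> l.
Proof.
move=> /cvgr0Pnorm_lt u0; apply/cvgrPdist_lt => e e0.
have := u0 _ e0; apply: filterS => k; rewrite ger0_norm ?normF_ge0 //.
by rewrite distrC; apply: le_lt_trans; exact: mx_norm_le_normF.
Qed.

Lemma continuous_normF m n : continuous (fun A : 'M[R]_(m, n) => normF A).
Proof.
move=> A; apply: (@continuous_comp _ _ _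
  (fun A : 'M[R]_(m, n) => \sum_i \sum_j A i j ^+ 2) Num.sqrt); last first.
  exact: sqrt_continuous.
have addc : continuous (fun x : R * R => x.1 + x.2) by exact: add_continuous.
have cc : continuous (fun A : 'M[R]_(m, n) => \sum_i \sum_j A i j ^+ 2).
  apply: (continuous_big (op := +%R) addc) => i _.
  apply: (continuous_big (op := +%R) addc) => j _ B.
  have -> : (fun x : 'M[R]_(m, n) => x i j ^+ 2) = (fun x => x i j * x i j).
    by apply/funext => x; rewrite expr2.
  by apply: continuousM; apply: differentiable_continuous; exact: differentiable_coord.
exact: cc.
Qed.

Lemma trmx_continuous m n : continuous (@trmx R m n).
Proof.
move=> A U [N nN NU]; exists (fun i j => N j i) => [i j|B BN].
  by have := nN j i; rewrite mxE.
by apply: NU => i j; rewrite mxE; exact: BN.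
Qed.

Lemma psum_le (a : nat -> R) m n : (forall k, 0 <= a k) -> (m <= n)%N ->
  \sum_(k < m) a k <= \sum_(k < n) a k.
Proof.
move=> a0 mn; rewrite -(subnKC mn); elim: (n - m)%N => [|k IH]; first by rewrite addn0.
by rewrite addnS big_ord_recr /= (le_trans IH) // lerDl.
Qed.

End matrix_topology.

Section directional.
Context {R : realType} {d : nat}.
Implicit Types (f : 'cV[R]_d -> R) (h k : 'cV[R]_d).

Lemma derive_sum f h k : differentiable f h ->
  'D_k f h = \sum_j k j ord0 * 'D_(delta_mx j ord0) f h.
Proof.
move=> df; have lin := @linearP _ _ _ _ ('d f h).
rewrite deriveE //.
under eq_bigr do rewrite deriveE // -[_ * _]/(_ *: (_ : R^o)) -linearZ.
rewrite -linear_sum; congr ('d f h _); apply/colP => i.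
rewrite summxE (bigD1 i) //= !mxE !eqxx mulr1 big1 ?addr0 // => j ji.
by rewrite !mxE eq_sym (negbTE ji) mulr0.
Qed.

Lemma is_derive_line f h k (t : R) : differentiable f (h + t *: k) ->
  is_derive t 1 (fun s : R => f (h + s *: k)) ('D_k f (h + t *: k)).
Proof.
move=> df; have := diff_derivable (v := k) df.
have E : (fun s : R => s^-1 *: (((fun s : R => f (h + s *: k)) \o shift t) (s *: 1)
      - f (h + t *: k))) =
    (fun s : R => s^-1 *: ((f \o shift (h + t *: k)) (s *: k) - f (h + t *: k))).
  apply/funext => s /=; congr (_ *: (f _ - _)).
  by rewrite /shift /= scaler1 scalerDl addrCA.
by move=> dk; apply: DeriveDef; rewrite /derivable /derive E.
Qed.

Section smooth.
Variable G : 'cV[R]_d -> R.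
Hypothesis G_diff2 : forall h, twice_differentiable G h.

Let G_diff h : differentiable G h.
Proof. by have [/nbhs_singleton] := G_diff2 h. Qed.

Let dG_diff h i : differentiable (fun y => gradient G y i ord0) h.
Proof.
have [_ dg] := G_diff2 h.
exact: (differentiable_comp dg (differentiable_coord _ _ _)).
Qed.

Lemma G_continuous : continuous G.
Proof. by move=> h; exact: differentiable_continuous. Qed.

Lemma gradient_continuous i : continuous (fun y => gradient G y i ord0).
Proof. by move=> h; exact: differentiable_continuous. Qed.

Lemma is_derive_G h k (t : R) :
  is_derive t 1 (fun s : R => G (h + s *: k)) (mxdot k (gradient G (h + t *: k))).
Proof.
have := is_derive_line (G_diff (h + t *: k)); rewrite derive_sum //.
by congr is_derive; apply: eq_bigr => i _; rewrite big_ord1 (ord1 ord0) !mxE.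
Qed.

Lemma is_derive_gradient h k (t : R) :
  is_derive t 1 (fun s : R => mxdot k (gradient G (h + s *: k)))
    (quad (hessian G (h + t *: k)) k).
Proof.
have -> : (fun s : R => mxdot k (gradient G (h + s *: k))) =
    \sum_i (k i ord0 \*: (fun s : R => gradient G (h + s *: k) i ord0)).
  by apply/funext => s; rewrite fct_sumE; apply: eq_bigr => i _; rewrite big_ord1 (ord1 ord0).
have -> : quad (hessian G (h + t *: k)) k =
    \sum_i (k i ord0 *: 'D_k (fun y => gradient G y i ord0) (h + t *: k)).
  apply: eq_bigr => i _; rewrite big_ord1 (ord1 ord0) !mxE derive_sum //.
  by congr (_ * _); apply: eq_bigr => j _; rewrite !mxE mulrC.
by apply: is_derive_sum => i; apply: is_deriveZ; exact: is_derive_line.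
Qed.

Lemma hessian_mean_value h k (t : R) : 0 <= t ->
  exists2 s, 0 <= s <= t & mxdot k (gradient G (h + t *: k)) - mxdot k (gradient G h) =
    t * quad (hessian G (h + s *: k)) k.
Proof.
move=> t0; have [||c] := @MVT_segment R (fun s => mxdot k (gradient G (h + s *: k)))
  (fun s => quad (hessian G (h + s *: k)) k) 0 t t0.
- by move=> x _; exact: is_derive_gradient.
- apply: derivable_within_continuous => x _.
  exact: (@ex_derive _ _ _ _ _ _ _ (is_derive_gradient h k x)).
rewrite in_itv /= scale0r addr0 subr0 => ct E.
by exists c => //; rewrite E mulrC.
Qed.

Section hessian_bound.
Variable L : R.
Hypothesis L_gt0 : 0 < L.
Hypothesis hessian_le : forall h, normop (hessian G h) <= L.

Lemma normop_le m n (A : 'M[R]_(m, n)) (x : 'cV[R]_n) :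
  normF (A *m x) <= normop A * normF x.
Proof.
have [->|/eqP x0] := eqVneq x 0; first by rewrite mulmx0 !normF0 mulr0.
have nx0 : 0 < normF x.
  by rewrite lt_neqAle normF_ge0 eq_sym normF_eq0 andbT; exact/eqP.
rewrite -ler_pdivrMr //; apply: ub_le_sup.
  exists (normF A) => _ [y /= y1 <-]; rewrite norm2E in y1; rewrite norm2E.
  by rewrite (le_trans (normF_mulmx _ _)) // ler_piMr // normF_ge0.
exists ((normF x)^-1 *: x) => /=.
  by rewrite norm2E normFZ ger0_norm ?invr_ge0 ?normF_ge0 // mulVf // gt_eqF.
by rewrite norm2E -scalemxAr normFZ ger0_norm ?invr_ge0 ?normF_ge0 // mulrC.
Qed.

Lemma quad_hessian_le h k : quad (hessian G h) k <= L * normF k ^+ 2.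
Proof.
rewrite (le_trans (ler_norm _)) // (le_trans (mxdot_le _ _)) //.
rewrite mulrC expr2 mulrA ler_wpM2r ?normF_ge0 // (le_trans (normop_le _ _)) //.
by rewrite ler_wpM2r // normF_ge0.
Qed.

(** Along the segment, G minus its linear part and [M / 2 * s ^+ 2] has derivative at most 0, by the
    mean value theorem applied to the gradient; a second mean value theorem concludes, without any
    integral. *)
Lemma descent h k : G (h + k) <= G h + mxdot (gradient G h) k + L / 2 * normF k ^+ 2.
Proof.
set M := L * normF k ^+ 2.
pose psi (s : R) := G (h + s *: k) - (mxdot k (gradient G h) * s + M / 2 * s ^+ 2).
pose dpsi (s : R) := mxdot k (gradient G (h + s *: k)) -
  (mxdot k (gradient G h) + M * s).
have dpsiP (s : R) : is_derive s 1 psi (dpsi s).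
  have d1 : is_derive s (1 : R) (mxdot k (gradient G h) \*: (id : R -> R)) _ :=
    is_deriveZ _ (is_derive_id s 1).
  have d2 : is_derive s (1 : R) ((M / 2) \*: ((id : R -> R) ^+ 2)) _ :=
    is_deriveZ _ (is_deriveX 2 (is_derive_id s 1)).
  have d3 := is_deriveB (is_derive_G h k s) (is_deriveD d1 d2).
  apply: (is_derive_eq d3).
  by rewrite /dpsi /GRing.scale /= !mulr1 expr1; congr (_ - (_ + _)); field.
have [|c] := @MVT_segment R psi dpsi 0 1 ler01 (fun x _ => dpsiP x).
  apply: derivable_within_continuous => x _.
  exact: (@ex_derive _ _ _ _ _ _ _ (dpsiP x)).
rewrite in_itv /= => /andP[c0 c1] E.
have [s /andP[s0 sc] Es] := hessian_mean_value h k c0.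
have : dpsi c <= 0.
  rewrite /dpsi opprD addrA Es.
  have := ler_wpM2l c0 (quad_hessian_le (h + s *: k) k); rewrite -/M; lra.
move: E; rewrite subr0 mulr1 => <-.
rewrite /psi scale0r !addr0 scale1r expr1n expr0n /=.
by rewrite /M (mxdotC k) !mulr0 !mulr1; lra.
Qed.

End hessian_bound.

Section convex.
Hypothesis G_convex : convex_fun G.

Lemma convex_line h k (t : R) : 0 <= t <= 1 ->
  G (h + t *: k) <= (1 - t) * G h + t * G (h + k).
Proof.
move=> /andP[t0 t1]; have := @G_convex (Itv01 t0 t1) (h + k) h.
rewrite !inE => /(_ Logic.I Logic.I); rewrite convRE /=.
have -> : @conv R (convex_lmodType 'cV[R]_d) (Itv01 t0 t1) (h + k) h = h + t *: k.
  change (t *: (h + k) + (1 - t) *: h = h + t *: k).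
  by rewrite scalerDr scalerBl scale1r addrC -addrA addKr.
by rewrite /unstable.onem; lra.
Qed.

Lemma convex_gradient h k : G h + mxdot (gradient G h) k <= G (h + k).
Proof.
have [dG vG] := is_derive_G h k 0.
rewrite -lerBrDl mxdotC; move: vG; rewrite scale0r addr0 => <-.
move/cvg_dnbhs_at_right : dG => dG.
rewrite /derive -(cvg_lim _ dG) //; apply: limr_le; first exact: cvgP dG.
near=> s.
have s0 : 0 < s by near: s; exact: nbhs_right_gt.
have s1 : s <= 1 by near: s; exact: nbhs_right_le.
rewrite /= scale0r addr0 /shift /= addr0 scaler1 -[_ *: _]/(s^-1 * _).
rewrite ler_pdivrMl // lerBlDr.
have := @convex_line h k s; rewrite ltW //= s1 => /(_ isT); lra.
Unshelve. all: by end_near. Qed.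

Lemma gradient_monotone h k : mxdot k (gradient G h) <= mxdot k (gradient G (h + k)).
Proof.
have := convex_gradient h k; have := convex_gradient (h + k) (- k).
by rewrite addrK mxdotNr !(mxdotC k); lra.
Qed.

(** Limit of the difference quotients of the gradient, nonnegative by monotonicity. This is the sign
    that makes the drift harmless in the estimation of the inverse Hessian. *)
Lemma hessian_psd h k : 0 <= quad (hessian G h) k.
Proof.
have [dG vG] := is_derive_gradient h k 0.
move: vG; rewrite scale0r addr0 => <-.
move/cvg_dnbhs_at_right : dG => dG.
rewrite /derive -(cvg_lim _ dG) //; apply: limr_ge; first exact: cvgP dG.
near=> s.
have s0 : 0 < s by near: s; exact: nbhs_right_gt.
rewrite /= scale0r addr0 /shift /= addr0 scaler1 -[_ *: _]/(s^-1 * _).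
rewrite mulr_ge0 ?invr_ge0 ?(ltW s0) // subr_ge0.
by have := gradient_monotone h (s *: k); rewrite !mxdotZl ler_pM2l.
Unshelve. all: by end_near. Qed.

Section minimum.
Variables (theta : 'cV[R]_d) (L : R).
Hypothesis theta_zero : gradient G theta = 0.
Hypothesis theta_unique : forall h, gradient G h = 0 -> h = theta.
Hypothesis L_gt0 : 0 < L.
Hypothesis hessian_le : forall h, normop (hessian G h) <= L.

Lemma G_min h : G theta <= G h.
Proof.
have := convex_gradient theta (h - theta).
by rewrite theta_zero mxdot0l addr0 addrCA subrr addr0.
Qed.

(** A gradient step of length 1/L lowers [G] by at least |grad|^2 / (2L), and cannot go below the
    minimum. *)
Lemma gradient_le_gap h : normF (gradient G h) ^+ 2 <= 2 * L * (G h - G theta).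
Proof.
have := descent hessian_le h (- L^-1 *: gradient G h).
have := G_min (h + - L^-1 *: gradient G h).
rewrite mxdotZr -normF_sqr normFZ normrN ger0_norm ?invr_ge0 ?(ltW L_gt0) //.
set u := normF _ ^+ 2; rewrite exprMn -/u.
have -> : L / 2 * (L^-1 ^+ 2 * u) = L^-1 * u / 2 by field; rewrite gt_eqF.
move=> h1 h2; have : L^-1 * u / 2 <= G h - G theta by lra.
by rewrite -mulrA ler_pdivrMl // ; lra.
Qed.

Lemma gap_le_gradient h : G h - G theta <= normF (gradient G h) * normF (h - theta).
Proof.
have := convex_gradient h (theta - h); rewrite addrCA subrr addr0.
have := le_trans (ler_norm _) (mxdot_le (- gradient G h) (theta - h)).
rewrite normFN -(normFN (theta - h)) opprB mxdotNl; lra.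
Qed.

(** On the sphere of radius r the gap attains a minimum, positive because a zero gap forces a zero
    gradient, hence the point [theta]. Convexity along rays turns this into linear growth outside
    the sphere. *)
Lemma gap_coercive r : 0 < r -> exists2 m, 0 < m &
  forall h, r <= normF (h - theta) -> m * normF (h - theta) <= G h - G theta.
Proof.
move=> r0; pose K := [set x : 'rV[R]_d | normF x = r].
(* The sphere is empty in dimension 0; then no point is at distance at least r and any [m] will
   do. *)
have [K0|/set0P K0] := eqVneq K set0.
  exists 1 => // h; set v := h - theta => rv.
  have v0 : 0 < normF v by exact: lt_le_trans rv.
  have : K ((r / normF v) *: v^T).
    rewrite /K /= normFZ normF_trmx ger0_norm ?divfK ?gt_eqF //.
    by rewrite divr_ge0 // ltW.
  by rewrite K0.
have cK : compact K.
  apply: bounded_closed_compact.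
    exists r; split; first exact: num_real.
    move=> M rM x /= xr; rewrite (le_trans (mx_norm_le_normF x)) // xr.
    exact: ltW.
  apply: (preimage_closed (D := [set x | x = r])); last exact: closed_eq.
  by move=> x _; exact: continuous_normF.
pose f (x : 'rV[R]_d) := G (theta + x^T).
have cf : continuous f.
  move=> x; apply: (@continuous_comp _ _ _ (fun x : 'rV[R]_d => theta + x^T) G).
    by apply: continuousD; [exact: cst_continuous|exact: trmx_continuous].
  exact: G_continuous.
have [c cK' fc] := compact_EVT_min K0 cK (continuous_subspaceT cf).
move: cK'; rewrite inE => cr.
have mc : 0 < f c - G theta.
  rewrite lt_neqAle subr_ge0 G_min andbT eq_sym; apply/eqP => E.
  have g0 : gradient G (theta + c^T) = 0.
    apply/eqP; rewrite -normF_eq0 -sqrf_eq0 eq_le sqr_ge0 andbT.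
    by rewrite (le_trans (gradient_le_gap _)) // -/(f c) E mulr0.
  have := theta_unique g0; rewrite -[RHS]addr0 => /addrI cT.
  by move: cr; rewrite /K /= -normF_trmx cT normF0 => rr; rewrite -rr ltxx in r0.
exists ((f c - G theta) / r); first by rewrite divr_gt0.
move=> h; set v := h - theta => rv.
have v0 : 0 < normF v by exact: lt_le_trans rv.
have fv : f c <= G (theta + (r / normF v) *: v).
  have := fc ((r / normF v) *: v^T); rewrite /f linearZ /= trmxK; apply.
  rewrite inE /K /= normFZ normF_trmx ger0_norm ?divfK ?gt_eqF //.
  by rewrite divr_ge0 // ltW.
have := @convex_line theta v (r / normF v); rewrite divr_ge0 ?(ltW r0) ?(ltW v0) //.
rewrite ler_pdivrMr // mul1r rv => /(_ isT) H.
have hv : theta + v = h by rewrite addrCA subrr addr0.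
rewrite hv in H.
rewrite mulrAC -mulrA -ler_pdivlMr ?divr_gt0 // invf_div mulrC.
by move: (le_trans fv H); set q := r / normF v; nra.
Qed.

(* A bounded gap keeps [u] bounded by coercivity; if the gap also stayed above
   some e, convexity would keep the gradient away from 0. *)
Lemma gap_liminf (u : nat -> 'cV[R]_d) (delta : nat -> R) (C C' : R) :
  (forall n, 0 <= delta n) ->
  (forall M, exists n, M <= \sum_(k < n) delta k) ->
  (forall n, G (u n) - G theta <= C) ->
  (forall n, \sum_(k < n) delta k * normF (gradient G (u k)) ^+ 2 <= C') ->
  forall e N, 0 < e -> exists2 n, (N <= n)%N & G (u n) - G theta < e.
Proof.
move=> d0 dvg VC dC e N e0; apply: contrapT => nex.
have Ve n : (N <= n)%N -> e <= G (u n) - G theta.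
  by move=> Nn; rewrite leNgt; apply/negP => lt; apply: nex; exists n.
have [m m0 mP] := gap_coercive ltr01.
have C0 : 0 <= C by apply: le_trans (VC 0%N); rewrite subr_ge0 G_min.
set B := 1 + C / m.
have B0 : 0 < B by rewrite ltr_pwDl // divr_ge0 // ltW.
have uB n : normF (u n - theta) <= B.
  have [u1|/ltW u1] := leP (normF (u n - theta)) 1.
    by rewrite (le_trans u1) // lerDl divr_ge0 // ltW.
  rewrite -(@ler_pM2l _ m) // (le_trans (mP _ u1)) // (le_trans (VC n)) //.
  by rewrite mulrDr mulrCA divff ?gt_eqF // !mulr1 lerDr ltW.
have gB n : (N <= n)%N -> (e / B) ^+ 2 <= normF (gradient G (u n)) ^+ 2.
  move=> Nn; rewrite ler_pXn2r ?nnegrE ?normF_ge0 ?divr_ge0 ?(ltW e0) ?(ltW B0) //.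
  rewrite ler_pdivrMr // (le_trans (Ve n Nn)) // (le_trans (gap_le_gradient _)) //.
  by rewrite ler_wpM2l // normF_ge0.
set c := (e / B) ^+ 2; have c0 : 0 < c by rewrite exprn_gt0 // divr_gt0.
(* The gradient is bounded below only from rank [N] on, so the weights before [N] are added back on
   the right. *)
have sumle n : c * \sum_(k < n) delta k <= C' + c * \sum_(k < N) delta k.
  have : c * \sum_(k < n) delta k <= \sum_(k < n) delta k * normF (gradient G (u k)) ^+ 2
      + c * \sum_(k < N) delta k.
    have S0 : 0 <= c * \sum_(k < N) delta k by rewrite mulr_ge0 ?(ltW c0) // sumr_ge0.
    elim: n => [|n IH]; first by rewrite !big_ord0 mulr0 add0r.
    have [nN|Nn] := ltnP n N.
      rewrite (@le_trans _ _ (c * \sum_(k < N) delta k)) //.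
        by rewrite ler_wpM2l ?(ltW c0) // psum_le.
      by rewrite lerDr sumr_ge0 // => k _; rewrite mulr_ge0 // sqr_ge0.
    rewrite !big_ord_recr /= mulrDr addrAC lerD // mulrC ler_wpM2l //.
    exact: gB.
  by move=> /le_trans; apply; rewrite lerD2r.
have [n] := dvg ((C' + c * \sum_(k < N) delta k) / c + 1).
rewrite -(ler_pM2l c0) => /le_trans /(_ (sumle n)).
by rewrite mulrDr mulr1 mulrCA divff ?gt_eqF // mulr1 gerDl leNgt c0.
Qed.

Lemma gap_cvg (u : nat -> 'cV[R]_d) :
  (fun n => G (u n) - G theta) @ \oo --> 0 ->
  (fun n => normF (u n - theta)) @ \oo --> 0.
Proof.
move=> /cvgr0Pnorm_lt V0; apply/cvgr0Pnorm_lt => e e0.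
have [m m0 mP] := gap_coercive e0.
have := V0 _ (mulr_gt0 m0 e0); apply: filterS => n.
rewrite !ger0_norm ?normF_ge0 ?subr_ge0 ?G_min // => Vn.
rewrite ltNge; apply/negP => en.
have := le_lt_trans (mP _ en) Vn; rewrite ltr_pM2l // => ne.
by have := le_lt_trans en ne; rewrite ltxx.
Qed.

End minimum.

End convex.

End smooth.

End directional.

(** * Estimation of the inverse Hessian *)

Section inverse_hessian_step.
Context {R : realType} {d : nat}.
Implicit Types (A : 'M[R]_d) (x z Q : 'cV[R]_d) (e : R).

Definition hinv_step A z Q e : 'M[R]_d :=
  A - e *: ((A *m z) *m Q^T + Q *m (A *m z)^T - 2%:M).

Definition transition z Q e : 'M[R]_d := 1%:M - e *: (Q *m z^T).

Lemma trmx_mulmx_dot x z : x^T *m z = (mxdot x z)%:M.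
Proof. by rewrite [LHS]mx11_scalar mxdotE /mxtrace big_ord1. Qed.

Lemma transition_tr z Q e x : (transition z Q e)^T *m x = x - (e * mxdot Q x) *: z.
Proof.
rewrite /transition linearB /= linearZ /= trmx_mul trmxK trmx1 mulmxBl mul1mx.
congr (_ - _); rewrite -scalemxAl -scalerA; congr (_ *: _).
by rewrite -mulmxA trmx_mulmx_dot mul_mx_scalar.
Qed.

Lemma hinv_step_sym A z Q e : A^T = A -> (hinv_step A z Q e)^T = hinv_step A z Q e.
Proof.
move=> sA; rewrite /hinv_step; set M := (_ - 2%:M).
have sM : M^T = M.
  by rewrite /M linearB /= linearD /= !trmx_mul !trmxK tr_scalar_mx sA;
    congr (_ - _); rewrite addrC.
by rewrite linearB /= linearZ /= sA sM.
Qed.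

Lemma mxdot_sym A x z : A^T = A -> mxdot x (A *m z) = mxdot z (A *m x).
Proof. by move=> sA; rewrite mxdotC mxdot_mulmxl sA. Qed.

Lemma quad_outer x z Q : quad (z *m Q^T) x = mxdot x z * mxdot Q x.
Proof.
by rewrite /quad -mulmxA trmx_mulmx_dot mul_mx_scalar mxdotZr mulrC.
Qed.

(** Completing the product: A - e (A z Q^T + Q z^T A) is (I - e Q z^T) A (I - e Q z^T)^T minus the
    rank-one term e^2 (z^T A z) Q Q^T, the only loss. *)
Lemma quad_hinv_step A z Q e x : A^T = A -> quad (hinv_step A z Q e) x =
  quad A ((transition z Q e)^T *m x) + 2 * e * normF x ^+ 2
  - e ^+ 2 * quad A z * mxdot Q x ^+ 2.
Proof.
move=> sA; rewrite transition_tr /hinv_step -scaleNr quadD quadZ quadD quadD.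
rewrite -[- 2%:M]scaleN1r quadZ quad_scalar !quad_outer.
rewrite [in RHS]/quad mulmxBr !mxdotDl !mxdotDr !mxdotNl !mxdotNr -!scalemxAr.
rewrite !mxdotZl !mxdotZr -/(quad A x) -/(quad A z) (mxdot_sym z x sA).
by rewrite (mxdotC (A *m z)) (mxdotC x Q); ring.
Qed.

(** The premise on [Q] and [z] is conditional on e != 0 because a rejected sample, for which e = 0,
    obeys no bound. *)
Lemma transition_norm_ge z Q e b x : 0 <= e -> (e != 0 -> normF Q * normF z <= b) ->
  e * b <= 2^-1 -> (1 - e * b) * normF x <= normF ((transition z Q e)^T *m x).
Proof.
move=> e0 Qz eb; rewrite transition_tr.
have [->|ne0] := eqVneq e 0; first by rewrite !mul0r scale0r !subr0 mul1r.
have : normF x <= normF (x - (e * mxdot Q x) *: z) + normF ((e * mxdot Q x) *: z).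
  by rewrite (le_trans _ (normFD _ _)) // subrK.
rewrite normFZ normrM ger0_norm // => h.
have : e * `|mxdot Q x| * normF z <= e * (b * normF x).
  rewrite -mulrA ler_wpM2l // (@le_trans _ _ (normF Q * normF x * normF z)) //.
    by rewrite ler_wpM2r ?normF_ge0 // mxdot_le.
  by rewrite mulrAC ler_wpM2r ?normF_ge0 // Qz.
lra.
Qed.

(* The choice of the truncation level makes the quadratic term in e harmless:
   the correction 2 e I dominates it. *)
Lemma hinv_step_lower A z Q e b a x : A^T = A -> 0 <= e ->
  (e != 0 -> normF Q * normF z <= b) -> normF A <= a -> e ^+ 2 * b ^+ 2 * a <= e ->
  quad A ((transition z Q e)^T *m x) + e * normF x ^+ 2 <= quad (hinv_step A z Q e) x.
Proof.
move=> sA e0 Qz Aa eba; rewrite quad_hinv_step // -addrA lerD2l.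
have [->|ne0] := eqVneq e 0; first by rewrite expr0n /= !(mul0r, mulr0) subrr.
have b0 : 0 <= b by apply: le_trans (Qz ne0); rewrite mulr_ge0 ?normF_ge0.
suff : e ^+ 2 * quad A z * mxdot Q x ^+ 2 <= e * normF x ^+ 2 by lra.
apply: (@le_trans _ _ (e ^+ 2 * b ^+ 2 * a * normF x ^+ 2)); last first.
  by rewrite ler_wpM2r // sqr_ge0.
have -> : e ^+ 2 * b ^+ 2 * a * normF x ^+ 2 = e ^+ 2 * (b ^+ 2 * (a * normF x ^+ 2)).
  by ring.
rewrite -mulrA ler_wpM2l ?sqr_ge0 //.
apply: (@le_trans _ _ ((normF A * normF z ^+ 2) * (normF Q ^+ 2 * normF x ^+ 2))).
  apply: (@le_trans _ _ ((normF A * normF z ^+ 2) * mxdot Q x ^+ 2)).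
    by rewrite ler_wpM2r ?sqr_ge0 // (le_trans (ler_norm _)) // quad_le.
  rewrite ler_wpM2l ?mulr_ge0 ?normF_ge0 ?sqr_ge0 //.
  by rewrite !normF_sqr mxdot_sqr_le.
have -> : normF A * normF z ^+ 2 * (normF Q ^+ 2 * normF x ^+ 2) =
    (normF Q * normF z) ^+ 2 * (normF A * normF x ^+ 2) by ring.
apply: ler_pM; rewrite ?mulr_ge0 ?sqr_ge0 ?normF_ge0 //.
  by rewrite ler_pXn2r ?nnegrE ?mulr_ge0 ?normF_ge0 // Qz.
by rewrite ler_wpM2r ?sqr_ge0.
Qed.

(** The factor is known to be 1 only when the result lies strictly inside the ball, since a matrix
    projected from outside lands on the boundary. *)
Lemma projF_scale n b (A : 'M[R]_n) : 0 <= b ->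
  exists2 s, 0 <= s <= 1 & projF b A = s *: A /\ (normF (projF b A) < b -> s = 1).
Proof.
move=> b0; rewrite projFE //; case: ifPn => [_|]; first by exists 1; rewrite ?ler01 ?lexx.
rewrite -ltNge => bA; have A0 : 0 < normF A by exact: le_lt_trans bA.
exists (b / normF A); first by rewrite divr_ge0 ?(ltW A0) // ler_pdivrMr // mul1r ltW.
split=> //; rewrite normFZ ger0_norm ?divr_ge0 ?(ltW A0) // divfK ?gt_eqF //.
by rewrite ltxx.
Qed.

Lemma normF_projF n b (A : 'M[R]_n) : 0 <= b -> normF (projF b A) <= b.
Proof.
move=> b0; rewrite projFE //; case: ifPn => [|]; first by rewrite scale1r.
rewrite -ltNge => bA; have A0 : 0 < normF A by exact: le_lt_trans bA.
by rewrite normFZ ger0_norm ?divr_ge0 ?(ltW A0) // divfK ?gt_eqF.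
Qed.

Lemma normF_projF_le n b (A : 'M[R]_n) : 0 <= b -> normF (projF b A) <= normF A.
Proof.
move=> /(projF_scale A)[s /andP[s0 s1] [-> _]].
by rewrite normFZ ger0_norm // ler_piMl // normF_ge0.
Qed.

(** * Lower bounds on the inverse Hessian estimates along one trajectory *)

Section pathwise.
Variables (A Phi : nat -> 'M[R]_d) (z Q : nat -> 'cV[R]_d) (e : nat -> R).
Variables (cb cb' beta beta' kappa C : R).
Let b n := cb * pw beta n.
Let b' n := cb' * pw beta' n.
Hypotheses (cb_gt0 : 0 < cb) (cb'_gt0 : 0 < cb') (beta_ge0 : 0 <= beta)
  (beta'_ge0 : 0 <= beta') (kappa_lt : kappa < beta') (kappa_01 : 0 <= kappa <= 1) (C_gt0 : 0 < C).
Hypothesis e_ge0 : forall n, 0 <= e n.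
Hypothesis Qz_le : forall n, e n != 0 -> normF (Q n) * normF (z n) <= b n.
Hypothesis eb_le : forall n, e n * b n <= 2^-1.
Hypothesis eb'_le : forall n, e n ^+ 2 * b n ^+ 2 * b' n <= e n.
Hypothesis A0_sym : (A 0)^T = A 0.
Hypothesis AS : forall n, A n.+1 = projF (b' n) (hinv_step (A n) (z n) (Q n) (e n)).
Hypothesis Phi0 : Phi 0 = 1%:M.
Hypothesis PhiS : forall n, Phi n.+1 = transition (z n) (Q n) (e n) *m Phi n.
Hypothesis Phi_le : forall n, normF (Phi n) ^+ 2 <= C.
Hypothesis A_le : forall n, normF (A n) <= C * pw kappa n.
Hypothesis e_divergent : forall M, exists n, M <= \sum_(k < n) e k.

Let b'_ge0 n : 0 <= b' n.
Proof. by rewrite mulr_ge0 ?pw_ge0 // ltW. Qed.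

Let A_sym n : (A n)^T = A n.
Proof.
elim: n => // n IH; rewrite AS.
have [s _ [-> _]] := projF_scale (hinv_step (A n) (z n) (Q n) (e n)) (b'_ge0 n).
by rewrite linearZ /= hinv_step_sym.
Qed.

Let A_le_b' n : normF (A n.+1) <= b' n.+1.
Proof.
rewrite AS (le_trans (normF_projF _ (b'_ge0 n))) // ler_wpM2l ?(ltW cb'_gt0) //.
exact: pw_homo.
Qed.

Let lower_step n x : quad (A n.+1) ((transition (z n.+1) (Q n.+1) (e n.+1))^T *m x)
  + e n.+1 * normF x ^+ 2 <= quad (hinv_step (A n.+1) (z n.+1) (Q n.+1) (e n.+1)) x.
Proof.
apply: (@hinv_step_lower _ _ _ _ (b n.+1) (b' n.+1)) => //; exact: Qz_le.
Qed.

(** The lower bound is capped at 0 because of the projection: multiplication by s in [0, 1] improves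
    a negative lower bound and preserves the bound 0, but would spoil a positive one. *)
Let minr_ge0 (c u v w s : R) : 0 <= v -> 0 <= w -> 0 <= s <= 1 ->
  Num.min 0 u * v + w * v <= c -> Num.min 0 (u + w) * v <= s * c.
Proof.
move=> v0 w0 /andP[s0 s1] H.
have Hc : Num.min 0 (u + w) * v <= c.
  rewrite (le_trans _ H) // -mulrDl ler_wpM2r // !minElt.
  by case: ifP; case: ifP; lra.
have M0 : Num.min 0 (u + w) * v <= 0.
  by rewrite mulr_le0_ge0 // ge_min lexx.
have [c0|c0] := leP 0 c; first by rewrite (le_trans M0) // mulr_ge0.
by rewrite (le_trans Hc) //; nra.
Qed.

(* The initial matrix is not projected, so that A 1 need not be positive. Its
   negative part is transported by the products Phi n of the transition
   matrices, which stay bounded, while e n I is added at each step. *)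
Let eventually_psd : exists N, forall n, (N <= n)%N -> forall x, 0 <= quad (A n) x.
Proof.
(* The 4 comes from |x| <= 2 |T^T x| for the first transition matrix T, since e b <= 1/2. The factor
   1/C converts e |x|^2 into a multiple of |Phi^T x|^2, which is at most C |x|^2. The sum starts at
   e_1, the first step being spent on reaching [A 1]. *)
pose u n := - (4 * normF (A 1%N)) + C^-1 * \sum_(k < n) e k.+1.
have H n x : Num.min 0 (u n) * normF ((Phi n.+1)^T *m x) ^+ 2 <= quad (A n.+1) x.
  elim: n x => [|n IH] x.
    rewrite /u big_ord0 mulr0 addr0 PhiS Phi0 mulmx1.
    have T := @transition_norm_ge (z 0%N) (Q 0%N) (e 0%N) (b 0%N) x (e_ge0 0) (@Qz_le 0) (eb_le 0).
    have hT : normF x <= 2 * normF ((transition (z 0%N) (Q 0%N) (e 0%N))^T *m x).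
      have : 2^-1 * normF x <= (1 - e 0%N * b 0%N) * normF x.
        by rewrite ler_wpM2r ?normF_ge0 //; have := eb_le 0; lra.
      by move=> /le_trans /(_ T); lra.
    have hT2 : normF x ^+ 2 <= 4 * normF ((transition (z 0%N) (Q 0%N) (e 0%N))^T *m x) ^+ 2.
      have -> : 4 = 2 ^+ 2 :> R by ring.
      by rewrite -exprMn ler_pXn2r ?nnegrE ?mulr_ge0 ?normF_ge0.
    have := quad_le (A 1%N) x; rewrite ler_norml => /andP[+ _]; apply: le_trans.
    have Amin : Num.min 0 (- (4 * normF (A 1%N))) = - (4 * normF (A 1%N)).
      by apply: min_r; rewrite oppr_le0 mulr_ge0 ?normF_ge0.
    rewrite Amin mulNr lerN2; have := ler_wpM2l (normF_ge0 (A 1%N)) hT2.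
    by set t := _ ^+ 2; set v := _ ^+ 2; lra.
  rewrite AS; have [s s01 [-> _]] := projF_scale (hinv_step (A n.+1) (z n.+1) (Q n.+1) (e n.+1)) (b'_ge0 n.+1).
  rewrite quadZ; have -> : u n.+1 = u n + C^-1 * e n.+1.
    by rewrite /u big_ord_recr /= mulrDr addrA.
  apply: minr_ge0 => //; first exact: sqr_ge0.
    by rewrite mulr_ge0 // invr_ge0 ltW.
  apply: le_trans (lower_step n x); apply: lerD.
    by rewrite PhiS trmx_mul -mulmxA; exact: IH.
  rewrite -mulrA mulrCA ler_wpM2l // ler_pdivrMl //.
  apply: (@le_trans _ _ (normF (Phi n.+2) ^+ 2 * normF x ^+ 2)).
    rewrite -exprMn ler_pXn2r ?nnegrE ?mulr_ge0 ?normF_ge0 //.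
    by rewrite -(normF_trmx (Phi _)) normF_mulmx.
  by rewrite ler_wpM2r ?sqr_ge0.
have [N NP] := e_divergent (C * (4 * normF (A 1%N)) + e 0%N).
exists N.+1; case=> // n; rewrite ltnS => Nn x.
apply: le_trans (H n x); suff -> : Num.min 0 (u n) = 0 by rewrite mul0r.
apply: min_l; rewrite /u addrC subr_ge0 ler_pdivlMl //.
have : \sum_(k < N) e k <= \sum_(k < n.+1) e k by apply: psum_le => //; exact: ltnW.
by rewrite [X in _ <= X]big_ord_recl /=; lra.
Qed.

Let eventually_unprojected : exists N, forall n, (N <= n)%N ->
  A n.+1 = hinv_step (A n) (z n) (Q n) (e n).
Proof.
have bk : 0 < beta' - kappa by rewrite subr_gt0.
(* The 2 C bounds C (n+2)^kappa by 2 C (n+1)^kappa; the other 2 makes the inequality strict, as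
   needed to exclude the boundary of the ball. *)
have c0 : 0 < cb' / 2 / (2 * C) by rewrite !divr_gt0 // mulr_gt0.
have [N NP] := pwN_small bk c0; exists N => n Nn.
have [s _ [E s1]] := projF_scale (hinv_step (A n) (z n) (Q n) (e n)) (b'_ge0 n).
rewrite AS E s1 ?scale1r // -AS (le_lt_trans (A_le n.+1)) //.
apply: (@le_lt_trans _ _ (2 * C * pw kappa n)).
  by rewrite (mulrC 2) -mulrA ler_wpM2l ?(ltW C_gt0) // pwS_le.
have -> : kappa = beta' + - (beta' - kappa) by ring.
rewrite pwD mulrCA /b' mulrC; rewrite ltr_pM2r ?pw_gt0 //.
have := NP n Nn; rewrite ler_pdivlMr ?mulr_gt0 // mulrC => /le_lt_trans; apply.
by rewrite ltr_pdivrMr // ltr_pMr // ltr1n.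
Qed.

(** If A_n >= l I with l b <= 1/2, one unprojected step gives at least (1 - e b)^2 l + e >= l - 2 e
    l b + e >= l. The constraint l b <= 1/2 is what limits l to the order n^(-beta). *)
Lemma hinv_lower : exists N k, [/\ 0 < k & forall n, (N <= n)%N -> forall x,
  k * pw (- beta) n * normF x ^+ 2 <= quad (A n) x].
Proof.
have [N1 psd] := eventually_psd; have [N2 unproj] := eventually_unprojected.
(* The 1 is there because the lower bound of a step relies on the norm bound given by an earlier
   projection, which [A 0] has not undergone. *)
pose M := maxn N1 (maxn N2 1).
have [m Mm em] : exists2 m, (M <= m)%N & 0 < e m.
  have [n nP] := e_divergent (\sum_(k < M) e k + 1).
  apply: contrapT => ne; suff : \sum_(k < n) e k <= \sum_(k < M) e k by lra.
  have [nM|/ltnW Mn] := leqP n M; first exact: psum_le.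
  rewrite -(subnKC Mn); elim: (n - M)%N => [|k IH]; first by rewrite addn0.
  rewrite addnS big_ord_recr /= -[leRHS]addr0 lerD //.
  by rewrite leNgt; apply/negP => ek; apply: ne; exists (M + k)%N; rewrite ?leq_addr.
(* [e m] is the lower bound created by one accepted step from a nonnegative matrix; [(2 * cb)^-1]
   ensures that k (n+1)^(-beta) b_n <= 1/2. *)
pose k := Num.min (e m) (2 * cb)^-1.
have k0 : 0 < k by rewrite lt_min em invr_gt0 mulr_gt0.
exists m.+1, k; split=> // n mn; rewrite -(subnKC mn).
have lowS i x : (m <= i)%N ->
    quad (A i) ((transition (z i) (Q i) (e i))^T *m x) + e i * normF x ^+ 2 <= quad (A i.+1) x.
  move=> mi; have Mi := leq_trans Mm mi; rewrite unproj; last first.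
    by apply: leq_trans Mi; rewrite !leq_max leqnn orbT.
  case: i mi Mi => [|i] mi Mi; last exact: lower_step.
  by move: Mi; rewrite /M !geq_max ltnn !andbF.
elim: (n - m.+1)%N => [|i IH] x.
  rewrite addn0 (le_trans _ (lowS m x (leqnn m))) // ler_wpDl //.
    apply: psd; apply: leq_trans Mm; exact: leq_maxl.
  rewrite ler_wpM2r ?sqr_ge0 // (@le_trans _ _ (k * 1)) //.
    by rewrite ler_wpM2l ?(ltW k0) // -(pw0 m.+1) le_pw // oppr_le0.
  by rewrite mulr1 ge_min lexx.
rewrite addnS; set j := (m.+1 + i)%N in IH *.
have mj : (m <= j)%N by rewrite /j addSn -addnS leq_addr.
rewrite (le_trans _ (lowS j x mj)) //.
apply: (@le_trans _ _ (k * pw (- beta) j * ((1 - e j * b j) * normF x) ^+ 2 + e j * normF x ^+ 2)); last first.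
  rewrite lerD2r (le_trans _ (IH _)) // ler_wpM2l ?mulr_ge0 ?pw_ge0 ?(ltW k0) //.
  have eb := eb_le j.
  rewrite ler_pXn2r ?nnegrE ?mulr_ge0 ?normF_ge0 ?subr_ge0 //; last by lra.
  by apply: transition_norm_ge => //; exact: Qz_le.
rewrite exprMn [X in _ <= X + _]mulrA -mulrDl ler_wpM2r ?sqr_ge0 //.
apply: (@le_trans _ _ (k * pw (- beta) j)).
  by rewrite ler_wpM2l ?(ltW k0) // pwN_homo.
have kb : k * pw (- beta) j * b j <= 2^-1.
  rewrite /b pwN (_ : _ * _ = k * cb); last by field; rewrite gt_eqF ?pw_gt0.
  by rewrite -ler_pdivlMr // -invfM ge_min lexx orbT.
have l0 : 0 <= k * pw (- beta) j by rewrite mulr_ge0 ?pw_ge0 // ltW.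
have ej := e_ge0 j.
have := ler_wpM2l ej kb.
have : 0 <= k * pw (- beta) j * (e j * b j) ^+ 2 by rewrite mulr_ge0 // sqr_ge0.
set l := k * _; set bj := b j; set ee := e j => h1 h2; nra.
Qed.

Lemma hinv_avg_lower (Abar : nat -> 'M[R]_d) (t : R) : 0 <= t -> beta < 1 ->
  (forall n, Abar n.+1 =
    (1 - log_weight t n.+1) *: Abar n + log_weight t n.+1 *: A n.+1) ->
  exists N k, [/\ 0 < k & forall n, (N <= n)%N -> forall x,
    k * pw (- beta) n * normF x ^+ 2 <= quad (Abar n) x].
Proof.
move=> t0 beta1 AbarS; have [N [k [k0 low]]] := hinv_lower.
have [|N' NP] := @weighted_average_lower R t t0 N (normF (Abar N)) k beta (normF_ge0 _) k0.
  by rewrite beta_ge0.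
exists N', (k / 4); split=> [|n Nn x]; first by rewrite divr_gt0.
have [->|/eqP x0] := eqVneq x 0; first by rewrite normF0 expr0n mulr0 /quad mxdot0l.
have nx : 0 < normF x ^+ 2.
  by rewrite exprn_gt0 // lt_neqAle normF_ge0 eq_sym normF_eq0 andbT; exact/eqP.
rewrite -ler_pdivlMr //.
apply: (NP (fun n => quad (Abar n) x / normF x ^+ 2) (fun n => quad (A n) x / normF x ^+ 2)) => //.
- by move=> i; rewrite AbarS quadD !quadZ mulrDl !mulrA.
- rewrite ler_pdivlMr // mulNr.
  by have := quad_le (Abar N) x; rewrite ler_norml => /andP[].
- by move=> i Ni; rewrite ler_pdivlMr //; exact: low.
Qed.

End pathwise.

End inverse_hessian_step.

(** * Expectations and integration over one step with the state frozen *)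

Section expectations.
Context {dT : measure_display} {T : measurableType dT} {R : realType}
  (P : probability T R).

Lemma has_expectation_cst (c : R) : has_expectation P (fun=> c) c.
Proof.
split; first exact: finite_measure_integrable_cst.
exact: expectation_cst.
Qed.

Lemma has_expectationD (Y Y' : T -> R) a a' : has_expectation P Y a ->
  has_expectation P Y' a' -> has_expectation P (fun w => Y w + Y' w) (a + a').
Proof.
move=> [iY EY] [iY' EY']; split.
  by have := integrableD measurableT iY iY'; under eq_fun do rewrite -EFinD.
move: EY EY'; rewrite unlock => EY EY'; rewrite EFinD -EY -EY' -integralD //.
Qed.

Lemma has_expectationZ (Y : T -> R) a k : has_expectation P Y a ->
  has_expectation P (fun w => k * Y w) (k * a).
Proof.
move=> [iY EY]; split.
  by have := integrableZl measurableT k iY; under eq_fun do rewrite -EFinM.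
move: EY; rewrite unlock => EY; rewrite EFinM -EY -integralZl //.
Qed.

Lemma has_expectation_sum I (r : seq I) (Y : I -> T -> R) (a : I -> R) :
  (forall i, has_expectation P (Y i) (a i)) ->
  has_expectation P (fun w => \sum_(i <- r) Y i w) (\sum_(i <- r) a i).
Proof.
move=> Ya; elim: r => [|i r IH].
  by rewrite big_nil; under eq_fun do rewrite big_nil; exact: has_expectation_cst.
rewrite big_cons; under eq_fun do rewrite big_cons.
exact: has_expectationD.
Qed.

Lemma has_expectation_mxdot m n (Y : T -> 'M[R]_(m, n)) (M B : 'M[R]_(m, n)) :
  has_expectation_mx P Y M -> has_expectation P (fun w => mxdot B (Y w)) (mxdot B M).
Proof.
move=> YM; apply: has_expectation_sum => i; apply: has_expectation_sum => j.
exact: has_expectationZ.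
Qed.

Lemma expectation_ge0_le (f : T -> \bar R) (Y : T -> R) a :
  measurable_fun setT f -> (forall w, 0 <= f w)%E -> has_expectation P Y a ->
  {ae P, forall w, (f w <= (Y w)%:E)%E} -> (\int[P]_w f w <= a%:E)%E.
Proof.
move=> mf f0 [iY EY] fY.
have mY : measurable_fun setT Y by apply/measurable_EFinP; exact: measurable_int iY.
have mYp : measurable_fun setT (fun w => (Num.max (Y w) 0)%:E).
  by apply/measurable_EFinP; exact: measurable_maxr.
(* [Y] may be negative on a null set; its positive part keeps the comparison among nonnegative
   functions. *)
apply: (@le_trans _ _ (\int[P]_w (Num.max (Y w) 0)%:E)%E).
  apply: ae_ge0_le_integral => //; first by move=> w _; rewrite lee_fin le_max lexx orbT.
  apply: filterS fY => w fw _; apply: (le_trans fw).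
  by rewrite lee_fin le_max lexx.
rewrite -EY unlock le_eqVlt; apply/orP; left; apply/eqP.
apply: ae_eq_integral => //; first by apply/measurable_EFinP.
apply: filterS fY => w fw _; congr EFin; apply: max_l.
by rewrite -lee_fin (le_trans (f0 w)).
Qed.

Lemma expectation_le (f : T -> \bar R) (Y N : T -> R) a k C :
  measurable_fun setT f -> (forall w, 0 <= f w)%E -> has_expectation P Y a ->
  measurable_fun setT N -> (forall w, 0 <= N w) -> ('E_P[N] <= C%:E)%E -> 0 <= k ->
  {ae P, forall w, (f w <= (Y w + k * N w)%:E)%E} ->
  (\int[P]_w f w <= (a + k * C)%:E)%E.
Proof.
move=> mf f0 EY mN N0 EN k0 fY.
have I0 : (0 <= 'E_P[N])%E by rewrite unlock; apply: integral_ge0 => w _; rewrite lee_fin.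
have If : 'E_P[N]%E \is a fin_num.
  by rewrite ge0_fin_numE // (le_lt_trans EN) // ltry.
have HN : has_expectation P N (fine 'E_P[N]%E).
  split; last by rewrite fineK.
  apply/integrableP; split; first exact/measurable_EFinP.
  under eq_integral do rewrite gee0_abs ?lee_fin //.
  by move: EN; rewrite unlock => /le_lt_trans; apply; rewrite ltry.
apply: (le_trans (expectation_ge0_le mf f0 (has_expectationD EY (has_expectationZ k HN)) fY)).
by rewrite lee_fin lerD2l ler_wpM2l // -lee_fin fineK.
Qed.

Section one_step.
Context {p d : nat} (G : set (set T)) (Xn Yn : T -> 'cV[R]_p) (Zn : T -> 'cV[R]_d).
Hypothesis G_measurable : G `<=` measurable.
Hypothesis Xn_measurable : measurable_fun setT Xn.
Hypothesis Yn_measurable : measurable_fun setT Yn.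
Hypothesis Zn_measurable : measurable_fun setT Zn.
Hypothesis Xn_law : same_law P Xn Yn.
Hypothesis Xn_independent :
  independent_of P (G `|` preimage_set_system setT Zn measurable) Xn.
Hypothesis Zn_independent : independent_of P G Zn.

(** Two freezings: first the data sample, independent of the past together with [Zn], then [Zn],
    independent of the past. On the way the sample is replaced by [Yn], in whose law the moments are
    known. The data integral is the inner one, so that the Hessian has become its mean when the
    covariance of [Zn] is used. *)
Lemma integral_step d' (U : measurableType d') (S : T -> U) (B : set T)
    (f : U * ('cV[R]_p * 'cV[R]_d) -> R) (c : U -> R) :
  measurable_fun setT (S : g_sigma_algebraType G -> U) -> <<s G >> B ->
  measurable_fun setT f -> (forall s, 0 <= f s) ->
  measurable_fun setT (fun w => c (S w)) ->
  (forall s, (\int[P]_w'' \int[P]_w' (f (s, (Yn w', Zn w'')))%:E <= (c s)%:E)%E) ->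
  (\int[P]_(w in B) (f (S w, (Xn w, Zn w)))%:E <= \int[P]_(w in B) (c (S w))%:E)%E.
Proof.
move=> mS GB mf f0 mc fc.
set GZ := G `|` preimage_set_system setT Zn measurable.
have GZm : GZ `<=` measurable.
  by move=> A [/G_measurable //|[C mC <-]]; exact: Zn_measurable.
have G_GZ : G `<=` GZ by move=> A; left.
have mSZ : measurable_fun setT ((fun w => (S w, Zn w)) : g_sigma_algebraType GZ -> _).
  apply: measurable_fun_pair; first exact: (measurable_finer G_GZ).
  by apply: measurable_generated => A; right.
have GZB : <<s GZ >> B by apply: sub_smallest2r GB.
have mB : measurable B by exact: (g_sigma_algebra_measurable G_measurable).
have mfE : measurable_fun setT (EFin \o f) by exact/measurable_EFinP.
pose f1 (x : (U * 'cV[R]_d) * 'cV[R]_p) : \bar R := (f (x.1.1, (x.2, x.1.2)))%:E.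
have mf1 : measurable_fun setT f1.
  apply: (measurableT_comp mfE).
  apply: measurable_fun_pair; first by apply: measurableT_comp.
  by apply: measurable_fun_pair => //; apply: measurableT_comp.
have f10 x : (0 <= f1 x)%E by rewrite lee_fin.
have E1 := integral_freeze GZm mSZ Xn_measurable Xn_independent GZB mf1 f10.
pose Xm : {RV P >-> 'cV[R]_p} := HB.pack Yn (isMeasurableFun.Build _ _ _ _ _ Yn_measurable).
pose f2 (x : U * 'cV[R]_d) : \bar R := (\int[P]_w' f1 (x, Yn w'))%E.
have mf2 : measurable_fun setT f2.
  have -> : f2 = fubini_F (distribution P Xm) f1.
    apply/funext => x; rewrite /f2 /fubini_F ge0_integral_distribution //.
    exact: measurableT_comp.
  exact: measurable_fun_fubini_tonelli_F.
have f20 x : (0 <= f2 x)%E by apply: integral_ge0 => w _; exact: f10.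
have E2 := integral_freeze G_measurable mS Zn_measurable Zn_independent GB mf2 f20.
rewrite [leLHS](_ : _ = \int[P]_(w in B) f2 (S w, Zn w))%E; last first.
  rewrite -[LHS]/(\int[P]_(w in B) f1 ((S w, Zn w), Xn w))%E E1.
  apply: eq_integral => w _; rewrite /f2.
  apply: (integral_same_law (f := fun x => f1 ((S w, Zn w), x)) Xn_measurable Yn_measurable Xn_law) => //.
  exact: measurableT_comp.
rewrite E2; apply: ge0_le_integral => //.
- by move=> w _; apply: integral_ge0 => w' _; exact: f20.
- apply: measurable_funTS.
  pose Zm : {RV P >-> 'cV[R]_d} := HB.pack Zn (isMeasurableFun.Build _ _ _ _ _ Zn_measurable).
  have -> : (fun w => \int[P]_w' f2 (S w, Zn w'))%E =
      fubini_F (distribution P Zm) f2 \o S.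
    apply/funext => w; rewrite /= /fubini_F ge0_integral_distribution //.
    exact: measurableT_comp.
  apply: measurableT_comp; first exact: measurable_fun_fubini_tonelli_F.
  exact: measurable_coarse mS.
- by apply: measurable_funTS; exact/measurable_EFinP.
- by move=> w _; exact: fc.
Qed.

End one_step.

Lemma frozen_bound p d (Y : T -> 'cV[R]_p) (Z : T -> 'cV[R]_d) (H : 'cV[R]_p -> 'M[R]_d)
    (K S : 'M[R]_d) (f : 'cV[R]_p * 'cV[R]_d -> R) (M q C g c k : R) :
  measurable_fun setT Y -> measurable_fun setT Z -> measurable_fun setT H ->
  measurable_fun setT f -> (forall xz, 0 <= f xz) ->
  has_expectation_mx P (fun w => H (Y w)) K ->
  (forall x, 0 <= quad K x) ->
  ('E_P[fun w => (normF (H (Y w)) `^ q)%R] <= C%:E)%E ->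
  {ae P, forall w, norm2 (Z w) <= M} ->
  has_expectation_mx P (fun w => Z w *m (Z w)^T) 1%:M ->
  0 <= g -> 0 <= k ->
  (forall x z, normF z <= M ->
    f (x, z) <= c - g * mxdot (S *m S^T *m z) (H x *m z) + k * normF (H x) `^ q) ->
  (\int[P]_w'' \int[P]_w' (f (Y w', Z w''))%:E <= (c + k * C)%:E)%E.
Proof.
move=> mY mZ mH mf f0 EH K0 HC ZM EZ g0 k0 fle.
have mHY : measurable_fun setT (fun w => H (Y w)) by exact: measurableT_comp.
have mfE : measurable_fun setT (EFin \o f) by exact/measurable_EFinP.
have inner z : normF z <= M -> (\int[P]_w' (f (Y w', z))%:E <=
    ((c - g * mxdot (S *m S^T *m z) (K *m z)) + k * C)%:E)%E.
  move=> zM.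
  have EY : has_expectation P (fun w => c - g * mxdot (S *m S^T *m z) (H (Y w) *m z))
      (c - g * mxdot (S *m S^T *m z) (K *m z)).
    apply: has_expectationD; first exact: has_expectation_cst.
    rewrite -mulNr; under eq_fun do rewrite -mulNr.
    apply: has_expectationZ.
    have E A : mxdot (S *m S^T *m z) (A *m z) = mxdot (S *m S^T *m z *m z^T) A.
      by rewrite mxdotC mxdot_mulmxr mxdotC.
    by rewrite E; under eq_fun do rewrite E; exact: has_expectation_mxdot.
  apply: (expectation_le _ _ EY _ _ HC k0).
  - apply: (measurableT_comp mfE); exact: measurable_fun_pair.
  - by move=> w; rewrite lee_fin.
  - apply: (measurableT_comp (measurable_powR q)); exact: measurable_normF.
  - by move=> w; exact: powR_ge0.
  - by apply: nearW => w; rewrite lee_fin; exact: fle.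
have EY : has_expectation P
    (fun w => c + k * C + - g * mxdot (S *m S^T *m Z w) (K *m Z w))
    (c + k * C + - g * mxdot ((S *m S^T)^T *m K) 1%:M).
  apply: has_expectationD; first exact: has_expectation_cst.
  apply: has_expectationZ.
  have E z : mxdot (S *m S^T *m z) (K *m z) = mxdot ((S *m S^T)^T *m K) (z *m z^T).
    by rewrite mxdot_mulmxl mulmxA mxdotC mxdot_mulmxr.
  by under eq_fun do rewrite E; exact: has_expectation_mxdot.
(* The trace is the sum of the quadratic form of [K] over the columns of [S]. *)
have SK0 : 0 <= mxdot ((S *m S^T)^T *m K) 1%:M.
  rewrite mxdotC -[1%:M]trmx1 mxdotE trmxK mul1mx trmx_mul trmxK mxtrace_mulC mulmxA.
  rewrite mxtrace_mulC mulmxA.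
  rewrite /mxtrace; apply: sumr_ge0 => j _.
  have -> : (S^T *m K *m S) j j = quad K (col j S).
    rewrite /quad colE mxdotE trmx_mul !mulmxA.
    rewrite /mxtrace big_ord1 trmx_delta -!mulmxA -rowE !mulmxA -colE.
    by rewrite [in RHS]mxE [in RHS]mxE.
  exact: K0.
apply: (@le_trans _ _ (c + k * C + - g * mxdot ((S *m S^T)^T *m K) 1%:M)%:E); last first.
  by rewrite lee_fin gerDl mulNr oppr_le0 mulr_ge0.
apply: (expectation_ge0_le _ _ EY).
- pose Xm : {RV P >-> 'cV[R]_p} := HB.pack Y (isMeasurableFun.Build _ _ _ _ _ mY).
  pose f1 (x : 'cV[R]_d * 'cV[R]_p) : \bar R := (f (x.2, x.1))%:E.
  have mf1 : measurable_fun setT f1.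
    by apply: (measurableT_comp mfE); exact: measurable_fun_pair.
  have -> : (fun w'' => \int[P]_w' (f (Y w', Z w''))%:E)%E =
      fubini_F (distribution P Xm) f1 \o Z.
    apply/funext => w; rewrite /= /fubini_F ge0_integral_distribution //.
      exact: measurableT_comp.
    by move=> x; rewrite lee_fin.
  apply: measurableT_comp => //; apply: measurable_fun_fubini_tonelli_F => //.
  by move=> x; rewrite lee_fin.
- by move=> w; apply: integral_ge0 => w' _; rewrite lee_fin.
- apply: filterS ZM => w; rewrite norm2E => /inner /le_trans; apply.
  by rewrite lee_fin mulNr addrAC.
Qed.

End expectations.

(** * Pointwise bounds for one step with truncation *)

Section one_step_bounds.
Context {R : realType} {d : nat}.
Variables (H : 'M[R]_d) (z : 'cV[R]_d) (M q b g : R).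
Hypotheses (M_ge0 : 0 <= M) (z_le : normF z <= M) (q_gt2 : 2 < q)
  (b_gt0 : 0 < b) (g_ge0 : 0 <= g).
Let Q := H *m z.
Let kept : bool := norm2 Q * norm2 z <= b.
Let e := g * kept%:R.
Let kap := (M ^+ 2) `^ q.
Let h := normF H `^ q.

Let q_gt0 : 0 < q. Proof. by apply: lt_trans q_gt2; rewrite ltr0n. Qed.

Let kap_ge0 : 0 <= kap. Proof. exact: powR_ge0. Qed.

Let h_ge0 : 0 <= h. Proof. exact: powR_ge0. Qed.

Let e_ge0 : 0 <= e.
Proof. by rewrite mulr_ge0 // ler0n. Qed.

Let e_le : e <= g.
Proof. by rewrite /e; case: kept; rewrite ?mulr1 ?mulr0. Qed.

Let y_ge0 : 0 <= normF Q * normF z.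
Proof. by rewrite mulr_ge0 ?normF_ge0. Qed.

Let y_le : normF Q * normF z <= M ^+ 2 * normF H.
Proof.
rewrite (@le_trans _ _ (normF H * normF z * normF z)) //.
  by rewrite ler_wpM2r ?normF_ge0 // normF_mulmx.
rewrite -mulrA mulrC ler_wpM2r ?normF_ge0 // -expr2.
by rewrite ler_pXn2r ?nnegrE ?normF_ge0.
Qed.

Let yq_le : (normF Q * normF z) `^ q <= kap * h.
Proof.
rewrite /kap /h -powRM ?sqr_ge0 ?normF_ge0 //.
by apply: ge0_ler_powR; rewrite ?nnegrE ?mulr_ge0 ?sqr_ge0 ?normF_ge0 // (ltW q_gt0).
Qed.

Lemma rejected_le : (1 - kept%:R) <= kap * b `^ (- q) * h.
Proof.
rewrite mulrAC; have H0 : 0 <= kap * h * b `^ (- q) by rewrite !mulr_ge0 ?powR_ge0.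
have [kp|] := boolP kept; first by rewrite subrr.
rewrite /kept -ltNge !norm2E subr0 => bQ; rewrite powRN ler_pdivlMr ?powR_gt0 // mul1r.
apply: le_trans yq_le; apply: ge0_ler_powR; rewrite ?nnegrE //; exact: ltW.
Qed.

(** Markov's inequality in pointwise form: a rejected y = |Q| |z| exceeds b, so y = y^q y^(1-q) <=
    y^q b^(1-q). *)
Let rejected_moment : (1 - kept%:R) * (normF Q * normF z) <= kap * b `^ (1 - q) * h.
Proof.
rewrite mulrAC; have H0 : 0 <= kap * h * b `^ (1 - q) by rewrite !mulr_ge0 ?powR_ge0.
have [kp|] := boolP kept; first by rewrite subrr mul0r.
rewrite /kept -ltNge !norm2E subr0 mul1r; set y := normF Q * normF z => bQ.
have y0 : 0 < y by exact: lt_trans bQ.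
have -> : y = y `^ q * y `^ (1 - q).
  by rewrite -powRD ?(gt_eqF y0) ?implybT // addrC subrK powRr1 // ltW.
apply: ler_pM; rewrite ?powR_ge0 //.
have -> : 1 - q = - (q - 1) by ring.
rewrite !powRN lef_pV2 ?posrE ?powR_gt0 //.
have q10 : 0 <= q - 1 by rewrite subr_ge0 ltW // (lt_trans _ q_gt2) // ltr1n.
by apply: ge0_ler_powR => //; rewrite ?nnegrE; exact: ltW.
Qed.

Let y2_le : (normF Q * normF z) ^+ 2 <= M ^+ 4 * (1 + h).
Proof.
have hH : normF H ^+ 2 <= 1 + h.
  have [H1|H1] := leP (normF H) 1.
    by rewrite (@le_trans _ _ 1) ?lerDl // expr_le1 // normF_ge0.
  rewrite -powR_mulrn ?normF_ge0 // (@le_trans _ _ h) ?lerDr //.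
  by apply: ler_powR; exact: ltW.
rewrite (@le_trans _ _ ((M ^+ 2 * normF H) ^+ 2)) //.
  by rewrite ler_pXn2r ?nnegrE ?mulr_ge0 ?sqr_ge0 ?normF_ge0.
rewrite exprMn -exprM ler_wpM2l //; exact: exprn_ge0.
Qed.

(* Since z has identity covariance and is independent of H, the term
   on the right has a conditional mean with a sign, unlike the truncated one on
   the left; the difference is controlled by the moment of order q. *)
Let drift_le (S : 'M[R]_d) :
  - e * mxdot (S *m S^T *m z) Q <= - g * mxdot (S *m S^T *m z) Q
    + g * (normF S ^+ 2 * (kap * b `^ (1 - q) * h)).
Proof.
set u := mxdot (S *m S^T *m z) Q.
have ub : `|u| <= normF S ^+ 2 * (normF Q * normF z).
  rewrite (le_trans (mxdot_le _ _)) // mulrCA mulrC ler_wpM2l ?normF_ge0 //.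
  rewrite (le_trans (normF_mulmx _ _)) // ler_wpM2r ?normF_ge0 //.
  by rewrite (le_trans (normF_mulmx _ _)) // normF_trmx expr2.
have S0 : 0 <= normF S ^+ 2 by exact: sqr_ge0.
have := ler_wpM2l S0 rejected_moment.
rewrite /e; case: kept => /=; rewrite ?mulr1 ?mulr0.
  rewrite subrr mul0r mulr0 => h0; rewrite lerDl mulr_ge0 //.
rewrite subr0 mul1r oppr0 mul0r => h0.
have := le_trans (ler_norm u) (le_trans ub h0).
by move=> /(ler_wpM2l g_ge0); lra.
Qed.

Lemma transition_sqnorm_le (S : 'M[R]_d) :
  normF (transition z Q e *m S) ^+ 2 <=
  normF S ^+ 2 * (1 + g ^+ 2 * M ^+ 4) - 2 * g * mxdot (S *m S^T *m z) Q
  + normF S ^+ 2 * (2 * g * kap * b `^ (1 - q) + g ^+ 2 * M ^+ 4) * h.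
Proof.
have dr := drift_le S; set u := mxdot (S *m S^T *m z) Q in dr *.
rewrite /transition mulmxBl mul1mx -scalemxAl.
have -> : normF (S - e *: (Q *m z^T *m S)) ^+ 2 = normF S ^+ 2 - 2 * e * u
    + e ^+ 2 * normF (Q *m z^T *m S) ^+ 2.
  rewrite !normF_sqr mxdotDl !mxdotDr !(mxdotNl, mxdotNr, mxdotZl, mxdotZr).
  rewrite [mxdot (Q *m _ *m S) S]mxdotC.
  have -> : mxdot S (Q *m z^T *m S) = u.
    by rewrite mxdotC mxdot_mulmxr mxdot_mulmxr trmxK mxdotC.
  by ring.
have e2 : e ^+ 2 * normF (Q *m z^T *m S) ^+ 2 <=
    g ^+ 2 * (normF S ^+ 2 * (M ^+ 4 * (1 + h))).
  apply: ler_pM; rewrite ?sqr_ge0 //; first by rewrite ler_pXn2r ?nnegrE.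
  rewrite (@le_trans _ _ ((normF Q * normF z) ^+ 2 * normF S ^+ 2)) //.
    rewrite -exprMn ler_pXn2r ?nnegrE ?mulr_ge0 ?normF_ge0 //.
    by rewrite (le_trans (normF_mulmx _ _)) // normF_outer.
  by rewrite mulrC ler_wpM2l ?sqr_ge0.
by lra.
Qed.

(** The term linear in the norm of [A] comes from the increment 2 e I paired with [A]. It is the one
    contribution of order g, not g^2, apart from the drift and its truncation error. The 8 comes
    from (2u + 2v)^2 <= 8 u^2 + 8 v^2. *)
Lemma hinv_step_sqnorm_le (A : 'M[R]_d) : A^T = A ->
  normF (hinv_step A z Q e) ^+ 2 <=
  normF A ^+ 2 * (1 + 8 * g ^+ 2 * M ^+ 4) + 4 * g * normF (1%:M : 'M[R]_d) * normF A
  + 8 * g ^+ 2 * normF (1%:M : 'M[R]_d) ^+ 2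
  - 4 * g * mxdot (A *m A^T *m z) Q
  + normF A ^+ 2 * (4 * g * kap * b `^ (1 - q) + 8 * g ^+ 2 * M ^+ 4) * h.
Proof.
move=> sA; have dr := drift_le A; rewrite sA in dr *.
set u := mxdot (A *m A *m z) Q in dr *; set nI := normF (1%:M : 'M[R]_d).
rewrite /hinv_step; move NE: (_ - 2%:M) => N.
have -> : normF (A - e *: N) ^+ 2 = normF A ^+ 2 - 2 * e * mxdot A N + e ^+ 2 * normF N ^+ 2.
  rewrite !normF_sqr mxdotDl !mxdotDr !(mxdotNl, mxdotNr, mxdotZl, mxdotZr) (mxdotC N).
  by ring.
have scalE : (2%:M : 'M[R]_d) = 2 *: 1%:M by rewrite scalemx1.
have AN : mxdot A N = 2 * u - 2 * mxdot 1%:M A.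
  rewrite -NE mxdotDr mxdotNr mxdotDr scalE mxdotZr (mxdotC A 1%:M).
  have -> : mxdot A (A *m z *m Q^T) = u.
    by rewrite mxdotC mxdot_mulmxr trmxK /u -mulmxA [RHS]mxdot_mulmxl sA.
  have -> : mxdot A (Q *m (A *m z)^T) = u.
    by rewrite mxdotC mxdot_mulmxr trmxK mxdotC mulmxA.
  by ring.
have tr_le : mxdot 1%:M A <= nI * normF A by exact: le_trans (ler_norm _) (mxdot_le _ _).
have N2 : normF N ^+ 2 <= 8 * (normF A ^+ 2 * (M ^+ 4 * (1 + h))) + 8 * nI ^+ 2.
  have NB : normF N <= 2 * (normF A * (normF Q * normF z)) + 2 * nI.
    rewrite -NE (le_trans (normFB _ _)) // scalE normFZ ger0_norm // lerD2r.
    rewrite (le_trans (normFD _ _)) // !normF_outer.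
    have : normF (A *m z) * normF Q <= normF A * (normF Q * normF z).
      by rewrite (mulrC (normF Q)) mulrA ler_wpM2r ?normF_ge0 // normF_mulmx.
    rewrite (mulrC (normF Q) (normF (A *m z))); lra.
  have : normF N ^+ 2 <= (2 * (normF A * (normF Q * normF z)) + 2 * nI) ^+ 2.
    by rewrite ler_pXn2r ?nnegrE ?normF_ge0 // (le_trans _ NB) // normF_ge0.
  have := ler_wpM2l (sqr_ge0 (normF A)) y2_le.
  set y := normF Q * normF z; set a := normF A.
  have := sqr_ge0 (a * y - nI); nra.
have e2 : e ^+ 2 * normF N ^+ 2 <=
    g ^+ 2 * (8 * (normF A ^+ 2 * (M ^+ 4 * (1 + h))) + 8 * nI ^+ 2).
  by apply: ler_pM; rewrite ?sqr_ge0 //; rewrite ler_pXn2r ?nnegrE.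
have nA : 0 <= nI * normF A by rewrite mulr_ge0 ?normF_ge0.
have et : e * mxdot 1%:M A <= g * (nI * normF A).
  rewrite (@le_trans _ _ (e * (nI * normF A))) //; first by rewrite ler_wpM2l.
  by rewrite ler_wpM2r.
rewrite AN; lra.
Qed.

End one_step_bounds.

Section bounded_partial_sums.
Context {R : realType}.

Definition bounded_sums (a : nat -> R) : Prop :=
  exists C, forall n, \sum_(k < n) a k <= C.

Lemma bounded_sumsD a b : bounded_sums a -> bounded_sums b ->
  bounded_sums (fun n => a n + b n).
Proof.
move=> [C aC] [D bD]; exists (C + D) => n.
by rewrite big_split /=; apply: lerD; [exact: aC|exact: bD].
Qed.

Lemma bounded_sumsZ a c : 0 <= c -> bounded_sums a -> bounded_sums (fun n => c * a n).
Proof. by move=> c0 [C aC]; exists (c * C) => n; rewrite -mulr_sumr ler_wpM2l. Qed.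

Lemma bounded_sums_pw c s : 0 <= c -> s < -1 -> bounded_sums (fun n => c * pw s n).
Proof.
move=> c0 s1; apply: bounded_sumsZ => //; rewrite -(opprK s).
by apply: pw_summable; rewrite ltrNr.
Qed.

Lemma bounded_sums0 : bounded_sums (fun=> 0).
Proof. by exists 0 => n; rewrite big1. Qed.

Lemma bounded_sums_finite (a : nat -> R) N : (forall n, 0 <= a n) ->
  bounded_sums (fun n => if (n < N)%N then a n else 0).
Proof.
move=> a0; exists (\sum_(k < N) a k).
elim=> [|n IH]; first by rewrite big_ord0 sumr_ge0.
have [nN|Nn] := ltnP n N.
  rewrite (@le_trans _ _ (\sum_(k < n.+1) a k)) ?psum_le //.
  by apply: ler_sum => k _; case: ifP.
by rewrite big_ord_recr /= ltnNge Nn addr0.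
Qed.

End bounded_partial_sums.

Section kept.
Context {R : realType} {dT : measure_display} {T : measurableType dT}.

Lemma measurable_le_indicator (f : T -> R) (b : R) : measurable_fun setT f ->
  measurable_fun setT (fun x => ((f x <= b)%R%:R : R)).
Proof.
move=> mf; rewrite (_ : (fun _ => _) = (fun x => if f x <= b then 1 else 0)).
  by apply: measurable_fun_ifT => //; exact: measurable_fun_ler.
by apply/funext => x; case: (f x <= b).
Qed.

Lemma measurable_transition p d (H : 'cV[R]_p -> 'cV[R]_d -> 'M[R]_d)
    (H_meas : measurable_fun setT (fun xh : 'cV[R]_p * 'cV[R]_d => H xh.1 xh.2))
    (x : T -> 'cV[R]_p) (h z : T -> 'cV[R]_d) :
  measurable_fun setT x -> measurable_fun setT h -> measurable_fun setT z ->
  measurable_fun setT (fun w => H (x w) (h w) *m z w).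
Proof.
move=> mx mh mz; apply: measurable_mulmx => //.
apply: (measurableT_comp H_meas (g := fun w => (x w, h w))).
exact: measurable_fun_pair.
Qed.

Lemma measurable_kept d (z Q : T -> 'cV[R]_d) (b g : R) :
  measurable_fun setT z -> measurable_fun setT Q ->
  measurable_fun setT (fun w => g * (norm2 (Q w) * norm2 (z w) <= b)%R%:R).
Proof.
move=> mz mQ; apply: measurable_funM => //; apply: measurable_le_indicator.
by apply: measurable_funM; exact: measurable_norm2.
Qed.

Lemma measurable_hinv_step d (A : T -> 'M[R]_d) (z Q : T -> 'cV[R]_d) (e : T -> R) :
  measurable_fun setT A -> measurable_fun setT z -> measurable_fun setT Q ->
  measurable_fun setT e -> measurable_fun setT (fun w => hinv_step (A w) (z w) (Q w) (e w)).
Proof.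
move=> mA mz mQ me; have mAz := measurable_mulmx mA mz.
apply: measurable_mxD => //; apply: measurable_mxN; apply: measurable_mxZ => //.
apply: measurable_mxD => //; apply: measurable_mxD.
  by apply: measurable_mulmx => //; exact: measurable_trmx.
by apply: measurable_mulmx => //; exact: measurable_trmx.
Qed.

Lemma measurable_transition_mx d (z Q : T -> 'cV[R]_d) (e : T -> R) :
  measurable_fun setT z -> measurable_fun setT Q ->
  measurable_fun setT e -> measurable_fun setT (fun w => transition (z w) (Q w) (e w)).
Proof.
move=> mz mQ me; apply: measurable_mxD => //; apply: measurable_mxN.
apply: measurable_mxZ => //; apply: measurable_mulmx => //; exact: measurable_trmx.
Qed.

End kept.

(** * The filtration of the samples and the one-step form of the convergence theorem *)

Section filtration.
Context {dT : measure_display} {T : measurableType dT} {R : realType}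
  (P : probability T R) {p d : nat}.
Variables (Xs : nat -> {RV P >-> 'cV[R]_p}) (Zs : nat -> {RV P >-> 'cV[R]_d})
  (X : {RV P >-> 'cV[R]_p}).
Hypotheses (Xs_indep : mutually_independent P (fun n => Xs n : T -> 'cV[R]_p))
  (Xs_law : forall n, same_law P (Xs n) X)
  (Zs_indep : mutually_independent P (fun n => Zs n : T -> 'cV[R]_d))
  (XZ_indep : independent_processes P (fun n => Xs n : T -> 'cV[R]_p)
                                      (fun n => Zs n : T -> 'cV[R]_d)).

Let mX n : measurable_fun setT (Xs n). Proof. exact: measurable_funPT. Qed.
Let mZ n : measurable_fun setT (Zs n). Proof. exact: measurable_funPT. Qed.

(** The samples of index below n are those that produce state n; the samples of index n are fresh at
    that time. *)
Definition past n : set (set T) :=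
  generated_by `I_n (fun n => Xs n : T -> 'cV[R]_p) `|`
  generated_by `I_n (fun n => Zs n : T -> 'cV[R]_d).

Lemma past_measurable n : past n `<=` measurable.
Proof. by move=> A [|]; apply: generated_by_measurable. Qed.

Lemma past_nondecreasing n : past n `<=` past n.+1.
Proof.
by move=> A [[k kn Ak]|[k kn Ak]]; [left|right]; exists k => //; exact: ltnW.
Qed.

Lemma Xs_past n : measurable_fun setT (Xs n : g_sigma_algebraType (past n.+1) -> 'cV[R]_p).
Proof. by apply: measurable_generated => A; left; exists n => /=. Qed.

Lemma Zs_past n : measurable_fun setT (Zs n : g_sigma_algebraType (past n.+1) -> 'cV[R]_d).
Proof. by apply: measurable_generated => A; right; exists n => /=. Qed.

Lemma measurable_past_next d' (U : measurableType d') n (S : T -> U) :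
  measurable_fun setT (S : g_sigma_algebraType (past n) -> U) ->
  measurable_fun setT (S : g_sigma_algebraType (past n.+1) -> U).
Proof. by apply: measurable_finer; exact: past_nondecreasing. Qed.

Lemma independent_sub d' (U : measurableType d') (G H : set (set T)) (Y : T -> U) :
  G `<=` H -> independent_of P H Y -> independent_of P G Y.
Proof.
by move=> GH HY A D GA mD; apply: HY => //; apply: sub_smallest2r GA.
Qed.

Lemma Xs_independent n :
  independent_of P (past n `|` preimage_set_system setT (Zs n) measurable) (Xs n).
Proof.
have H := process_independent (n := n) mX mZ Xs_indep XZ_indep.
apply: independent_sub H.
move=> A [[[k kn Ak]|[k kn Ak]]|Ak]; [left|right|right].
- by exists k.
- by exists k.
- by exists n.
Qed.

Lemma Zs_independent n : independent_of P (past n) (Zs n).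
Proof.
have ZX : independent_processes P (fun n => Zs n : T -> 'cV[R]_d)
    (fun n => Xs n : T -> 'cV[R]_p).
  by move=> A B sA sB; rewrite setIC muleC; exact: XZ_indep.
have H := process_independent (n := n) mZ mX Zs_indep ZX.
apply: independent_sub H.
by move=> A [[k kn Ak]|[k kn Ak]]; [right|left]; exists k.
Qed.

Lemma integral_past_step d' (U : measurableType d') n (S : T -> U) (B : set T)
    (f : U * ('cV[R]_p * 'cV[R]_d) -> R) (c : U -> R) :
  measurable_fun setT (S : g_sigma_algebraType (past n) -> U) -> <<s past n >> B ->
  measurable_fun setT f -> (forall s, 0 <= f s) ->
  measurable_fun setT (fun w => c (S w)) ->
  (forall s, (\int[P]_w'' \int[P]_w' (f (s, (X w', Zs n w'')))%:E <= (c s)%:E)%E) ->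
  (\int[P]_(w in B) (f (S w, (Xs n w, Zs n w)))%:E <= \int[P]_(w in B) (c (S w))%:E)%E.
Proof.
apply: integral_step => //.
- exact: past_measurable.
- exact: Xs_independent.
- exact: Zs_independent.
Qed.

(** Reduces each application to inequalities on frozen states: [f n] dominates the next value as a
    function of the state [S n] and of the fresh samples, and [c n] dominates its integral for every
    fixed state. The state may carry more than [W], for instance the point where the Hessian is
    taken. *)
Lemma robbins_siegmund_steps d' (U : measurableType d') (S : nat -> T -> U)
    (f : nat -> U * ('cV[R]_p * 'cV[R]_d) -> R) (c : nat -> U -> R)
    (W D : nat -> T -> R) (a b : nat -> R) :
  (forall n, measurable_fun setT (S n : g_sigma_algebraType (past n) -> U)) ->
  (forall n, measurable_fun setT (f n)) -> (forall n s, 0 <= f n s) ->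
  (forall n, measurable_fun setT (c n)) ->
  adapted past W -> (forall n w, 0 <= W n w) ->
  adapted past D -> (forall n w, 0 <= D n w) ->
  (exists w0, forall w, W 0%N w = w0) ->
  (forall n, 0 <= a n) -> (forall n, 0 <= b n) -> bounded_sums a -> bounded_sums b ->
  (forall n s, (\int[P]_w'' \int[P]_w' (f n (s, (X w', Zs n w'')))%:E <= (c n s)%:E)%E) ->
  (forall n w, W n.+1 w + D n w <= f n (S n w, (Xs n w, Zs n w))) ->
  (forall n w, c n (S n w) <= (1 + a n) * W n w + b n) ->
  {ae P, forall w, [/\ exists C, forall n, W n w <= C,
    exists C, forall n, \sum_(k < n) D k w <= C &
    (forall e N, 0 < e -> exists2 n, (N <= n)%N & W n w < e) ->
      W ^~ w @ \oo --> 0]}.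
Proof.
move=> mS mf f0 mc aW W0 aD D0 [w0 W0E] a0 b0 sa sb fc Wf cW.
have mSn n : measurable_fun setT (S n).
  by apply: measurable_coarse (mS n); exact: past_measurable.
have mW n : measurable_fun setT (W n).
  by apply: (adapted_measurable _ aW); exact: past_measurable.
have mD n : measurable_fun setT (D n).
  by apply: (adapted_measurable _ aD); exact: past_measurable.
have step n B : <<s past n >> B ->
    (\int[P]_(w in B) (W n.+1 w + D n w)%:E <=
     (1 + a n)%:E * \int[P]_(w in B) (W n w)%:E + (b n)%:E * P B)%E.
  move=> GB; have mB : measurable B.
    by apply: (g_sigma_algebra_measurable (@past_measurable n)).
  have mcS : measurable_fun setT (fun w => c n (S n w)) by exact: measurableT_comp.
  have mfX : measurable_fun setT (fun w => f n (S n w, (Xs n w, Zs n w))).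
    apply: (measurableT_comp (mf n)); apply: measurable_fun_pair => //.
    exact: measurable_fun_pair.
  have H := integral_past_step (mS n) GB (mf n) (f0 n) mcS (fc n).
  have c0 w : 0 <= c n (S n w).
    rewrite -lee_fin (le_trans _ (fc n _)) //; apply: integral_ge0 => w'' _.
    by apply: integral_ge0 => w' _; rewrite lee_fin.
  apply: (@le_trans _ _ (\int[P]_(w in B) (c n (S n w))%:E)%E).
    apply: le_trans H; apply: ge0_le_integral => //.
    - by move=> w _; rewrite lee_fin addr_ge0.
    - by apply: measurable_funTS; apply/measurable_EFinP; exact: measurable_funD.
    - by apply: measurable_funTS; exact/measurable_EFinP.
    - by move=> w _; rewrite lee_fin.
  apply: (@le_trans _ _ (\int[P]_(w in B) ((1 + a n)%:E * (W n w)%:E + (b n)%:E))%E).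
    apply: ge0_le_integral => //.
    - by move=> w _; rewrite lee_fin.
    - by apply: measurable_funTS; exact/measurable_EFinP.
    - apply: emeasurable_funD => //; apply: measurable_funeM.
      by apply: measurable_funTS; exact/measurable_EFinP.
    - by move=> w _; rewrite -EFinM -EFinD lee_fin.
  have mWB : measurable_fun B (fun w => (W n w)%:E).
    by apply: measurable_funTS; exact/measurable_EFinP.
  have a1 : (0 <= (1 + a n)%:E :> \bar R)%E by rewrite lee_fin addr_ge0.
  rewrite ge0_integralD //; last 3 first.
  - by move=> w _; rewrite mule_ge0 // lee_fin.
  - exact: measurable_funeM.
  - by move=> w _; rewrite lee_fin.
  rewrite ge0_integralZl // ?integral_cst //.
  by move=> w _; rewrite lee_fin.
have iW0 : (\int[P]_w (W 0%N w)%:E < +oo)%E.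
  rewrite (eq_integral (fun=> w0%:E)); last by move=> w _; rewrite W0E.
  by have [_] := has_expectation_cst P w0; rewrite unlock => ->; exact: ltry.
exact: (robbins_siegmund past_measurable past_nondecreasing W0 D0 aW aD a0 b0 sa sb iW0 step).
Qed.

Lemma bounded_by_steps d' (U : measurableType d') (S : nat -> T -> U)
    (f : nat -> U * ('cV[R]_p * 'cV[R]_d) -> R) (c : nat -> U -> R)
    (W : nat -> T -> R) (a b : nat -> R) :
  (forall n, measurable_fun setT (S n : g_sigma_algebraType (past n) -> U)) ->
  (forall n, measurable_fun setT (f n)) -> (forall n s, 0 <= f n s) ->
  (forall n, measurable_fun setT (c n)) ->
  adapted past W -> (forall n w, 0 <= W n w) ->
  (exists w0, forall w, W 0%N w = w0) ->
  (forall n, 0 <= a n) -> (forall n, 0 <= b n) -> bounded_sums a -> bounded_sums b ->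
  (forall n s, (\int[P]_w'' \int[P]_w' (f n (s, (X w', Zs n w'')))%:E <= (c n s)%:E)%E) ->
  (forall n w, W n.+1 w <= f n (S n w, (Xs n w, Zs n w))) ->
  (forall n w, c n (S n w) <= (1 + a n) * W n w + b n) ->
  {ae P, forall w, exists C, forall n, W n w <= C}.
Proof.
move=> mS mf f0 mc aW W0 W0E a0 b0 sa sb fc Wf cW.
have aZ : adapted past (fun=> fun=> 0 : R) by move=> n; exact: measurable_cst.
have Wf' n w : W n.+1 w + 0 <= f n (S n w, (Xs n w, Zs n w)) by rewrite addr0.
have RS := robbins_siegmund_steps mS mf f0 mc aW W0 aZ (fun _ _ => lexx 0)
  W0E a0 b0 sa sb fc Wf' cW.
by apply: filterS RS => w [].
Qed.

End filtration.

(** * Almost sure bounds on the inverse Hessian estimates *)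

Section inverse_hessian_process.
Context {dT : measure_display} {T : measurableType dT} {R : realType}
  (P : probability T R) {p d : nat}.
Variables (Xs : nat -> {RV P >-> 'cV[R]_p}) (Zs : nat -> {RV P >-> 'cV[R]_d})
  (X : {RV P >-> 'cV[R]_p}).
Hypotheses (Xs_indep : mutually_independent P (fun n => Xs n : T -> 'cV[R]_p))
  (Xs_law : forall n, same_law P (Xs n) X)
  (Zs_indep : mutually_independent P (fun n => Zs n : T -> 'cV[R]_d))
  (XZ_indep : independent_processes P (fun n => Xs n : T -> 'cV[R]_p)
                                      (fun n => Zs n : T -> 'cV[R]_d)).
Variables (M q C : R) (D2g : 'cV[R]_p -> 'cV[R]_d -> 'M[R]_d) (K : 'cV[R]_d -> 'M[R]_d).
Hypotheses (M_ge0 : 0 <= M) (q_gt2 : 2 < q) (C_ge0 : 0 <= C).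
Hypothesis Zs_bounded : forall n, {ae P, forall w, norm2 (Zs n w) <= M}.
Hypothesis Zs_cov : forall n,
  has_expectation_mx P (fun w => Zs n w *m (Zs n w)^T) 1%:M.
Hypothesis D2g_meas : measurable_fun setT
  (fun xh : 'cV[R]_p * 'cV[R]_d => D2g xh.1 xh.2).
Hypothesis D2g_mean : forall h, has_expectation_mx P (fun w => D2g (X w) h) (K h).
Hypothesis K_psd : forall h x, 0 <= quad (K h) x.
Hypothesis D2g_moment : forall h,
  ('E_P[fun w => (normF (D2g (X w) h) `^ q)%R] <= C%:E)%E.
Variables (cg gamma cb beta cb' beta' : R).
Hypotheses (cg_gt0 : 0 < cg) (cb_gt0 : 0 < cb) (cb'_gt0 : 0 < cb')
  (gamma_bnd : 2^-1 < gamma < 1) (beta_gt0 : 0 < beta) (beta_lt1 : beta < 1)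
  (beta_lower : 1 - gamma < beta * (q - 1)).
Let g n := cg * pw (- gamma) n.
Let b n := cb * pw beta n.
Let b' n := cb' * pw beta' n.
Hypothesis gb_le : forall n, g n * b n <= 2^-1.
Hypothesis gb'_le : forall n, g n ^+ 2 * b n ^+ 2 * b' n <= g n.
Variables (h : nat -> T -> 'cV[R]_d) (A : nat -> T -> 'M[R]_d) (A0 : 'M[R]_d).
Let past := past Xs Zs.
Let Q n w := D2g (Xs n w) (h n w) *m Zs n w.
Let e n w := g n * (norm2 (Q n w) * norm2 (Zs n w) <= b n)%R%:R.
Hypothesis h_adapted : forall n,
  measurable_fun setT (h n : g_sigma_algebraType (past n) -> 'cV[R]_d).
Hypothesis A_adapted : forall n,
  measurable_fun setT (A n : g_sigma_algebraType (past n) -> 'M[R]_d).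
Hypothesis A0_sym : A0^T = A0.
Hypothesis A_0 : forall w, A 0 w = A0.
Hypothesis A_S : forall n w, A n.+1 w =
  projF (b' n) (hinv_step (A n w) (Zs n w) (Q n w) (e n w)).

Let g_gt0 n : 0 < g n. Proof. by rewrite mulr_gt0 ?pw_gt0. Qed.
Let b_gt0 n : 0 < b n. Proof. by rewrite mulr_gt0 ?pw_gt0. Qed.
Let b'_ge0 n : 0 <= b' n. Proof. by rewrite mulr_ge0 ?pw_ge0 // ltW. Qed.
Let gamma_gt : 2^-1 < gamma. Proof. by case/andP: gamma_bnd. Qed.
Let gamma_lt : gamma < 1. Proof. by case/andP: gamma_bnd. Qed.
Let kap := (M ^+ 2) `^ q.
Let kap_ge0 : 0 <= kap. Proof. exact: powR_ge0. Qed.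

Let b_pow n s : b n `^ s = cb `^ s * pw (beta * s) n.
Proof. by rewrite /b /pw powRM ?powR_ge0 ?(ltW cb_gt0) // powRrM. Qed.

Let sum_g2 c : 0 <= c -> bounded_sums (fun n => c * g n ^+ 2).
Proof.
move=> c0; under eq_fun do rewrite /g exprMn -pwX mulrA.
by apply: bounded_sums_pw; [rewrite mulr_ge0 ?sqr_ge0|have := gamma_gt; lra].
Qed.

Let sum_gb c : 0 <= c -> bounded_sums (fun n => c * (g n * b n `^ (1 - q))).
Proof.
move=> c0; under eq_fun do rewrite b_pow /g mulrACA -pwD mulrA.
by apply: bounded_sums_pw; [rewrite !mulr_ge0 ?powR_ge0 // ltW|have := beta_lower; lra].
Qed.

(** Since b is bounded below, the rejection probability is dominated by the same summable sequence
    as the rejected moment. *)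
Let bq_le : exists2 k, 0 <= k & forall n, b n `^ (- q) <= k * b n `^ (1 - q).
Proof.
exists (cb^-1); first by rewrite invr_ge0 ltW.
move=> n; have -> : b n `^ (- q) = b n `^ (1 - q) * b n `^ (-1).
  by rewrite -powRD ?(gt_eqF (b_gt0 n)) ?implybT //; congr (_ `^ _); ring.
rewrite mulrC ler_wpM2r ?powR_ge0 //.
rewrite powR_inv1 ?(ltW (b_gt0 n)) // lef_pV2 ?posrE // /b ler_peMr ?(ltW cb_gt0) //.
by rewrite -(pw0 n) le_pw // ltW.
Qed.

Let e_past n : measurable_fun setT (e n : g_sigma_algebraType (past n.+1) -> R).
Proof.
apply: measurable_kept; first exact: Zs_past.
apply: (measurable_transition D2g_meas); first exact: Xs_past.
  by apply: measurable_past_next; exact: h_adapted.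
exact: Zs_past.
Qed.

Let Q_past n : measurable_fun setT (Q n : g_sigma_algebraType (past n.+1) -> 'cV[R]_d).
Proof.
apply: (measurable_transition D2g_meas); first exact: Xs_past.
  by apply: measurable_past_next; exact: h_adapted.
exact: Zs_past.
Qed.

Fixpoint transitions n w : 'M[R]_d :=
  if n is m.+1 then transition (Zs m w) (Q m w) (e m w) *m transitions m w else 1%:M.

Let transitions_adapted n : measurable_fun setT
  (transitions n : g_sigma_algebraType (past n) -> 'M[R]_d).
Proof.
elim: n => [|n IH]; first exact: measurable_cst.
apply: measurable_mulmx; last by apply: measurable_past_next.
by apply: measurable_transition_mx; [exact: Zs_past|exact: Q_past|exact: e_past].
Qed.

Let mQ (D : 'cV[R]_d * 'M[R]_d -> 'cV[R]_d) : measurable_fun setT D ->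
  measurable_fun setT (fun s : ('cV[R]_d * 'M[R]_d) * ('cV[R]_p * 'cV[R]_d) =>
    D2g s.2.1 (D s.1) *m s.2.2).
Proof.
move=> mD; apply: (measurable_transition D2g_meas) => //.
- by apply: measurableT_comp.
- by apply: measurableT_comp.
- by apply: measurableT_comp.
Qed.

Let mz : measurable_fun setT
  (fun s : ('cV[R]_d * 'M[R]_d) * ('cV[R]_p * 'cV[R]_d) => s.2.2).
Proof. by apply: measurableT_comp. Qed.

Let mS : measurable_fun setT
  (fun s : ('cV[R]_d * 'M[R]_d) * ('cV[R]_p * 'cV[R]_d) => s.1.2).
Proof. by apply: measurableT_comp. Qed.

Let bound n (v : 'cV[R]_d) (S : 'M[R]_d) (f : 'cV[R]_p * 'cV[R]_d -> R) g' c k :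
  measurable_fun setT f -> (forall xz, 0 <= f xz) -> 0 <= g' -> 0 <= k ->
  (forall x z, normF z <= M -> f (x, z) <= c - g' * mxdot (S *m S^T *m z) (D2g x v *m z)
     + k * normF (D2g x v) `^ q) ->
  (\int[P]_w'' \int[P]_w' (f (X w', Zs n w''))%:E <= (c + k * C)%:E)%E.
Proof.
move=> mf f0 g'0 k0 fle.
apply: (frozen_bound (H := D2g^~ v) (K := K v) (S := S) (g := g') (M := M) (q := q)) => //.
- exact: (measurableT_comp D2g_meas (g := fun x => (x, v)) (measurable_fun_pair _ _)).
Qed.

Lemma transitions_bounded :
  {ae P, forall w, exists C', forall n, normF (transitions n w) ^+ 2 <= C'}.
Proof.
pose f n (s : ('cV[R]_d * 'M[R]_d) * ('cV[R]_p * 'cV[R]_d)) :=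
  normF (transition s.2.2 (D2g s.2.1 s.1.1 *m s.2.2)
    (g n * (norm2 (D2g s.2.1 s.1.1 *m s.2.2) * norm2 s.2.2 <= b n)%R%:R) *m s.1.2) ^+ 2.
pose a n := M ^+ 4 * (1 + C) * g n ^+ 2 + 2 * kap * C * (g n * b n `^ (1 - q)).
pose c n (s : 'cV[R]_d * 'M[R]_d) := normF s.2 ^+ 2 * (1 + a n).
have M4 : 0 <= M ^+ 4 by exact: exprn_ge0.
apply: (bounded_by_steps (X := X) Xs_indep Xs_law Zs_indep XZ_indep
    (S := fun n w => (h n w, transitions n w)) (f := f) (c := c)
    (W := fun n w => normF (transitions n w) ^+ 2) (a := a) (b := fun=> 0)) => //.
- by move=> n; apply: measurable_fun_pair => //; exact: transitions_adapted.
- move=> n; apply: measurable_funX; apply: measurable_normF; apply: measurable_mulmx => //.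
  have mQn := mQ measurable_fst.
  apply: measurable_transition_mx => //; exact: measurable_kept.
- by move=> n s; exact: sqr_ge0.
- move=> n; apply: measurable_funM => //; apply: measurable_funX; apply: measurable_normF.
  exact: measurable_snd.
- by move=> n; apply: measurable_funX; apply: measurable_normF; exact: transitions_adapted.
- by move=> n w; exact: sqr_ge0.
- by exists (normF (1%:M : 'M[R]_d) ^+ 2).
- move=> n; rewrite addr_ge0 // !mulr_ge0 ?addr_ge0 ?sqr_ge0 ?powR_ge0 //; exact: ltW.
- apply: bounded_sumsD; first by apply: sum_g2; rewrite mulr_ge0 ?addr_ge0.
  by apply: sum_gb; rewrite !mulr_ge0.
- exact: bounded_sums0.
- move=> n [v S]; rewrite /c /=.
  have gn0 := ltW (g_gt0 n).
  have -> : normF S ^+ 2 * (1 + a n) = normF S ^+ 2 * (1 + g n ^+ 2 * M ^+ 4) +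
      normF S ^+ 2 * (2 * g n * kap * b n `^ (1 - q) + g n ^+ 2 * M ^+ 4) * C.
    by rewrite /a; ring.
  apply: (bound n (v := v) (S := S) (f := fun xz => f n ((v, S), xz)) (g' := 2 * g n)).
  + have mQn : measurable_fun setT (fun s : 'cV[R]_p * 'cV[R]_d => D2g s.1 v *m s.2).
      exact: (measurable_transition D2g_meas).
    rewrite /f /=; apply: measurable_funX; apply: measurable_normF.
    apply: measurable_mulmx => //; apply: measurable_transition_mx => //; exact: measurable_kept.
  + by move=> xz; exact: sqr_ge0.
  + by rewrite mulr_ge0.
  + rewrite mulr_ge0 ?sqr_ge0 // addr_ge0 //; last by rewrite mulr_ge0 ?sqr_ge0.
    by apply: mulr_ge0; [apply: mulr_ge0 => //; apply: mulr_ge0|exact: powR_ge0].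
  + by move=> x z zM; exact: transition_sqnorm_le.
- by move=> n w; rewrite addr0 mulrC.
Qed.

Lemma rejections_summable : {ae P, forall w, exists C', forall n,
  \sum_(k < n) (g k - e k w) <= C'}.
Proof.
have [kb kb0 kbP] := bq_le.
pose ind n (v : 'cV[R]_d) (xz : 'cV[R]_p * 'cV[R]_d) : R :=
  g n * (norm2 (D2g xz.1 v *m xz.2) * norm2 xz.2 <= b n)%R%:R.
(* The absolute value makes [f] nonnegative on every frozen state; along the process the sum is
   nonnegative and nothing changes. *)
pose f n (s : ('cV[R]_d * R) * ('cV[R]_p * 'cV[R]_d)) :=
  `|s.1.2| + (g n - g n * (norm2 (D2g s.2.1 s.1.1 *m s.2.2) * norm2 s.2.2 <= b n)%R%:R).
pose c n (s : 'cV[R]_d * R) := `|s.2| + g n * (kap * b n `^ (- q)) * C.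
have ind_le n v xz : 0 <= g n - ind n v xz.
  rewrite /ind subr_ge0; case: (_ <= b n); rewrite ?mulr1 ?mulr0 //.
  exact: ltW.
have W0 n w : 0 <= \sum_(k < n) (g k - e k w).
  by apply: sumr_ge0 => k _; exact: (ind_le k (h k w) (Xs k w, Zs k w)).
apply: (bounded_by_steps (X := X) Xs_indep Xs_law Zs_indep XZ_indep
    (S := fun n w => (h n w, \sum_(k < n) (g k - e k w))) (f := f) (c := c)
    (W := fun n w => \sum_(k < n) (g k - e k w)) (a := fun=> 0)
    (b := fun n => kap * C * kb * (g n * b n `^ (1 - q)))) => //.
- move=> n; apply: measurable_fun_pair => //; apply: measurable_sum => k.
  apply: measurable_funB => //.
  have : forall m, (k < m)%N -> measurable_fun setT (e k : g_sigma_algebraType (past m) -> R).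
    elim=> // m IH; rewrite ltnS leq_eqVlt => /orP[/eqP <-|/IH]; first exact: e_past.
    exact: measurable_past_next.
  by apply; exact: ltn_ord.
- move=> n; apply: measurable_funD.
    by apply: measurableT_comp => //; apply: measurableT_comp.
  apply: measurable_funB => //; apply: measurable_kept.
    by apply: measurableT_comp.
  apply: (measurable_transition D2g_meas) => //.
  + by apply: measurableT_comp.
  + by apply: measurableT_comp.
  + by apply: measurableT_comp.
- by move=> n s; rewrite addr_ge0 //; exact: (ind_le n s.1.1 s.2).
- move=> n; apply: measurable_funD => //; apply: measurableT_comp => //.
- move=> n; apply: measurable_sum => k; apply: measurable_funB => //.
  have : forall m, (k < m)%N -> measurable_fun setT (e k : g_sigma_algebraType (past m) -> R).
    elim=> // m IH; rewrite ltnS leq_eqVlt => /orP[/eqP <-|/IH]; first exact: e_past.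
    exact: measurable_past_next.
  by apply; exact: ltn_ord.
- by exists 0 => w; rewrite big_ord0.
- by move=> n; rewrite !mulr_ge0 ?powR_ge0 // ltW.
- exact: bounded_sums0.
- by apply: sum_gb; rewrite !mulr_ge0.
- move=> n [v u]; rewrite /c /=; have gn0 := ltW (g_gt0 n).
  apply: (bound n (v := v) (S := 0) (f := fun xz => f n ((v, u), xz)) (g' := 0)) => //.
  + have mQn : measurable_fun setT (fun s : 'cV[R]_p * 'cV[R]_d => D2g s.1 v *m s.2).
      exact: (measurable_transition D2g_meas).
    by rewrite /f /=; apply: measurable_funD => //; apply: measurable_funB => //; exact: measurable_kept.
  + by move=> xz; rewrite addr_ge0 //; exact: (ind_le n v xz).
  + by apply: mulr_ge0 => //; apply: mulr_ge0 => //; exact: powR_ge0.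
  + move=> x z zM; rewrite /f /= mul0r subr0 lerD2l -{1}(mulr1 (g n)) -mulrBr.
    rewrite -[leRHS]mulrA; apply: ler_wpM2l => //; exact: rejected_le.
- move=> n w; rewrite big_ord_recr /= /f /= (ger0_norm (W0 n w)); exact: lexx.
- move=> n w; rewrite addr0 mul1r /c /= (ger0_norm (W0 n w)) lerD2l.
  have := ler_wpM2l (mulr_ge0 (mulr_ge0 (ltW (g_gt0 n)) kap_ge0) C_ge0) (kbP n); lra.
Qed.

(** With y = (n+1)^(-kappa) |A_n|, the linear term is, up to a constant, of order g (n+1)^(-kappa)
    y, and y <= 1 + y^2 splits it between [a] and [b]. Summability of (n+1)^(-gamma-kappa) is the
    requirement kappa > 1 - gamma. *)
Lemma hinv_bounded kappa : 1 - gamma < kappa -> {ae P, forall w, exists C', forall n,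
  pw (- (2 * kappa)) n * normF (A n w) ^+ 2 <= C'}.
Proof.
move=> kg.
(* The one-step bound needs a symmetric matrix, whereas the frozen state
   ranges over all matrices. *)
pose sy (S : 'M[R]_d) := 2^-1 *: (S + S^T).
have sySym S : (sy S)^T = sy S by rewrite /sy linearZ linearD /= trmxK addrC.
have sy_id S : S^T = S -> sy S = S.
  by move=> sS; rewrite /sy sS -mulr2n -[S *+ 2]scaler_nat scalerA mulVf ?scale1r // pnatr_eq0.
have A_sym n w : (A n w)^T = A n w.
  elim: n => [|n IH]; first by rewrite A_0.
  rewrite A_S; have [s _ [-> _]] := projF_scale (hinv_step (A n w) (Zs n w) (Q n w) (e n w)) (b'_ge0 n).
  by rewrite linearZ /= hinv_step_sym.
pose r n := pw (- (2 * kappa)) n.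
have r0 n : 0 <= r n by exact: pw_ge0.
have r1 n : r n <= 1 by rewrite -(pw0 n) le_pw //; have := gamma_lt; lra.
pose f n (s : ('cV[R]_d * 'M[R]_d) * ('cV[R]_p * 'cV[R]_d)) :=
  r n * normF (hinv_step (sy s.1.2) s.2.2 (D2g s.2.1 s.1.1 *m s.2.2)
    (g n * (norm2 (D2g s.2.1 s.1.1 *m s.2.2) * norm2 s.2.2 <= b n)%R%:R)) ^+ 2.
set nI := normF (1%:M : 'M[R]_d); have nI0 : 0 <= nI by exact: normF_ge0.
pose a1 n := 8 * M ^+ 4 * (1 + C) * g n ^+ 2 + 4 * kap * C * (g n * b n `^ (1 - q)).
pose a2 n := 4 * nI * cg * pw (- gamma - kappa) n.
pose c n (s : 'cV[R]_d * 'M[R]_d) := r n * (normF (sy s.2) ^+ 2 * (1 + a1 n) +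
  4 * g n * nI * normF (sy s.2) + 8 * g n ^+ 2 * nI ^+ 2).
have M4 : 0 <= M ^+ 4 by exact: exprn_ge0.
have a1_ge0 n : 0 <= a1 n.
  by rewrite addr_ge0 // !mulr_ge0 ?addr_ge0 ?sqr_ge0 ?powR_ge0 //; exact: ltW.
have a2_ge0 n : 0 <= a2 n by rewrite !mulr_ge0 ?pw_ge0 // ltW.
have msy d0 (U : measurableType d0) (u : U -> 'M[R]_d) :
    measurable_fun setT u -> measurable_fun setT (fun x => sy (u x)).
  move=> mu; apply: measurable_mxZ => //; apply: measurable_mxD => //.
  exact: measurable_trmx.
apply: (bounded_by_steps (X := X) Xs_indep Xs_law Zs_indep XZ_indep
    (S := fun n w => (h n w, A n w)) (f := f) (c := c)
    (W := fun n w => r n * normF (A n w) ^+ 2) (a := fun n => a1 n + a2 n)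
    (b := fun n => a2 n + 8 * nI ^+ 2 * g n ^+ 2)) => //.
- by move=> n; apply: measurable_fun_pair.
- move=> n; apply: measurable_funM => //; apply: measurable_funX; apply: measurable_normF.
  have mQn := mQ measurable_fst.
  apply: measurable_hinv_step => //; last exact: measurable_kept.
  exact: msy.
- by move=> n s; rewrite mulr_ge0 ?sqr_ge0.
- move=> n; apply: measurable_funM => //.
  have mn : measurable_fun setT (fun s : 'cV[R]_d * 'M[R]_d => normF (sy s.2)).
    by apply: measurable_normF; apply: msy.
  apply: measurable_funD => //; apply: measurable_funD; apply: measurable_funM => //.
  exact: measurable_funX.
- by move=> n; apply: measurable_funM => //; apply: measurable_funX; apply: measurable_normF.
- by move=> n w; rewrite mulr_ge0 ?sqr_ge0.
- by exists (r 0%N * normF A0 ^+ 2) => w; rewrite A_0.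
- by move=> n; rewrite addr_ge0.
- move=> n; rewrite addr_ge0 // mulr_ge0 ?sqr_ge0 // mulr_ge0 ?sqr_ge0 //.
- apply: bounded_sumsD; last first.
    by apply: bounded_sums_pw; [rewrite !mulr_ge0 // ltW|lra].
  apply: bounded_sumsD; first by apply: sum_g2; rewrite !mulr_ge0 ?addr_ge0.
  by apply: sum_gb; rewrite !mulr_ge0.
- apply: bounded_sumsD; first by apply: bounded_sums_pw; [rewrite !mulr_ge0 // ltW|lra].
  by apply: sum_g2; rewrite mulr_ge0 ?sqr_ge0.
- move=> n [v S]; rewrite /c /=; have gn0 := ltW (g_gt0 n).
  have -> : r n * (normF (sy S) ^+ 2 * (1 + a1 n) + 4 * g n * nI * normF (sy S) +
      8 * g n ^+ 2 * nI ^+ 2) =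
    r n * (normF (sy S) ^+ 2 * (1 + 8 * g n ^+ 2 * M ^+ 4) + 4 * g n * nI * normF (sy S) +
      8 * g n ^+ 2 * nI ^+ 2) +
    r n * (normF (sy S) ^+ 2 * (4 * g n * kap * b n `^ (1 - q) + 8 * g n ^+ 2 * M ^+ 4)) * C.
    by rewrite /a1; ring.
  apply: (bound n (v := v) (S := sy S) (f := fun xz => f n ((v, S), xz)) (g' := r n * (4 * g n))).
  + have mQn : measurable_fun setT (fun s : 'cV[R]_p * 'cV[R]_d => D2g s.1 v *m s.2).
      exact: (measurable_transition D2g_meas).
    rewrite /f /=; apply: measurable_funM => //; apply: measurable_funX.
    apply: measurable_normF; apply: measurable_hinv_step => //; exact: measurable_kept.
  + by move=> xz; rewrite mulr_ge0 ?sqr_ge0.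
  + by apply: mulr_ge0 => //; apply: mulr_ge0.
  + apply: mulr_ge0 => //; apply: mulr_ge0; first exact: sqr_ge0.
    apply: addr_ge0; last by apply: mulr_ge0 => //; apply: mulr_ge0 => //; exact: sqr_ge0.
    by apply: mulr_ge0; [apply: mulr_ge0 => //; apply: mulr_ge0|exact: powR_ge0].
  + move=> x z zM; have := ler_wpM2l (r0 n)
      (hinv_step_sqnorm_le (D2g x v) M_ge0 zM q_gt2 (b_gt0 n) gn0 (sySym S)).
    move=> /le_trans; apply; rewrite le_eqVlt; apply/orP; left; apply/eqP.
    by rewrite -/nI -/kap; ring.
- move=> n w; rewrite /f /= A_S sy_id //.
  apply: ler_pM; rewrite ?r0 ?sqr_ge0 //.
    by rewrite /r pwN_homo //; have := gamma_lt; lra.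
  by rewrite ler_pXn2r ?nnegrE ?normF_ge0 // normF_projF_le.
- move=> n w; rewrite /c /= sy_id //.
  set x := normF (A n w); have x0 : 0 <= x by exact: normF_ge0.
  have kr : pw (- kappa) n ^+ 2 = r n by rewrite -pwX mulrN.
  have k0 : 0 <= pw (- kappa) n by exact: pw_ge0.
  have h1 : r n * (4 * g n * nI * x) <= a2 n * (1 + r n * x ^+ 2).
    have -> : a2 n * (1 + r n * x ^+ 2) =
        4 * nI * g n * (pw (- kappa) n * (1 + (pw (- kappa) n * x) ^+ 2)).
      by rewrite /a2 /g exprMn kr pwD; ring.
    have -> : r n * (4 * g n * nI * x) =
        4 * nI * g n * (pw (- kappa) n * (pw (- kappa) n * x)).
      by rewrite -kr; ring.
    apply: ler_wpM2l; first by apply: mulr_ge0; [exact: mulr_ge0|exact: ltW].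
    apply: ler_wpM2l => //.
    by set y := _ * x; nra.
  have h2 : r n * (8 * g n ^+ 2 * nI ^+ 2) <= 8 * nI ^+ 2 * g n ^+ 2.
    rewrite (@le_trans _ _ (1 * (8 * g n ^+ 2 * nI ^+ 2))) //; last by lra.
    apply: ler_wpM2r => //; apply: mulr_ge0; last exact: sqr_ge0.
    by apply: mulr_ge0 => //; exact: sqr_ge0.
  rewrite (_ : r n * _ = r n * (x ^+ 2 * (1 + a1 n)) + r n * (4 * g n * nI * x) +
    r n * (8 * g n ^+ 2 * nI ^+ 2)); last by ring.
  rewrite (_ : (1 + _) * _ + _ = r n * (x ^+ 2 * (1 + a1 n)) +
    a2 n * (1 + r n * x ^+ 2) + 8 * nI ^+ 2 * g n ^+ 2); last by ring.
  by rewrite lerD // lerD2l.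
Qed.

(** Three almost sure events are intersected and the rest is deterministic. [Abar] is quantified
    after w, so the exceptional set is independent of how the averages are initialised. *)
Lemma hinv_process_bounds kappa t : 1 - gamma < kappa -> kappa < beta' -> kappa <= 1 ->
  0 <= t -> {ae P, forall w,
  (exists2 C', 0 < C' & forall n, normF (A n w) <= C' * pw kappa n) /\
  (forall Abar : nat -> 'M[R]_d, (forall n, Abar n.+1 =
    (1 - log_weight t n.+1) *: Abar n + log_weight t n.+1 *: A n.+1 w) ->
   exists N k, [/\ 0 < k & forall n, (N <= n)%N -> forall x,
    k * pw (- beta) n * normF x ^+ 2 <= quad (Abar n) x])}.
Proof.
move=> kg kb k1 t0.
apply: filterS3 transitions_bounded rejections_summable (hinv_bounded kg) => w.
move=> [C1 C1P] [C2 C2P] [C3 C3P].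
have AC n : normF (A n w) <= (1 + C3) * pw kappa n.
  have C30 : 0 <= C3 by rewrite (le_trans _ (C3P 0%N)) // mulr_ge0 ?pw_ge0 ?sqr_ge0.
  rewrite -(@ler_pXn2r _ 2) ?nnegrE ?mulr_ge0 ?normF_ge0 ?pw_ge0 ?addr_ge0 //.
  rewrite exprMn -pwX; have := C3P n; rewrite pwN mulrC ler_pdivrMr ?pw_gt0 //.
  move=> /le_trans; apply; rewrite ler_wpM2r ?pw_ge0 //.
  have := sqr_ge0 C3; lra.
pose C' := 1 + `|C1| + `|C3|.
have C'0 : 0 < C' by have := normr_ge0 C1; have := normr_ge0 C3; rewrite /C'; lra.
have AC' n : normF (A n w) <= C' * pw kappa n.
  rewrite (le_trans (AC n)) // ler_wpM2r ?pw_ge0 //.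
  by have := normr_ge0 C1; have := ler_norm C3; rewrite /C'; lra.
split; first by exists C'.
move=> Abar AbarS.
have e0 n : 0 <= e n w by rewrite mulr_ge0 ?ler0n // ltW.
have e_cases n : e n w = 0 \/ e n w = g n.
  by rewrite /e; case: (_ <= _); [right; rewrite mulr1|left; rewrite mulr0].
apply: (@hinv_avg_lower _ _ (A^~ w) (transitions^~ w) (Zs^~ w) (Q^~ w) (e^~ w)
  cb cb' beta beta' kappa C' _ _ _ _ _ _ _ _ _ _ _ _ _ _ _ _ _ _ Abar t) => //.
- exact: ltW.
- by have := gamma_lt; lra.
- by have := gamma_lt; lra.
- move=> n; rewrite /e; case: (leP _ (b n)); last by rewrite mulr0 eqxx.
  by rewrite !norm2E.
- by move=> n; have [->|->] := e_cases n; [rewrite mul0r invr_ge0|exact: gb_le].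
- by move=> n; have [->|->] := e_cases n; [rewrite expr0n /= !mul0r|exact: gb'_le].
- by rewrite A_0.
- move=> n; rewrite (le_trans (C1P n)) //.
  by have := ler_norm C1; have := normr_ge0 C3; rewrite /C'; lra.
(* The sum of the gamma_k diverges since gamma < 1, and rejections remove at most [C2] from it. *)
move=> m; have [n nP] := @pw_divergent R gamma ((m + C2) / cg) (ltW (andP gamma_bnd).2).
exists n; have := C2P n; rewrite sumrB => h1.
have h2 : m + C2 <= \sum_(k < n) g k.
  by rewrite -mulr_sumr -ler_pdivrMl // mulrC.
lra.
Qed.

End inverse_hessian_process.

(** * Convergence of the Newton iterates *)

Section newton_process.
Context {dT : measure_display} {T : measurableType dT} {R : realType}
  (P : probability T R) {p d : nat}.
Variables (Xs : nat -> {RV P >-> 'cV[R]_p}) (Zs : nat -> {RV P >-> 'cV[R]_d})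
  (X : {RV P >-> 'cV[R]_p}).
Hypotheses (Xs_indep : mutually_independent P (fun n => Xs n : T -> 'cV[R]_p))
  (Xs_law : forall n, same_law P (Xs n) X)
  (Zs_indep : mutually_independent P (fun n => Zs n : T -> 'cV[R]_d))
  (XZ_indep : independent_processes P (fun n => Xs n : T -> 'cV[R]_p)
                                      (fun n => Zs n : T -> 'cV[R]_d)).
Variables (G : 'cV[R]_d -> R) (theta : 'cV[R]_d) (Dg : 'cV[R]_p -> 'cV[R]_d -> 'cV[R]_d).
Hypothesis Dg_meas : measurable_fun setT
  (fun xh : 'cV[R]_p * 'cV[R]_d => Dg xh.1 xh.2).
Hypothesis Dg_mean : forall h, has_expectation_mx P (fun w => Dg (X w) h) (gradient G h).
Variables (C L : R).
Hypotheses (C_gt0 : 0 < C) (L_gt0 : 0 < L).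
Hypothesis Dg_growth : forall h,
  ('E_P[fun w => (norm2 (Dg (X w) h) ^+ 2)%R] <= (C * (1 + G h - G theta))%:E)%E.
Hypothesis G_diff2 : forall h, twice_differentiable G h.
Hypothesis G_convex : convex_fun G.
Hypothesis hessian_le : forall h, normop (hessian G h) <= L.
Hypothesis theta_zero : gradient G theta = 0.
Hypothesis theta_unique : forall h, gradient G h = 0 -> h = theta.
Variables (cn nu beta kappa : R).
Hypotheses (cn_gt0 : 0 < cn) (nu_beta : nu + beta <= 1) (nu_kappa : 1 < 2 * nu - 2 * kappa).
Let past := past Xs Zs.
Let nu_ n := cn * pw (- nu) n.
Variables (h : nat -> T -> 'cV[R]_d) (B : nat -> T -> 'M[R]_d) (h0 : 'cV[R]_d).
Hypothesis h_adapted : forall n,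
  measurable_fun setT (h n : g_sigma_algebraType (past n) -> 'cV[R]_d).
Hypothesis B_adapted : forall n,
  measurable_fun setT (B n : g_sigma_algebraType (past n) -> 'M[R]_d).
Hypothesis h_0 : forall w, h 0 w = h0.
Hypothesis h_S : forall n w,
  h n.+1 w = h n w - nu_ n *: (B n w *m Dg (Xs n w) (h n w)).

Let V v := G v - G theta.
Let V_ge0 v : 0 <= V v.
Proof. by rewrite subr_ge0; exact: G_min. Qed.
Let nu_gt0 n : 0 < nu_ n. Proof. by rewrite mulr_gt0 ?pw_gt0. Qed.

Let mG : measurable_fun setT G.
Proof. by apply: continuous_mx_measurable; exact: G_continuous. Qed.
Let mV : measurable_fun setT V.
Proof. by apply: measurable_funB. Qed.
Let mgrad : measurable_fun setT (gradient G).
Proof.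
apply: measurable_mxP => i j; rewrite ord1.
by apply: continuous_mx_measurable; exact: gradient_continuous.
Qed.

Lemma newton_step_le n (v : 'cV[R]_d) (S : 'M[R]_d) :
  (\int[P]_w (V (v - nu_ n *: (S *m Dg (X w) v)))%:E <=
   (V v - nu_ n * quad S (gradient G v) +
    L / 2 * nu_ n ^+ 2 * normF S ^+ 2 * (C * (1 + V v)))%:E)%E.
Proof.
have mDg : measurable_fun setT (fun w => Dg (X w) v).
  by apply: (measurableT_comp Dg_meas (g := fun w => (X w, v))); exact: measurable_fun_pair.
have EY := has_expectationD (has_expectation_cst P (V v))
  (has_expectationZ (- nu_ n) (has_expectation_mxdot (S^T *m gradient G v) (Dg_mean v))).
have -> : V v - nu_ n * quad S (gradient G v) =
    V v + - nu_ n * mxdot (S^T *m gradient G v) (gradient G v).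
  by rewrite mxdot_mulmxl trmxK mulNr.
have N1 : ('E_P[fun w => (normF (Dg (X w) v) ^+ 2)%R] <= (C * (1 + V v))%:E)%E.
  by have := Dg_growth v; under eq_fun do rewrite norm2E; rewrite addrA.
apply: (expectation_le _ _ EY _ _ N1).
- apply/measurable_EFinP; apply: (measurableT_comp mV); apply: measurable_mxD => //.
  apply: measurable_mxN; apply: measurable_mxZ => //; exact: measurable_mulmx.
- by move=> w; rewrite lee_fin.
- by apply: measurable_funX; exact: measurable_normF.
- by move=> w; exact: sqr_ge0.
- rewrite mulr_ge0 ?sqr_ge0 // mulr_ge0 ?sqr_ge0 // divr_ge0 //; exact: ltW.
apply: nearW => w; rewrite lee_fin /V -!addrA [leRHS]addrCA addrC -lerBlDr opprK subrK.
have := descent G_diff2 hessian_le v (- (nu_ n *: (S *m Dg (X w) v))).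
move=> /le_trans; apply; rewrite -addrA lerD2l.
rewrite mxdotNr mxdotZr normFN normFZ mxdot_mulmxl trmxK mulNr lerD2l.
rewrite (ger0_norm (ltW (nu_gt0 n))) exprMn mulrA -[leRHS]mulrA -exprMn.
apply: ler_wpM2l; first by rewrite mulr_ge0 ?sqr_ge0 // divr_ge0 // ltW.
by rewrite ler_pXn2r ?nnegrE ?mulr_ge0 ?normF_ge0 // normF_mulmx.
Qed.

Section fixed_bounds.
Variable j : nat.
Let C0 : R := j.+1%:R.
Let C0_gt0 : 0 < C0. Proof. by rewrite ltr0n. Qed.

(* The random bounds on [B n], with a deterministic constant: almost every w
   satisfies all of them once [j] is large. *)
Definition step_ok n w : bool :=
  (normF (B n w) <= j.+1%:R * pw kappa n) && ((j <= n)%N ==>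
  (pw (- beta) n / j.+1%:R * normF (gradient G (h n w)) ^+ 2 <=
     quad (B n w) (gradient G (h n w)))).

(** Tests the times below n only, so that [steps_ok n.+1] is known at time n, before the sample of
    index n is used. *)
Fixpoint steps_ok n w : bool := if n is m.+1 then steps_ok m w && step_ok m w else true.

(** Zero before time [j], where no lower bound on [B n] is demanded. *)
Definition gain n : R := if (n < j)%N then 0 else nu_ n * (pw (- beta) n / j.+1%:R).

Let gain_ge0 n : 0 <= gain n.
Proof.
rewrite /gain; case: ifP => // _; rewrite mulr_ge0 ?divr_ge0 ?pw_ge0 //.
exact: ltW.
Qed.

Let steps_ok_meas n : measurable_fun setT
  (steps_ok n.+1 : g_sigma_algebraType (past n) -> bool).
Proof.
have gm m : measurable_fun setT
    ((fun w => gradient G (h m w)) : g_sigma_algebraType (past m) -> 'cV[R]_d).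
  exact: (measurableT_comp mgrad).
have ok m : measurable_fun setT (step_ok m : g_sigma_algebraType (past m) -> bool).
  apply: measurable_and.
    by apply: measurable_fun_ler => //; exact: measurable_normF.
  case: (j <= m)%N => /=; last exact: measurable_cst.
  apply: measurable_fun_ler.
    by apply: measurable_funM => //; apply: measurable_funX; exact: measurable_normF.
  by apply: measurable_mxdot => //; exact: measurable_mulmx.
elim: n => [|n IH]; first by apply: measurable_and.
by apply: measurable_and => //; apply: measurable_past_next.
Qed.

(** The gap is killed at the first failure of the bounds. As it is nonnegative and the failure is
    known beforehand, this preserves the almost supermartingale inequality. *)
Let W n w := if steps_ok n w then V (h n w) else 0.
Let D n w := if steps_ok n.+1 w then gain n * normF (gradient G (h n w)) ^+ 2 else 0.

Lemma newton_robbins_siegmund : {ae P, forall w, [/\ exists C', forall n, W n w <= C',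
    exists C', forall n, \sum_(k < n) D k w <= C' &
    (forall e N, 0 < e -> exists2 n, (N <= n)%N & W n w < e) ->
      W ^~ w @ \oo --> 0]}.
Proof.
(* [c1] gathers the second-order term under |B_n| <= C0 (n+1)^kappa; [c2] comes from |quad B grad|
   <= |B| |grad|^2 <= |B| 2 L V. *)
pose c1 := L / 2 * C * C0 ^+ 2 * cn ^+ 2; pose c2 := 2 * L * C0 * cn.
have c1_ge0 : 0 <= c1 by rewrite !mulr_ge0 ?sqr_ge0 ?invr_ge0 // ltW.
have c2_ge0 : 0 <= c2 by rewrite !mulr_ge0 // ltW.
pose b n := c1 * pw (- 2 * nu + 2 * kappa) n.
(* Before time [j] the first-order term may have the wrong sign; it is then at most a multiple of
   the gap, and only finitely many such terms occur. *)
pose a n := b n + (if (n < j)%N then c2 * pw (- nu + kappa) n else 0).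
have b_ge0 n : 0 <= b n by rewrite mulr_ge0 ?pw_ge0.
have a2_ge0 n : 0 <= c2 * pw (- nu + kappa) n by rewrite mulr_ge0 ?pw_ge0.
pose f n (s : (('cV[R]_d * 'M[R]_d) * bool) * ('cV[R]_p * 'cV[R]_d)) :=
  if s.1.2 then V (s.1.1.1 - nu_ n *: (s.1.1.2 *m Dg s.2.1 s.1.1.1)) +
    gain n * normF (gradient G s.1.1.1) ^+ 2 else 0.
pose c n (s : ('cV[R]_d * 'M[R]_d) * bool) :=
  if s.2 then V s.1.1 - nu_ n * quad s.1.2 (gradient G s.1.1) +
    L / 2 * nu_ n ^+ 2 * normF s.1.2 ^+ 2 * (C * (1 + V s.1.1)) +
    gain n * normF (gradient G s.1.1) ^+ 2 else 0.
have gn0 n v : 0 <= gain n * normF (gradient G v) ^+ 2.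
  by rewrite mulr_ge0 ?sqr_ge0.
apply: (robbins_siegmund_steps (X := X) Xs_indep Xs_law Zs_indep XZ_indep
    (S := fun n w => ((h n w, B n w), steps_ok n.+1 w)) (f := f) (c := c)
    (a := a) (b := b)).
- move=> n; apply: measurable_fun_pair; last exact: steps_ok_meas.
  exact: measurable_fun_pair.
- move=> n; apply: measurable_fun_ifT => //; first by apply: measurableT_comp.
  have m1 : measurable_fun setT
      (fun s : (('cV[R]_d * 'M[R]_d) * bool) * ('cV[R]_p * 'cV[R]_d) => s.1.1.1).
    by do 2!apply: measurableT_comp => //.
  have m2 : measurable_fun setT
      (fun s : (('cV[R]_d * 'M[R]_d) * bool) * ('cV[R]_p * 'cV[R]_d) => s.1.1.2).
    by do 2!apply: measurableT_comp => //.
  have m3 : measurable_fun setT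
      (fun s : (('cV[R]_d * 'M[R]_d) * bool) * ('cV[R]_p * 'cV[R]_d) => s.2.1).
    by apply: measurableT_comp.
  apply: measurable_funD.
    apply: (measurableT_comp mV); apply: measurable_mxD => //; apply: measurable_mxN.
    apply: measurable_mxZ => //; apply: measurable_mulmx => //.
    apply: (measurableT_comp Dg_meas (g := fun s => (s.2.1, s.1.1.1))).
    exact: measurable_fun_pair.
  apply: measurable_funM => //; apply: measurable_funX; apply: measurable_normF.
  exact: (measurableT_comp mgrad).
- by move=> n s; rewrite /f; case: ifP => // _; rewrite addr_ge0.
- move=> n; apply: measurable_fun_ifT => //.
  have m1 : measurable_fun setT (fun s : ('cV[R]_d * 'M[R]_d) * bool => s.1.1).
    by apply: measurableT_comp.
  have m2 : measurable_fun setT (fun s : ('cV[R]_d * 'M[R]_d) * bool => s.1.2).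
    by apply: measurableT_comp.
  have mg : measurable_fun setT
      (fun s : ('cV[R]_d * 'M[R]_d) * bool => gradient G s.1.1).
    exact: (measurableT_comp mgrad).
  have mv : measurable_fun setT (fun s : ('cV[R]_d * 'M[R]_d) * bool => V s.1.1).
    exact: (measurableT_comp mV).
  apply: measurable_funD; last first.
    by apply: measurable_funM => //; apply: measurable_funX; exact: measurable_normF.
  apply: measurable_funD.
    apply: measurable_funB => //; apply: measurable_funM => //.
    by apply: measurable_mxdot => //; exact: measurable_mulmx.
  apply: measurable_funM; last by apply: measurable_funM => //; exact: measurable_funD.
  by apply: measurable_funM => //; apply: measurable_funX; exact: measurable_normF.
- move=> n; apply: measurable_fun_ifT => //; last exact: (measurableT_comp mV).
  case: n => [|n]; first exact: measurable_cst.
  exact: measurable_past_next.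
- by move=> n w; rewrite /W; case: ifP.
- move=> n; have mgh : measurable_fun setT
      ((fun w => gradient G (h n w)) : g_sigma_algebraType (past n) -> 'cV[R]_d).
    exact: (measurableT_comp mgrad).
  apply: measurable_fun_ifT => //.
  by apply: measurable_funM => //; apply: measurable_funX; exact: measurable_normF.
- by move=> n w; rewrite /D; case: ifP.
- by exists (V h0) => w; rewrite /W /= h_0.
- by move=> n; rewrite /a addr_ge0 //; case: ifP.
- by [].
- apply: bounded_sumsD; last exact: bounded_sums_finite.
  by apply: bounded_sums_pw => //; have := nu_kappa; lra.
- by apply: bounded_sums_pw => //; have := nu_kappa; lra.
- have int1 (e : \bar R) : (\int[P]__ e = e)%E.
    by rewrite (integral_cst P measurableT e) [X in (_ * X)%E]probability_setT mule1.
  move=> n [[v S] [|]]; rewrite /f /c /=; last first.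
    by rewrite !int1.
  rewrite int1.
  have mVn : measurable_fun setT (fun w => V (v - nu_ n *: (S *m Dg (X w) v))).
    apply: (measurableT_comp mV); apply: measurable_mxD => //; apply: measurable_mxN.
    apply: measurable_mxZ => //; apply: measurable_mulmx => //.
    by apply: (measurableT_comp Dg_meas (g := fun w => (X w, v))); exact: measurable_fun_pair.
  under eq_integral do rewrite EFinD.
  rewrite ge0_integralD //; last 3 first.
  - by move=> w _; rewrite lee_fin.
  - exact/measurable_EFinP.
  - by move=> w _; rewrite lee_fin.
  rewrite int1 EFinD leeD2r //.
  exact: newton_step_le.
- move=> n w; rewrite /W /D /f /= -h_S.
  by case: (steps_ok n w && step_ok n w); rewrite ?addr0.
- move=> n w; rewrite /W /c /=; case: ifP => [/andP[-> /andP[Bn low]]|_]; last first.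
    have an : 0 <= a n by rewrite /a addr_ge0 //; case: ifP.
    by case: ifP => _; rewrite ?mulr0 ?add0r // addr_ge0 // mulr_ge0 // addr_ge0.
  have Vn := V_ge0 (h n w); set v := V (h n w) in Vn *.
  have k0 : 0 <= pw kappa n by exact: pw_ge0.
  have sq : L / 2 * nu_ n ^+ 2 * normF (B n w) ^+ 2 * (C * (1 + v)) <= b n * (1 + v).
    have -> : b n * (1 + v) = L / 2 * nu_ n ^+ 2 * (C0 * pw kappa n) ^+ 2 * (C * (1 + v)).
      by rewrite /b /c1 /nu_ pwD mulNr -mulrN !pwX; ring.
    apply: ler_wpM2r; first by apply: mulr_ge0; [exact: ltW|exact: addr_ge0].
    apply: ler_wpM2l; first by rewrite mulr_ge0 ?sqr_ge0 // divr_ge0 // ltW.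
    by rewrite ler_pXn2r ?nnegrE ?mulr_ge0 ?normF_ge0 // ltW.
  suff : gain n * normF (gradient G (h n w)) ^+ 2 - nu_ n * quad (B n w) (gradient G (h n w)) <=
      (if (n < j)%N then c2 * pw (- nu + kappa) n else 0) * v by rewrite /a; lra.
  rewrite /gain; case: ltnP low => [nj _|jn low]; last first.
    by rewrite mul0r -mulrA -mulrBr pmulr_rle0 // subr_le0.
  rewrite mul0r sub0r -mulrN.
  have -> : c2 * pw (- nu + kappa) n * v = nu_ n * (C0 * pw kappa n * (2 * L * v)).
    by rewrite /c2 /nu_ pwD; ring.
  rewrite ler_wpM2l ?(ltW (nu_gt0 n)) //.
  apply: (le_trans (ler_norm _)); rewrite normrN (le_trans (quad_le _ _)) //.
  by rewrite ler_pM ?normF_ge0 ?sqr_ge0 //; exact: gradient_le_gap.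
Qed.

End fixed_bounds.

Lemma newton_cvg :
  {ae P, forall w, exists C', forall n, normF (B n w) <= C' * pw kappa n} ->
  {ae P, forall w, exists N k, [/\ 0 < k & forall n, (N <= n)%N -> forall x,
    k * pw (- beta) n * normF x ^+ 2 <= quad (B n w) x]} ->
  {ae P, forall w, (fun n => normF (h n w - theta)) @ \oo --> 0}.
Proof.
move=> Bbound Blower.
have /ae_foralln RS := newton_robbins_siegmund.
apply: filterS3 RS Bbound Blower => w RS [C' BC'] [N [k [k0 kP]]].
(* One integer serves as starting rank, as upper constant above [C'] and as inverse lower constant
   above 1/k. *)
pose j := maxn N (maxn (Num.truncn C') (Num.truncn k^-1)).
have jN : (N <= j)%N by rewrite leq_maxl.
have jC : C' <= j.+1%:R.
  by rewrite (le_trans (ltW (truncnS_gt _))) // ler_nat ltnS !leq_max leqnn orbT.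
have jk : j.+1%:R^-1 <= k.
  rewrite -[k]invrK lef_pV2 ?posrE ?invr_gt0 ?ltr0n //.
  by rewrite (le_trans (ltW (truncnS_gt _))) // ler_nat ltnS !leq_max leqnn !orbT.
have ok n : steps_ok j n w.
  elim: n => //= n -> /=; apply/andP; split.
    by rewrite (le_trans (BC' n)) // ler_wpM2r ?pw_ge0.
  apply/implyP => jn; apply: le_trans (kP n (leq_trans jN jn) _).
  by rewrite ler_wpM2r ?sqr_ge0 // mulrC ler_wpM2r ?pw_ge0.
have [[C1 UC1] [C2 DC2] conv] := RS j.
have WE n : (if steps_ok j n w then V (h n w) else 0) = V (h n w) by rewrite ok.
apply: (gap_cvg G_diff2 G_convex theta_zero theta_unique L_gt0 hessian_le).
rewrite (_ : (fun n => _) = (fun n => if steps_ok j n w then V (h n w) else 0)); last first.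
  by apply/funext => n; rewrite WE.
apply: conv => e m e0.
have gain0 n : 0 <= gain j n.
  by rewrite /gain; case: ifP => // _; rewrite mulr_ge0 ?divr_ge0 ?pw_ge0 // ltW.
(* The gains are of order n^(-nu-beta) with nu + beta <= 1, hence not summable; [C3] compensates for
   those set to 0 before [j]. *)
have div m' : exists n, m' <= \sum_(k < n) gain j k.
  pose c := cn / j.+1%:R; have c0 : 0 < c by rewrite divr_gt0 ?ltr0n.
  have [C3 C3P] := @bounded_sums_finite R (fun k => c * pw (- (nu + beta)) k) j
    (fun k => mulr_ge0 (ltW c0) (pw_ge0 _ _)).
  have [n nP] := pw_divergent ((m' + C3) / c) nu_beta.
  exists n; move: nP; rewrite ler_pdivrMr // mulrC mulr_sumr => nP.
  rewrite -(lerD2r C3) (le_trans nP) // -lerBlDl -sumrB (le_trans _ (C3P n)) //.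
  apply: ler_sum => i _; rewrite /gain; case: ifP => _; rewrite ?subr0 // subr_le0.
  by rewrite /nu_ opprD pwD /c le_eqVlt; apply/orP; left; apply/eqP; ring.
have VC n : G (h n w) - G theta <= C1 by have := UC1 n; rewrite WE.
have DC n : \sum_(k < n) gain j k * normF (gradient G (h k w)) ^+ 2 <= C2.
  rewrite (le_trans _ (DC2 n)) // ler_sum // => i _.
  by rewrite -[X in if X then _ else _]/(steps_ok j i.+1 w) ok.
have [n nm nV] := gap_liminf G_diff2 G_convex theta_zero theta_unique L_gt0 hessian_le
  gain0 div VC DC m e0.
by exists n => //; rewrite WE.
Qed.

End newton_process.

(** * The algorithm as an adapted process, and the conclusion *)

Section uwasn_process.
Context {dT : measure_display} {T : measurableType dT} {R : realType}
  (P : probability T R) {p d : nat}.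
Variables (Xs : nat -> {RV P >-> 'cV[R]_p}) (Zs : nat -> {RV P >-> 'cV[R]_d})
  (Dg : 'cV[R]_p -> 'cV[R]_d -> 'cV[R]_d) (D2g : 'cV[R]_p -> 'cV[R]_d -> 'M[R]_d)
  (gamma nu beta beta' : nat -> R) (tau tau' : R) (theta0 : 'cV[R]_d) (A0 : 'M[R]_d).
Hypothesis Dg_meas : measurable_fun setT
  (fun xh : 'cV[R]_p * 'cV[R]_d => Dg xh.1 xh.2).
Hypothesis D2g_meas : measurable_fun setT
  (fun xh : 'cV[R]_p * 'cV[R]_d => D2g xh.1 xh.2).
Hypothesis beta'_ge0 : forall n, 0 <= beta' n.
Let state n w := uwasn Dg D2g gamma nu beta beta' tau tau' theta0 A0
  (fun k => Xs k w) (fun k => Zs k w) n.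
Let past := past Xs Zs.

Lemma uwasn_adapted n :
  [/\ measurable_fun setT ((fun w => est (state n w)) : g_sigma_algebraType (past n) -> _),
      measurable_fun setT ((fun w => est_avg (state n w)) : g_sigma_algebraType (past n) -> _),
      measurable_fun setT ((fun w => hinv (state n w)) : g_sigma_algebraType (past n) -> _) &
      measurable_fun setT ((fun w => hinv_avg (state n w)) : g_sigma_algebraType (past n) -> _)].
Proof.
elim: n => [|n [mh mha mA mAa]]; first by split; exact: measurable_cst.
have nh := measurable_past_next mh; have nha := measurable_past_next mha.
have nA := measurable_past_next mA; have nAa := measurable_past_next mAa.
have mX := @Xs_past _ _ _ _ _ _ Xs Zs n; have mZ := @Zs_past _ _ _ _ _ _ Xs Zs n.
have mh' : measurable_fun setT
    ((fun w => est (state n.+1 w)) : g_sigma_algebraType (past n.+1) -> _).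
  apply: measurable_mxD => //; apply: measurable_mxN; apply: measurable_mxZ => //.
  apply: measurable_mulmx => //.
  exact: (measurableT_comp Dg_meas (measurable_fun_pair mX nh)).
have mA' : measurable_fun setT
    ((fun w => hinv (state n.+1 w)) : g_sigma_algebraType (past n.+1) -> _).
  have mQ := measurable_transition D2g_meas mX nha mZ.
  apply: measurable_projF => //; apply: measurable_hinv_step => //.
  exact: measurable_kept.
split=> //.
- by apply: measurable_mxD; exact: measurable_mxZ.
- by apply: measurable_mxD; exact: measurable_mxZ.
Qed.

End uwasn_process.

Lemma normF_weighted_average {R : realType} m n (u v : 'M[R]_(m, n)) (t : R) k : 0 <= t ->
  normF ((1 - log_weight t k.+1) *: u + log_weight t k.+1 *: v) <=
  (1 - log_weight t k.+1) * normF u + log_weight t k.+1 * normF v.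
Proof.
move=> t0; rewrite (le_trans (normFD _ _)) // !normFZ !ger0_norm ?log_weight_ge0 //.
by rewrite subr_ge0 log_weight_le1.
Qed.

Lemma weighted_average_le {R : realType} (t u v b : R) k : 0 <= t -> u <= b -> v <= b ->
  (1 - log_weight t k.+1) * u + log_weight t k.+1 * v <= b.
Proof.
move=> t0 ub vb; have l0 : 0 <= log_weight t k.+1 by exact: log_weight_ge0.
have l1 : 0 <= 1 - log_weight t k.+1 by rewrite subr_ge0 log_weight_le1.
by have := ler_wpM2l l0 vb; have := ler_wpM2l l1 ub; lra.
Qed.

Theorem theorem4p1
  (R : realType) (dT : measure_display) (T : measurableType dT)
  (P : probability T R) (p d : nat)
  (* model; [Dg] and [D2g] are measurable versions of the gradient and the
     Hessian of g in its second variable, tied to g by [g_diff] *)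
  (X : {RV P >-> 'cV[R]_p})
  (g : 'cV[R]_p -> 'cV[R]_d -> R)
  (Dg : 'cV[R]_p -> 'cV[R]_d -> 'cV[R]_d)
  (D2g : 'cV[R]_p -> 'cV[R]_d -> 'M[R]_d)
  (G : 'cV[R]_d -> R) (theta : 'cV[R]_d)
  (g_meas : forall h, measurable_fun setT (fun x => g x h))
  (Dg_meas : measurable_fun setT
    (fun xh : 'cV[R]_p * 'cV[R]_d => Dg xh.1 xh.2))
  (D2g_meas : measurable_fun setT
    (fun xh : 'cV[R]_p * 'cV[R]_d => D2g xh.1 xh.2))
  (g_convex : {ae P, forall w, convex_fun (g (X w))})
  (g_diff : forall h, exists Om : set 'cV[R]_p,
    [/\ measurable Om, P (X @^-1` Om) = 1%E &
        forall x, Om x ->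
          [/\ twice_differentiable (g x) h, Dg x h = gradient (g x) h &
              D2g x h = hessian (g x) h]])
  (G_def : forall h, has_expectation P (fun w => g (X w) h) (G h))
  (G_convex : convex_fun G)
  (G_gradient : forall h,
    has_expectation_mx P (fun w => Dg (X w) h) (gradient G h))
  (G_hessian : forall h,
    has_expectation_mx P (fun w => D2g (X w) h) (hessian G h))
  (theta_zero : gradient G theta = 0)
  (theta_unique : forall h, gradient G h = 0 -> h = theta)
  (* data; [Xs n] and [Zs n] are X_(n+1) and Z_(n+1) *)
  (Xs : nat -> {RV P >-> 'cV[R]_p}) (Zs : nat -> {RV P >-> 'cV[R]_d})
  (Xs_indep : mutually_independent P (fun n => Xs n : T -> 'cV[R]_p))
  (Xs_law : forall n, same_law P (Xs n) X)
  (Zs_indep : mutually_independent P (fun n => Zs n : T -> 'cV[R]_d))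
  (Zs_law : forall n m, same_law P (Zs n) (Zs m))
  (XZ_indep : independent_processes P (fun n => Xs n : T -> 'cV[R]_p)
                                      (fun n => Zs n : T -> 'cV[R]_d))
  (Zs_bounded : exists M : R, forall n, {ae P, forall w, norm2 (Zs n w) <= M})
  (Zs_mean : forall n, has_expectation_mx P (Zs n) 0)
  (Zs_cov : forall n,
    has_expectation_mx P (fun w => Zs n w *m (Zs n w)^T) 1%:M)
  (* parameters *)
  (c_gamma gamma c_nu nu c_beta beta c_beta' beta' tau tau' : R)
  (c_gamma_gt0 : 0 < c_gamma) (gamma_bnd : 2^-1 < gamma < 1)
  (c_nu_gt0 : 0 < c_nu) (c_beta_gt0 : 0 < c_beta) (c_beta'_gt0 : 0 < c_beta')
  (gamma_ := power_seq c_gamma (- gamma)) (nu_ := power_seq c_nu (- nu))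
  (beta_ := power_seq c_beta beta) (beta'_ := power_seq c_beta' beta')
  (gamma_beta : forall n, (1 <= n)%N -> gamma_ n * beta_ n <= 2^-1)
  (gamma_beta' : forall n, (1 <= n)%N ->
    gamma_ n ^+ 2 * beta_ n ^+ 2 * beta'_ n <= gamma_ n)
  (tau_ge0 : 0 <= tau) (tau'_ge0 : 0 <= tau')
  (theta0 : 'cV[R]_d) (A0 : 'M[R]_d) (A0_posdef : posdefmx A0)
  (* (i) *)
  (gradient_growth : exists C : R, 0 < C /\ forall h,
    ('E_P[fun w => (norm2 (Dg (X w) h) ^+ 2)%R] <=
     (C * (1 + G h - G theta))%:E)%E)
  (* (ii) *)
  (G_C2 : (forall h, twice_differentiable G h) /\ continuous (hessian G))
  (hessian_posdef : posdefmx (hessian G theta))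
  (hessian_bounded : exists L : R, 0 < L /\
    forall h, normop (hessian G h) <= L)
  (* (iii) *)
  (hessian_lipschitz : exists r L : R, [/\ 0 < r, 0 < L &
    forall h, norm2 (theta - h) <= r ->
      normop (hessian G h - hessian G theta) <= L * norm2 (theta - h)])
  (* (iv) *)
  (q : R) (q_gt2 : 2 < q)
  (hessian_moment : exists C : R, forall h,
    ('E_P[fun w => (normF (D2g (X w) h) `^ q)%R] <= C%:E)%E)
  (* step exponents *)
  (beta_bnd : (1 - gamma) / (q - 1) < beta < gamma - 2^-1)
  (gamma_nu : 3 / 2 < gamma + nu)
  (nu_bnd : 2^-1 < nu < 1 - beta)
  (beta'_bnd : 1 - gamma < beta' < gamma - 2 * beta)
  (state := fun n w => uwasn Dg D2g gamma_ nu_ beta_ beta'_ tau tau' theta0 A0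
                        (fun k => Xs k w) (fun k => Zs k w) n) :
  {ae P, forall w, est (state n w) @[n --> \oo] --> theta} /\
  {ae P, forall w, est_avg (state n w) @[n --> \oo] --> theta}.
Proof.
have [M0 M0P] := Zs_bounded; have [C [C_gt0 CP]] := gradient_growth.
have [L [L_gt0 LP]] := hessian_bounded; have [Cq0 CqP] := hessian_moment.
have [G_diff2 _] := G_C2.
have [gamma_gt gamma_lt] := andP gamma_bnd; have [beta_gt beta_lt] := andP beta_bnd.
have [nu_gt nu_lt] := andP nu_bnd; have [beta'_gt beta'_lt] := andP beta'_bnd.
have q1 : 0 < q - 1 by lra.
have beta_gt0 : 0 < beta by apply: lt_trans beta_gt; rewrite divr_gt0 // subr_gt0.
have beta_lower : 1 - gamma < beta * (q - 1) by rewrite -ltr_pdivrMr.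
have beta_lt1 : beta < 1 by lra.
(* The midpoint between 1 - gamma and the smaller of beta' and nu - 1/2. *)
have [kappa [kappa_gt kappa_lt kappa_nu]] : exists kappa : R,
    [/\ 1 - gamma < kappa, kappa < beta' & kappa < nu - 2^-1].
  have [bn|nb] := leP beta' (nu - 2^-1).
    by exists ((1 - gamma + beta') / 2); split; lra.
  by exists ((1 - gamma + (nu - 2^-1)) / 2); split; lra.
have beta'_ge0 n : 0 <= beta'_ n by rewrite mulr_ge0 ?powR_ge0 // ltW.
have adapt := uwasn_adapted Xs Zs gamma_ nu_ beta_ tau tau' theta0 A0
  Dg_meas D2g_meas beta'_ge0.
have H : {ae P, forall w,
  (exists2 C', 0 < C' & forall n, normF (hinv (state n w)) <= C' * pw kappa n) /\
  (forall Abar : nat -> 'M[R]_d, (forall n, Abar n.+1 =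
    (1 - log_weight tau n.+1) *: Abar n + log_weight tau n.+1 *: hinv (state n.+1 w)) ->
   exists N k, [/\ 0 < k & forall n, (N <= n)%N -> forall x,
    k * pw (- beta) n * normF x ^+ 2 <= quad (Abar n) x])}.
  (* The bounds [M0] and [Cq0] come without a sign; their absolute values are used instead. *)
  have Zs_bounded' n : {ae P, forall w, norm2 (Zs n w) <= `|M0|}.
    by apply: filterS (M0P n) => w /le_trans; apply; exact: ler_norm.
  have CqP' h : ('E_P[fun w => (normF (D2g (X w) h) `^ q)%R] <= `|Cq0|%:E)%E.
    by apply: le_trans (CqP h) _; rewrite lee_fin ler_norm.
  apply: (hinv_process_bounds (X := X) (h := fun n w => est_avg (state n w)) (A0 := A0)
    Xs_indep Xs_law Zs_indep XZ_indep (normr_ge0 M0) q_gt2 (normr_ge0 Cq0) Zs_bounded'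
    Zs_cov D2g_meas G_hessian (hessian_psd G_diff2 G_convex) CqP' c_gamma_gt0 c_beta_gt0
    c_beta'_gt0 gamma_bnd beta_gt0 beta_lt1 beta_lower _ _ _ _ _ _ _) => //.
  - by move=> n; exact: gamma_beta.
  - by move=> n; exact: gamma_beta'.
  - by move=> n; have [] := adapt n.
  - by move=> n; have [] := adapt n.
  - by have [] := A0_posdef.
  - by lra.
have nu_beta : nu + beta <= 1 by lra.
have nu_kappa : 1 < 2 * nu - 2 * kappa by lra.
have est_cvg : {ae P, forall w, (fun n => normF (est (state n w) - theta)) @ \oo --> 0}.
  apply: (newton_cvg (X := X) (h := fun n w => est (state n w))
    (B := fun n w => hinv_avg (state n w)) (h0 := theta0)
    Xs_indep Xs_law Zs_indep XZ_indep
    Dg_meas G_gradient C_gt0 L_gt0 CP G_diff2 G_convex LP theta_zero theta_unique c_nu_gt0 nu_beta nu_kappa) => //.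
  - by move=> n; have [] := adapt n.
  - by move=> n; have [] := adapt n.
  (* The term normF [A0] covers the initial average. Since kappa >= 0 the bound is nondecreasing in
     n, so convex combinations respect it. *)
  - apply: filterS H => w [[C' C'0 C'P] _]; exists (C' + normF A0) => n.
    have kappa0 : 0 <= kappa by lra.
    elim: n => [|n IH]; first by rewrite /pw powR1 mulr1 /= lerDr ltW.
    apply: (le_trans (normF_weighted_average _ _ _ tau_ge0)).
    set b := (C' + _) * _.
    have h1 : normF (hinv_avg (state n w)) <= b.
      apply: (le_trans IH); rewrite ler_wpM2l ?pw_homo //.
      by rewrite addr_ge0 ?normF_ge0 // ltW.
    have h2 : normF (hinv (state n.+1 w)) <= b.
      by apply: (le_trans (C'P _)); rewrite ler_wpM2r ?pw_ge0 // lerDl normF_ge0.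
    exact: weighted_average_le.
  - by apply: filterS H => w [_]; apply.
split; apply: filterS est_cvg => w cw; apply: cvg_normF => //.
(* The two weights sum to 1, so [theta] can be subtracted inside the average before taking norms. *)
apply: (weighted_average_cvg0 tau'_ge0 _ _ cw) => [n|n]; first exact: normF_ge0.
have -> : est_avg (state n.+1 w) - theta =
    (1 - log_weight tau' n.+1) *: (est_avg (state n w) - theta) +
    log_weight tau' n.+1 *: (est (state n.+1 w) - theta).
  rewrite [LHS]/= !scalerBr addrACA; congr (_ + _).
  by rewrite -opprD -scalerDl subrK scale1r.
exact: normF_weighted_average.
Qed.
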